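(* Let $X$ be any of the spaces $l^p_a$ $(0<p\le\infty)$, $c_{0,a}$, or $X_q$ $(0\le q<\infty)$. Then the set of functions $f\in X$ such that the derivative $f'$ is totally unbounded is a $G_\delta$ and dense subset of $X$. The same holds for the set of non-extendable functions in $X$.
   Context: $D$ is the open unit disc in $\mathbb{C}$. For a holomorphic function $f$ on $D$ write $f(z)=\sum_{n=0}^\infty a_n(f)z^n$. For $0<p<\infty$, $l^p_a$ is the space of holomorphic functions $f$ on $D$ with $\sum_{n=0}^\infty|a_n(f)|^p<\infty$; $l^\infty_a$ is the space of those with $\sup_n|a_n(f)|<\infty$; $c_{0,a}$ is the space of those with $a_n(f)\to0$. For $1\le p\le\infty$, $l^p_a$ carries the norm inherited from the sequence space $l^p$, i.e. the metric $d_p(f,g)=\big(\sum_n|a_n(f)-a_n(g)|^p\big)^{1/p}$ (or $d_\infty(f,g)=\sup_n|a_n(f)-a_n(g)|$ if $p=\infty$); for $0<p<1$ it carries the metric $d_p(f,g)=\sum_n|a_n(f)-a_n(g)|^p$; $c_{0,a}$ carries the norm inherited from $l^\infty_a$. For $0\le q<\infty$, $X_q=\bigcap_{p>q}l^p_a$ with the metric $\sum_{n=0}^\infty\frac1{2^n}\frac{d_{p_n}(f,g)}{1+d_{p_n}(f,g)}$, where $(p_n)$ is a strictly decreasing sequence converging to $q$. A function $g:D\to\mathbb{C}$ is called totally unbounded (on $D$) if for every open disc $B(\zeta,\varepsilon)$ with $\varepsilon>0$ and $\zeta\in\partial D$ and every connected component $Y$ of $B(\zeta,\varepsilon)\cap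 D$ the restriction $g|_Y$ is unbounded. A holomorphic function $f$ on $D$ is called extendable if there exist a domain (nonempty connected open set) $U\subset\mathbb{C}$ with $\partial D\cap U\neq\emptyset$ and a holomorphic function $F$ on $U$ such that $f|_Y=F|_Y$ for some connected component $Y$ of $U\cap D$. Otherwise $f$ is called non-extendable. *)

(* Defs.v *)
From Stdlib Require Import Reals ClassicalEpsilon.
From Coquelicot Require Export Coquelicot.
Open Scope R_scope.

(** * Plane topology *)

Definition unit_disc (z : C) : Prop := Cmod z < 1.
Definition unit_circle (z : C) : Prop := Cmod z = 1.
Definition open_disc (zeta : C) (eps : R) (z : C) : Prop :=
  Cmod (z - zeta)%C < eps.

Definition inter (A B : C -> Prop) (z : C) : Prop := A z /\ B z.

(* The empty set counts as connected; [domain] and [component] exclude it. *)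
Definition connected (A : C -> Prop) : Prop :=
  forall V W : C -> Prop,
    open V -> open W ->
    (forall z, A z -> V z \/ W z) ->
    (exists z, A z /\ V z) -> (exists z, A z /\ W z) ->
    exists z, A z /\ V z /\ W z.

Definition domain (U : C -> Prop) : Prop :=
  open U /\ connected U /\ exists z, U z.

(* [Y] is a connected component of [A]: for some [x] in [A] it is the union
   of all connected subsets of [A] containing [x]. *)
Definition component (A Y : C -> Prop) : Prop :=
  exists x, A x /\
    forall y, Y y <->
      exists S : C -> Prop,
        connected S /\ (forall z, S z -> A z) /\ S x /\ S y.

(** * Holomorphic functions *)

Definition holomorphic_on (U : C -> Prop) (f : C -> C) : Prop :=
  forall z, U z -> @ex_derive C_AbsRing C_NormedModule f z.

(* A function on the disc is represented by its extension by 0 to [C], so that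
   Leibniz equality of representatives is equality on the disc (up to
   functional extensionality). *)
Definition hol_disc (f : C -> C) : Prop :=
  holomorphic_on unit_disc f /\ forall z, ~ unit_disc z -> f z = RtoC 0.

(* The sequence [a] with [f z = sum_n a n * z^n] on the disc; it exists and is
   unique when [f] is holomorphic there. *)
Definition coef (f : C -> C) : nat -> C :=
  epsilon (inhabits (fun _ : nat => RtoC 0))
    (fun a : nat -> C => forall z, unit_disc z ->
       @is_pseries C_AbsRing C_NormedModule a z (f z)).

Definition totally_unbounded (g : C -> C) : Prop :=
  forall (zeta : C) (eps : R), unit_circle zeta -> 0 < eps ->
  forall Y : C -> Prop, component (inter (open_disc zeta eps) unit_disc) Y ->
    ~ exists M : R, forall z, Y z -> Cmod (g z) <= M.

Definition extendable (f : C -> C) : Prop :=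
  exists (U : C -> Prop) (F : C -> C),
    domain U /\ (exists zeta, unit_circle zeta /\ U zeta) /\
    holomorphic_on U F /\
    exists Y : C -> Prop, component (inter U unit_disc) Y /\
      forall z, Y z -> f z = F z.

Definition non_extendable (f : C -> C) : Prop := ~ extendable f.

(** * The function spaces and their metrics *)

(* [x^p] for [0 <= x] and [0 < p]; note that [Rpower 0 p = 1]. *)
Definition rpow (x p : R) : R := if Rlt_dec 0 x then Rpower x p else 0.

Definition lpa (p : R) (f : C -> C) : Prop :=
  hol_disc f /\ ex_series (fun n => rpow (Cmod (coef f n)) p).

Definition linfa (f : C -> C) : Prop :=
  hol_disc f /\ exists M : R, forall n, Cmod (coef f n) <= M.

Definition c0a (f : C -> C) : Prop :=
  hol_disc f /\ filterlim (coef f) eventually (locally (RtoC 0)).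

Definition Xq (q : R) (f : C -> C) : Prop := forall p, q < p -> lpa p f.

Definition dist_lp (p : R) (f g : C -> C) : R :=
  let s := Series (fun n => rpow (Cmod (coef f n - coef g n)%C) p) in
  if Rle_dec 1 p then rpow s (1 / p) else s.

Definition dist_linf (f g : C -> C) : R :=
  real (Sup_seq (fun n => Finite (Cmod (coef f n - coef g n)%C))).

Definition dist_Xq (p : nat -> R) (f g : C -> C) : R :=
  Series (fun n => 1 / 2 ^ n *
    (dist_lp (p n) f g / (1 + dist_lp (p n) f g))).

Inductive is_space :
  ((C -> C) -> Prop) -> ((C -> C) -> (C -> C) -> R) -> Prop :=
| space_lp (p : R) : 0 < p -> is_space (lpa p) (dist_lp p)
| space_linf : is_space linfa dist_linf
| space_c0 : is_space c0a dist_linf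
| space_Xq (q : R) (p : nat -> R) :
    0 <= q -> (forall n, p (S n) < p n) -> is_lim_seq p (Finite q) ->
    is_space (Xq q) (dist_Xq p).

(** * Subsets of a metric space [(X, d)] whose points are functions *)

Definition open_in (X : (C -> C) -> Prop) (d : (C -> C) -> (C -> C) -> R)
    (O : (C -> C) -> Prop) : Prop :=
  forall f, X f -> O f ->
    exists r : R, 0 < r /\ forall g, X g -> d f g < r -> O g.

Definition Gdelta_in (X : (C -> C) -> Prop) (d : (C -> C) -> (C -> C) -> R)
    (A : (C -> C) -> Prop) : Prop :=
  exists O : nat -> (C -> C) -> Prop,
    (forall n, open_in X d (O n)) /\
    forall f, X f -> (A f <-> forall n, O n f).

Definition dense_in (X : (C -> C) -> Prop) (d : (C -> C) -> (C -> C) -> R)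
    (A : (C -> C) -> Prop) : Prop :=
  forall f, X f -> forall r : R, 0 < r ->
    exists g, X g /\ A g /\ d f g < r.

(* Main.v *)
(** The derivative of f is totally unbounded iff it is unbounded on the trace
    on D of each disc of a countable family of discs B(z0, r) with rational
    data, z0 in D and r > 1 - |z0|; by Taylor expansion and the identity
    theorem f is extendable iff, for some such disc, the Taylor coefficients
    c_n of f at z0 satisfy c_n r^n = O(1).  Cauchy's estimate makes
    f |-> c_n continuous for the coefficient sup norm, which each of the
    metrics controls, so both sets are G_delta.

    A totally unbounded derivative prevents extension, so density is needed
    only for the first set.  The lacunary series h = sum 2^(-k) z^(16^k)
    belongs to all the spaces, and |z h'(z)| >= 3/14 8^K on a circle |z| = rho_K with
    rho_K -> 1.  For each disc of the family f' + c h' is bounded on its trace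
    for at most one c, so arbitrarily small c make f' + c h' totally unbounded.

    Complex differentiability yields power series through Goursat's theorem
    for rectangles, applied in the coordinate z = exp w, where circles become
    vertical segments. *)

Require Import Defs.
From Stdlib Require Import Reals Lra Lia ClassicalEpsilon FunctionalExtensionality.
From Stdlib Require Cantor.
From Coquelicot Require Import Coquelicot.

(** * Series of complex numbers *)

(** Density is shown by perturbing an arbitrary f of the space. Approximating by polynomials first
    would fail in the space of bounded coefficients, where polynomials are not dense; adding c h to
    f itself treats all the spaces alike. The admissible c fill an interval, which no sequence
    exhausts, while each disc of the countable family excludes at most one of them.

    The two bases in h answer opposite demands. The coefficients 2^(-k) are geometric, so their p-th
    powers are summable for every p > 0; the derivative has the coefficients 16^k 2^(-k) = 8^k, and
    the gaps between the exponents 16^k let a single term dominate on a well chosen circle.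

    Connected components occur in both definitions. The trace on D of a disc is convex, hence is its
    own only component. For a general domain U the given component of its trace must first be shown
    to come close to a point of the circle inside U; a small disc about that point then takes the
    place of U.

    In the coordinate w the centre z = 0 is sent to infinity on the left, so a circle integral is
    evaluated by moving its vertical segment to the left, where the factor z makes it small. *)

Notation is_Cderive := (@is_derive C_AbsRing C_NormedModule).
Notation ex_Cderive := (@ex_derive C_AbsRing C_NormedModule).
Notation is_Cpseries := (@is_pseries C_AbsRing C_NormedModule).
Notation is_Cseries := (@is_series C_AbsRing C_NormedModule).

Lemma locally_Cmod (z : C) (P : C -> Prop) :
  @locally C_UniformSpace z P <->
  exists d, 0 < d /\ forall w, Cmod (w - z) < d -> P w.
Proof.
split.
- intros H. apply locally_C in H. destruct H as [d Hd].
  exists d; split; [apply cond_pos|]. intros w Hw. apply Hd, Hw.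
- intros [d [Hd H]]. apply locally_C. exists (mkposreal d Hd).
  intros w Hw. apply H, Hw.
Qed.

Lemma is_Cderive_Cmod (f : C -> C) (z l : C) :
  is_Cderive f z l <->
  forall eps, 0 < eps -> exists d, 0 < d /\ forall w, Cmod (w - z) < d ->
    Cmod (f w - f z - (w - z) * l) <= eps * Cmod (w - z).
Proof.
split.
- intros [_ H] eps Heps.
  destruct (H z (fun P HP => HP) (mkposreal eps Heps)) as [d Hd].
  exists d; split; [apply cond_pos|]. intros w Hw. exact (Hd w Hw).
- intros H; split; [apply is_linear_scal_l|].
  intros y Hy eps.
  assert (E := @is_filter_lim_locally_unique C_AbsRing
    (AbsRing_NormedModule C_AbsRing) z y Hy). subst y.
  destruct (H eps (cond_pos eps)) as [d [Hd H']].
  exists (mkposreal d Hd). intros w Hw. exact (H' w Hw).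
Qed.

Lemma filterlim_Cmod {T : Type} (F : (T -> Prop) -> Prop) {FF : Filter F}
    (u : T -> C) (l : C) :
  filterlim u F (@locally C_UniformSpace l) <->
  forall eps, 0 < eps -> F (fun n => Cmod (u n - l) < eps).
Proof.
split.
- intros H eps Heps. apply (H (fun w => Cmod (w - l) < eps)).
  apply locally_Cmod. exists eps; auto.
- intros H P HP. apply locally_Cmod in HP. destruct HP as [d [Hd HP]].
  unfold filtermap. generalize (H d Hd). apply filter_imp. auto.
Qed.

Lemma Cmod_sub_sym (z w : C) : Cmod (z - w) = Cmod (w - z).
Proof. rewrite <- Cmod_opp. f_equal. ring. Qed.

Lemma Cmod_triangle_sub (a b c : C) :
  Cmod (a - c) <= Cmod (a - b) + Cmod (b - c).
Proof.
replace (a - c)%C with ((a - b) + (b - c))%C by ring. apply Cmod_triangle.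
Qed.

Lemma Cmod_sub_ge (a b : C) : Cmod a - Cmod b <= Cmod (a - b).
Proof.
assert (H := Cmod_triangle (a - b) b).
replace (a - b + b)%C with a in H by ring. lra.
Qed.

Lemma Cmod_sub_le (a b : C) : Cmod (a - b) <= Cmod a + Cmod b.
Proof. rewrite <- (Cmod_opp b). apply Cmod_triangle. Qed.

Lemma Cmod_sum_n (a : nat -> C) (n : nat) :
  Cmod (sum_n a n) <= sum_n (fun k => Cmod (a k)) n.
Proof.
induction n as [|n IH].
- rewrite !sum_O. apply Rle_refl.
- rewrite !sum_Sn. eapply Rle_trans; [apply Cmod_triangle|].
  apply Rplus_le_compat_r, IH.
Qed.

Lemma sum_n_le_sum_n (a b : nat -> R) (n : nat) :
  (forall k, (k <= n)%nat -> a k <= b k) -> sum_n a n <= sum_n b n.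
Proof.
induction n as [|n IH]; intros H.
- rewrite !sum_O. apply H; lia.
- rewrite !sum_Sn. apply Rplus_le_compat; [apply IH; intros|]; apply H; lia.
Qed.

Lemma sum_n_le_Series (b : nat -> R) (n : nat) :
  (forall k, 0 <= b k) -> ex_series b -> sum_n b n <= Series b.
Proof.
intros Hb Hs. apply Series_correct in Hs.
apply (is_lim_seq_incr_compare (sum_n b)); [exact Hs|].
intros k. rewrite sum_Sn. unfold plus; simpl. specialize (Hb (S k)). lra.
Qed.

Lemma is_Cpseries_term (a : nat -> C) (z l : C) :
  is_Cpseries a z l <-> is_Cseries (fun n => a n * z ^ n)%C l.
Proof.
assert (E : forall n, (@scal C_AbsRing C_NormedModule (pow_n z n) (a n)
   = a n * z ^ n)%C).
{ intros n. replace (pow_n z n) with (z ^ n)%C.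
  - apply Cmult_comm.
  - induction n as [|n IH]; [reflexivity|]. rewrite Cpow_S, IH. reflexivity. }
unfold is_pseries. split; apply is_series_ext; intros n; rewrite E; reflexivity.
Qed.

Lemma is_Cseries_unique (a : nat -> C) (l1 l2 : C) :
  is_Cseries a l1 -> is_Cseries a l2 -> l1 = l2.
Proof. apply filterlim_locally_unique. Qed.

Lemma is_Cseries_Cmod (a : nat -> C) (l : C) :
  is_Cseries a l <->
  forall eps, 0 < eps ->
    exists N, forall n, (N <= n)%nat -> Cmod (sum_n a n - l) < eps.
Proof. apply (filterlim_Cmod eventually). Qed.

Lemma is_Cseries_Cmod_le (a : nat -> C) (l : C) (M : R) (N : nat) :
  is_Cseries a l -> (forall n, (N <= n)%nat -> Cmod (sum_n a n) <= M) ->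
  Cmod l <= M.
Proof.
intros H HM.
apply le_epsilon. intros eps Heps.
destruct (proj1 (is_Cseries_Cmod a l) H eps Heps) as [N' HN].
specialize (HN (N + N')%nat ltac:(lia)). specialize (HM (N + N')%nat ltac:(lia)).
rewrite Cmod_sub_sym in HN. assert (H1 := Cmod_sub_ge l (sum_n a (N + N'))). lra.
Qed.

Lemma is_Cseries_bound (a : nat -> C) (b : nat -> R) (l : C) :
  is_Cseries a l -> (forall n, Cmod (a n) <= b n) -> ex_series b ->
  Cmod l <= Series b.
Proof.
intros Ha Hb Hs. apply is_Cseries_Cmod_le with (a := a) (N := 0%nat); [exact Ha|].
intros n _. eapply Rle_trans; [apply Cmod_sum_n|].
eapply Rle_trans; [apply sum_n_le_sum_n; intros; apply Hb|].
apply sum_n_le_Series; [|exact Hs].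
intros k. eapply Rle_trans; [apply Cmod_ge_0|apply Hb].
Qed.

Lemma ex_Cseries_le (a : nat -> C) (b : nat -> R) :
  (forall n, Cmod (a n) <= b n) -> ex_series b -> exists l, is_Cseries a l.
Proof.
intros Hab Hb.
exact (@ex_series_le C_AbsRing C_CompleteNormedModule a b Hab Hb).
Qed.

Lemma is_Cseries_plus (a b : nat -> C) (la lb : C) :
  is_Cseries a la -> is_Cseries b lb ->
  is_Cseries (fun n => a n + b n)%C (la + lb)%C.
Proof. apply (@is_series_plus C_AbsRing C_NormedModule). Qed.

Lemma is_Cseries_scal (c : C) (a : nat -> C) (l : C) :
  is_Cseries a l -> is_Cseries (fun n => c * a n)%C (c * l)%C.
Proof. apply (@is_series_scal C_AbsRing C_NormedModule). Qed.

Lemma is_Cpseries_plus_scal (c : C) (a b : nat -> C) (z la lb : C) :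
  is_Cpseries a z la -> is_Cpseries b z lb ->
  is_Cpseries (fun n => a n + c * b n)%C z (la + c * lb)%C.
Proof.
rewrite !is_Cpseries_term. intros Ha Hb.
eapply is_series_ext; [|exact (is_Cseries_plus _ _ _ _ Ha
  (is_Cseries_scal c _ _ Hb))].
intros n. simpl. ring.
Qed.

Lemma bounded_of_tail_bounded (u : nat -> R) (N : nat) (M0 : R) :
  (forall n, (N <= n)%nat -> u n <= M0) -> exists M, forall n, u n <= M.
Proof.
revert M0. induction N as [|N IH]; intros M0 H.
- exists M0. intros n. apply H. lia.
- apply (IH (Rmax M0 (u N))). intros n Hn.
  destruct (Nat.eq_dec n N) as [->|Hne]; [apply Rmax_r|].
  eapply Rle_trans; [apply H; lia|apply Rmax_l].
Qed.

Lemma is_Cseries_bounded (a : nat -> C) (l : C) :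
  is_Cseries a l -> exists M, forall n, Cmod (a n) <= M.
Proof.
intros H. destruct (proj1 (is_Cseries_Cmod a l) H 1 Rlt_0_1) as [N HN].
apply (bounded_of_tail_bounded (fun n => Cmod (a n)) (S N) 2). intros n Hn.
destruct n as [|n]; [lia|].
  assert (E : a (S n) = ((sum_n a (S n) - l) - (sum_n a n - l))%C).
  { rewrite sum_Sn. change plus with Cplus. ring. }
  rewrite E. eapply Rle_trans; [apply Cmod_sub_le|].
  assert (H1 := HN (S n) ltac:(lia)). assert (H2 := HN n ltac:(lia)). lra.
Qed.

Lemma is_Cseries_component (a : nat -> C) (l : C) :
  is_Cseries a l ->
  is_series (fun n => Re (a n)) (Re l) /\ is_series (fun n => Im (a n)) (Im l).
Proof.
intros H. assert (S1 : forall n, sum_n (fun k => Re (a k)) n = Re (sum_n a n)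
   /\ sum_n (fun k => Im (a k)) n = Im (sum_n a n)).
{ induction n as [|n [IH1 IH2]]; [now rewrite !sum_O|].
  rewrite !sum_Sn, IH1, IH2. split; reflexivity. }
split; [refine (proj1 (is_lim_seq_spec _ (Re l)) _)
       |refine (proj1 (is_lim_seq_spec _ (Im l)) _)]; intros eps;
 destruct (proj1 (is_Cseries_Cmod a l) H eps (cond_pos eps)) as [N HN];
 exists N; intros n Hn; specialize (HN n Hn).
- change (Rabs (sum_n (fun k => Re (a k)) n - Re l) < eps).
  rewrite (proj1 (S1 n)). eapply Rle_lt_trans; [|exact HN].
  exact (re_le_Cmod (sum_n a n - l)).
- change (Rabs (sum_n (fun k => Im (a k)) n - Im l) < eps).
  rewrite (proj2 (S1 n)). eapply Rle_lt_trans; [|exact HN].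
  eapply Rle_trans; [|apply Rmax_Cmod]. apply Rmax_r.
Qed.

(* Restricting to real arguments reduces this to real power series. *)
Lemma is_Cpseries_coef_unique (a b : nat -> C) (f : C -> C) (d : R) :
  0 < d ->
  (forall z, Cmod z < d -> is_Cpseries a z (f z)) ->
  (forall z, Cmod z < d -> is_Cpseries b z (f z)) ->
  forall n, a n = b n.
Proof.
intros Hd Ha Hb.
assert (Hc : forall (c : nat -> C) (x : R), Cmod x < d ->
   is_Cpseries c (RtoC x) (f x) -> is_pseries (fun n => Re (c n)) x (Re (f x)) /\
     is_pseries (fun n => Im (c n)) x (Im (f x))).
{ intros c x Hx Hs. apply is_Cpseries_term, is_Cseries_component in Hs.
  destruct Hs as [H1 H2].
  assert (E : forall n, Re (c n * x ^ n)%C = @scal R_Ring R_ModuleSpace (pow_n x n) (Re (c n)) /\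
      Im (c n * x ^ n)%C = @scal R_Ring R_ModuleSpace (pow_n x n) (Im (c n))).
  { intros n. rewrite <- RtoC_pow. replace (pow_n x n) with (x ^ n)
      by (symmetry; apply pow_n_pow). unfold scal, Cmult, Re, Im, RtoC; simpl.
    unfold mult; simpl. split; ring. }
  split; [eapply is_series_ext; [|exact H1]|eapply is_series_ext; [|exact H2]];
   intros n; [exact (proj1 (E n))|exact (proj2 (E n))]. }
(* A radius of convergence [0] would put [d / 2] outside the closed disc of convergence, where the
   terms do not tend to [0]. *)
assert (Hrad : forall (c : nat -> R), ex_pseries c (d / 2) -> Rbar_lt 0 (CV_radius c)).
{ intros c Hc'. destruct (Rbar_lt_le_dec 0 (CV_radius c)) as [H|H]; [exact H|].
  exfalso. apply (CV_disk_outside c (d / 2)).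
  - rewrite Rabs_pos_eq by lra. eapply Rbar_le_lt_trans; [exact H|]. simpl. lra.
  - apply ex_series_lim_0 in Hc'. eapply is_lim_seq_ext; [|exact Hc'].
    intros n. simpl. unfold scal; simpl. unfold mult; simpl. rewrite pow_n_pow. ring. }
assert (Hd2 : Cmod (RtoC (d / 2)) < d) by (rewrite Cmod_R, Rabs_pos_eq; lra).
assert (Hloc : forall (P : R -> Prop), (forall x : R, Cmod x < d -> P x) -> locally 0 P).
{ intros P HP. exists (mkposreal d Hd). intros x Hx. apply HP. rewrite Cmod_R.
  unfold ball in Hx; simpl in Hx. unfold AbsRing_ball, abs, minus, plus, opp in Hx; simpl in Hx.
  rewrite Ropp_0, Rplus_0_r in Hx. exact Hx. }
intros n. apply injective_projections.
- apply (PSeries_ext_recip (fun n => Re (a n)) (fun n => Re (b n))).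
  + apply Hrad. eexists. apply (Hc a _ Hd2 (Ha _ Hd2)).
  + apply Hrad. eexists. apply (Hc b _ Hd2 (Hb _ Hd2)).
  + apply Hloc. intros x Hx.
    rewrite (is_pseries_unique _ _ _ (proj1 (Hc a _ Hx (Ha _ Hx)))).
    now rewrite (is_pseries_unique _ _ _ (proj1 (Hc b _ Hx (Hb _ Hx)))).
- apply (PSeries_ext_recip (fun n => Im (a n)) (fun n => Im (b n))).
  + apply Hrad. eexists. apply (Hc a _ Hd2 (Ha _ Hd2)).
  + apply Hrad. eexists. apply (Hc b _ Hd2 (Hb _ Hd2)).
  + apply Hloc. intros x Hx.
    rewrite (is_pseries_unique _ _ _ (proj2 (Hc a _ Hx (Ha _ Hx)))).
    now rewrite (is_pseries_unique _ _ _ (proj2 (Hc b _ Hx (Hb _ Hx)))).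
Qed.

(** * Differentiation of power series *)

(** Majorant for the second-order remainders in termwise differentiation. Writing [S n] for [n]
    keeps every term positive, as the ratio test requires. *)
Lemma ex_series_sqr_geom (q : R) :
  0 < q < 1 -> ex_series (fun n => INR (S n) ^ 2 * q ^ n).
Proof.
intros Hq.
assert (Hpos : forall n, 0 < INR (S n) ^ 2 * q ^ n).
{ intros n. apply Rmult_lt_0_compat; apply pow_lt; [apply lt_0_INR; lia|lra]. }
apply ex_series_ext with (fun n => Rabs (INR (S n) ^ 2 * q ^ n)).
{ intros n. apply Rabs_pos_eq, Rlt_le, Hpos. }
apply ex_series_DAlembert with q; [lra| |].
{ intros n. apply Rgt_not_eq, Hpos. }
assert (Hl : is_lim_seq (fun n => (1 + / INR (S n)) ^ 2 * q) q).
{ assert (H1 : is_lim_seq (fun n => 1 + / INR (S n)) (1 + 0)).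
  { apply is_lim_seq_plus'; [apply is_lim_seq_const|].
    apply (is_lim_seq_incr_1 (fun n => / INR n)).
    apply (is_lim_seq_inv _ p_infty); [apply is_lim_seq_INR|discriminate]. }
  replace (Finite q) with (Finite ((1 + 0) * ((1 + 0) * 1) * q)) by (f_equal; ring).
  apply is_lim_seq_mult'; [|apply is_lim_seq_const].
  apply is_lim_seq_mult'; [exact H1|].
  apply is_lim_seq_mult'; [exact H1|apply is_lim_seq_const]. }
eapply is_lim_seq_ext; [|exact Hl]. intros n.
assert (Hn : 0 < INR (S n)) by (apply lt_0_INR; lia).
rewrite Rabs_pos_eq by (apply Rlt_le, Rdiv_lt_0_compat; apply Hpos).
rewrite (S_INR (S n)). simpl (q ^ S n). field.
split; [apply pow_nonzero|]; lra.
Qed.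

(** The remainder for [S n] is [v] times the one for [n] plus [n * u ^ (n - 1) * (v - u) ^ 2], and
    [n ^ 2 + n <= (n + 1) ^ 2] closes the induction. The factor [r ^ 2] on the left replaces the
    exponent [n - 2] on the right. *)
Lemma pow_sub_linear_bound (u v : C) (r : R) (n : nat) :
  0 < r -> Cmod u <= r -> Cmod v <= r ->
  Cmod (v ^ n - u ^ n - INR n * u ^ pred n * (v - u)) * r ^ 2 <=
  INR n ^ 2 * r ^ n * Cmod (v - u) ^ 2.
Proof.
intros Hr Hu Hv. induction n as [|n IH].
- simpl. replace (1 - 1 - 0 * 1 * (v - u))%C with (RtoC 0) by ring.
  rewrite Cmod_0. apply Req_le. ring.
- assert (E : (v ^ S n - u ^ S n - INR (S n) * u ^ pred (S n) * (v - u))%C =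
     (v * (v ^ n - u ^ n - INR n * u ^ pred n * (v - u))
       + INR n * u ^ pred n * ((v - u) * (v - u)))%C).
  { rewrite S_INR, RtoC_plus. destruct n as [|n]; simpl pred.
    - simpl. ring.
    - rewrite !Cpow_S. ring. }
  rewrite E.
  assert (H2 : Cmod (INR n * u ^ pred n * ((v - u) * (v - u))) * r ^ 2 <=
      INR n * r ^ S n * Cmod (v - u) ^ 2).
  { rewrite !Cmod_mult, Cmod_pow, Cmod_R, Rabs_pos_eq by apply pos_INR.
    destruct n as [|n]; [simpl; lra|]. simpl pred.
    replace (INR (S n) * r ^ S (S n) * Cmod (v - u) ^ 2)
      with (INR (S n) * r ^ n * (Cmod (v - u) * Cmod (v - u)) * r ^ 2)
      by (simpl; ring).
    apply Rmult_le_compat_r; [apply pow2_ge_0|].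
    apply Rmult_le_compat_r; [apply Rle_0_sqr|].
    apply Rmult_le_compat_l; [apply pos_INR|].
    apply pow_incr. split; [apply Cmod_ge_0|exact Hu]. }
  eapply Rle_trans.
  { apply Rmult_le_compat_r; [apply pow2_ge_0|apply Cmod_triangle]. }
  rewrite Cmod_mult, Rmult_plus_distr_r, Rmult_assoc.
  assert (H3 := Rmult_le_compat _ _ _ _ (Cmod_ge_0 v)
     (Rmult_le_pos _ _ (Cmod_ge_0 _) (pow2_ge_0 r)) Hv IH).
  rewrite S_INR.
  assert (Hn := pos_INR n).
  assert (H4 : 0 <= (INR n + 1) * (r ^ S n * Cmod (v - u) ^ 2)).
  { apply Rmult_le_pos; [lra|]. apply Rmult_le_pos; [|apply pow2_ge_0].
    apply pow_le; lra. }
  simpl pow in *. nra.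
Qed.

(** Convergence at a radius [r2 > r1] bounds [a n * r2 ^ n], so [Cmod (a n) * INR n ^ 2 * r1 ^ n] is
    summable and the remainders add up to a multiple of [Cmod (z - w) ^ 2]. The series of the
    derivative stays in the conclusion because the lower bound for the lacunary derivative is read
    off from it. *)
Lemma Cpseries_is_derive (a : nat -> C) (f : C -> C) (z0 w : C) (r : R) :
  (forall z, Cmod (z - z0) < r -> is_Cpseries a (z - z0)%C (f z)) ->
  Cmod (w - z0) < r ->
  exists l, is_Cderive f w l /\
    is_Cseries (fun n => a n * (INR n * (w - z0) ^ pred n))%C l.
Proof.
intros Hf Hw. set (u := (w - z0)%C) in *.
assert (Hu := Cmod_ge_0 u).
set (r1 := (2 * Cmod u + r) / 3). set (r2 := (Cmod u + 2 * r) / 3).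
assert (Hr1 : Cmod u < r1) by (unfold r1; lra).
assert (Hr2 : r1 < r2 < r) by (unfold r1, r2; lra).
assert (Hb : exists M, forall n, Cmod (a n) * r2 ^ n <= M).
{ assert (H2 : Cmod ((z0 + r2) - z0) < r).
  { replace (z0 + r2 - z0)%C with (RtoC r2) by ring.
    rewrite Cmod_R, Rabs_pos_eq; lra. }
  destruct (is_Cseries_bounded _ _ (proj1 (is_Cpseries_term _ _ _) (Hf _ H2)))
    as [M HM].
  exists M. intros n. specialize (HM n).
  replace (z0 + r2 - z0)%C with (RtoC r2) in HM by ring.
  rewrite Cmod_mult, Cmod_pow, Cmod_R, Rabs_pos_eq in HM by lra. exact HM. }
destruct Hb as [M HM].
set (q := r1 / r2).
assert (Hq : 0 < q < 1).
{ unfold q. split; [apply Rdiv_lt_0_compat; lra|]. apply Rlt_div_l; lra. }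
set (B := fun n => M * (INR (S n) ^ 2 * q ^ n)).
assert (HB : ex_series B).
{ apply (ex_series_scal_l M _ (ex_series_sqr_geom q Hq)). }
assert (Hab : forall n, Cmod (a n) * (INR n ^ 2 * r1 ^ n) <= B n).
{ intros n. unfold B.
  replace (r1 ^ n) with (r2 ^ n * q ^ n)
    by (rewrite <- Rpow_mult_distr; f_equal; unfold q; field; lra).
  replace (Cmod (a n) * (INR n ^ 2 * (r2 ^ n * q ^ n)))
    with ((Cmod (a n) * r2 ^ n) * (INR n ^ 2 * q ^ n)) by ring.
  apply Rmult_le_compat.
  - apply Rmult_le_pos; [apply Cmod_ge_0|apply pow_le; lra].
  - apply Rmult_le_pos; [apply pow2_ge_0|apply pow_le; lra].
  - apply HM.
  - apply Rmult_le_compat_r; [apply pow_le; lra|].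
    apply pow_incr. split; [apply pos_INR|]. rewrite S_INR; lra. }
assert (Hl : exists l, is_Cseries (fun n => a n * (INR n * u ^ pred n))%C l).
{ apply ex_Cseries_le with (fun n => / r1 * B n).
  2: { apply (ex_series_scal_l (/ r1) _ HB). }
  intros n. apply Rmult_le_reg_l with r1; [lra|].
  replace (r1 * (/ r1 * B n)) with (B n) by (field; lra).
  eapply Rle_trans; [|apply Hab].
  rewrite !Cmod_mult, Cmod_pow, Cmod_R, Rabs_pos_eq by apply pos_INR.
  replace (r1 * (Cmod (a n) * (INR n * Cmod u ^ pred n)))
    with (Cmod (a n) * (r1 * (INR n * Cmod u ^ pred n))) by ring.
  apply Rmult_le_compat_l; [apply Cmod_ge_0|].
  destruct n as [|n]; [simpl; lra|]. simpl pred.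
  assert (H1 : 1 <= INR (S n)) by (rewrite S_INR; assert (H := pos_INR n); lra).
  assert (H2 : Cmod u ^ n <= r1 ^ n) by (apply pow_incr; lra).
  assert (H3 : 0 <= Cmod u ^ n) by (apply pow_le; lra).
  assert (H4 : INR (S n) * Cmod u ^ n <= INR (S n) ^ 2 * r1 ^ n).
  { apply Rmult_le_compat; try lra. rewrite <- Rsqr_pow2. unfold Rsqr. nra. }
  change (r1 ^ S n) with (r1 * r1 ^ n). nra. }
destruct Hl as [l Hl]. exists l. split; [|exact Hl].
apply is_Cderive_Cmod. intros eps Heps.
set (K := Series B / r1 ^ 2).
assert (HK : 0 <= K).
{ unfold K. apply Rdiv_le_0_compat; [|apply pow_lt; lra].
  eapply Rle_trans; [|apply (sum_n_le_Series B 0); [|exact HB]].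
  - rewrite sum_O. eapply Rle_trans; [|apply Hab]. simpl. lra.
  - intros k. eapply Rle_trans; [|apply Hab].
    apply Rmult_le_pos; [apply Cmod_ge_0|]. apply Rmult_le_pos; [apply pow2_ge_0|].
    apply pow_le; lra. }
(* The first bound keeps [z - z0] in the disc of radius [r1]; the second gives
   [K * Cmod (z - w) <= eps], with [K + 1] guarding against [K = 0]. *)
exists (Rmin (r1 - Cmod u) (eps / (K + 1))). split.
{ apply Rmin_pos; [lra|]. apply Rdiv_lt_0_compat; lra. }
intros z Hz.
assert (Hz1 : Cmod (z - w) < r1 - Cmod u) by (eapply Rlt_le_trans; [exact Hz|apply Rmin_l]).
assert (Hz2 : Cmod (z - w) < eps / (K + 1)) by (eapply Rlt_le_trans; [exact Hz|apply Rmin_r]).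
assert (Hv : Cmod (z - z0) < r1).
{ assert (H := Cmod_triangle_sub z w z0). fold u in H. lra. }
assert (Hser : is_Cseries (fun n => a n *
    ((z - z0) ^ n - u ^ n - INR n * u ^ pred n * ((z - z0) - u)))%C
    (f z - f w - (z - w) * l)%C).
{ assert (Sz := proj1 (is_Cpseries_term _ _ _) (Hf z ltac:(lra))).
  assert (Sw := proj1 (is_Cpseries_term _ _ _) (Hf w Hw)). fold u in Sw.
  assert (S := is_Cseries_plus _ _ _ _ Sz (is_Cseries_plus _ _ _ _
    (is_Cseries_scal (-(1))%C _ _ Sw) (is_Cseries_scal (- (z - w))%C _ _ Hl))).
  replace (f z - f w - (z - w) * l)%C with
    (f z + (- (1) * f w + - (z - w) * l))%C by ring.
  eapply is_series_ext; [|exact S]. intros n. simpl.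
  unfold u. ring. }
assert (Hbnd : Cmod (f z - f w - (z - w) * l) <= Series (fun n => Cmod (z - w) ^ 2 / r1 ^ 2 * B n)).
{ apply is_Cseries_bound with (1 := Hser).
  - intros n. rewrite Cmod_mult.
    assert (P := pow_sub_linear_bound u (z - z0) r1 n ltac:(lra) ltac:(lra) ltac:(lra)).
    replace (z - z0 - u)%C with (z - w)%C in P |- * by (unfold u; ring).
    apply Rmult_le_reg_r with (r1 ^ 2); [apply pow_lt; lra|].
    replace (Cmod (z - w) ^ 2 / r1 ^ 2 * B n * r1 ^ 2) with (Cmod (z - w) ^ 2 * B n)
      by (field; lra).
    eapply Rle_trans.
    { rewrite Rmult_assoc. apply Rmult_le_compat_l; [apply Cmod_ge_0|exact P]. }
    replace (Cmod (a n) * (INR n ^ 2 * r1 ^ n * Cmod (z - w) ^ 2))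
      with (Cmod (z - w) ^ 2 * (Cmod (a n) * (INR n ^ 2 * r1 ^ n))) by ring.
    apply Rmult_le_compat_l; [apply pow2_ge_0|apply Hab].
  - apply (ex_series_scal_l (Cmod (z - w) ^ 2 / r1 ^ 2) _ HB). }
rewrite Series_scal_l in Hbnd.
eapply Rle_trans; [exact Hbnd|].
replace (Cmod (z - w) ^ 2 / r1 ^ 2 * Series B) with (K * Cmod (z - w) * Cmod (z - w))
  by (unfold K; field; lra).
apply Rmult_le_compat_r; [apply Cmod_ge_0|].
apply Rlt_div_r in Hz2; [|lra].
assert (H := Cmod_ge_0 (z - w)). nra.
Qed.

(** At the centre only the term of index [1] of the derived series survives. This lets estimates of
    Taylor coefficients speak of [C_derive]. *)
Lemma Cpseries_is_derive_center (a : nat -> C) (f : C -> C) (z0 : C) (r : R) :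
  0 < r ->
  (forall z, Cmod (z - z0) < r -> is_Cpseries a (z - z0)%C (f z)) ->
  is_Cderive f z0 (a 1%nat).
Proof.
intros Hr Hf.
assert (H0 : Cmod (z0 - z0) < r).
{ replace (z0 - z0)%C with (RtoC 0) by ring. now rewrite Cmod_0. }
destruct (Cpseries_is_derive a f z0 z0 r Hf H0) as [l [Hd Hl]].
replace (a 1%nat) with l; [exact Hd|].
apply (is_Cseries_unique _ _ _ Hl).
apply is_Cseries_Cmod. intros eps Heps. exists 1%nat. intros n Hn.
replace (sum_n _ n) with (a 1%nat).
- replace (a 1%nat - a 1%nat)%C with (RtoC 0) by ring. now rewrite Cmod_0.
- replace (z0 - z0)%C with (RtoC 0) by ring.
  induction n as [|n IH]; [lia|]. rewrite sum_Sn. destruct n as [|n].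
  + rewrite sum_O. simpl. change plus with Cplus. ring.
  + rewrite <- IH by lia. simpl pred. rewrite Cpow_S. change plus with Cplus. ring.
Qed.

(** * Goursat's theorem for rectangles *)

Definition Ccont (f : C -> C) (z : C) : Prop :=
  forall eps, 0 < eps -> exists d, 0 < d /\
    forall w, Cmod (w - z) < d -> Cmod (f w - f z) < eps.

Definition curve_cont (f : R -> C) (x : R) : Prop :=
  forall eps, 0 < eps -> exists d, 0 < d /\
    forall y, Rabs (y - x) < d -> Cmod (f y - f x) < eps.

Lemma ex_Cderive_cont (f : C -> C) (z : C) : ex_Cderive f z -> Ccont f z.
Proof.
intros [l Hl] eps Heps.
destruct (proj1 (is_Cderive_Cmod f z l) Hl 1 Rlt_0_1) as [d [Hd H]].
assert (Hl0 := Cmod_ge_0 l).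
exists (Rmin d (eps / (2 + Cmod l))). split.
{ apply Rmin_pos; [exact Hd|]. apply Rdiv_lt_0_compat; lra. }
intros w Hw.
assert (H1 := H w (Rlt_le_trans _ _ _ Hw (Rmin_l _ _))).
assert (H2 := Rlt_le_trans _ _ _ Hw (Rmin_r _ _)).
apply Rlt_div_r in H2; [|lra].
assert (H3 := Cmod_sub_ge (f w - f z) ((w - z) * l)). rewrite Cmod_mult in H3.
assert (H4 := Cmod_ge_0 (w - z)).
nra.
Qed.

(** * Integrals of complex-valued functions of a real variable *)

Definition CInt (f : R -> C) (a b : R) : C := @RInt C_R_CompleteNormedModule f a b.
Notation ex_CInt := (@ex_RInt C_R_NormedModule).
Notation is_CInt := (@is_RInt C_R_NormedModule).

Lemma CInt_correct (f : R -> C) (a b : R) :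
  ex_CInt f a b -> is_CInt f a b (CInt f a b).
Proof. apply (@RInt_correct C_R_CompleteNormedModule). Qed.

Lemma is_CInt_unique (f : R -> C) (a b : R) (l : C) :
  is_CInt f a b l -> CInt f a b = l.
Proof. apply (@is_RInt_unique C_R_CompleteNormedModule). Qed.

Lemma ex_CInt_cont (f : R -> C) (a b : R) :
  a <= b -> (forall x, a <= x <= b -> curve_cont f x) -> ex_CInt f a b.
Proof.
intros Hab Hf. apply (@ex_RInt_continuous C_R_CompleteNormedModule).
rewrite Rmin_left, Rmax_right by exact Hab.
intros x Hx. apply (filterlim_Cmod (locally x) f (f x)).
intros eps Heps. destruct (Hf x Hx eps Heps) as [d [Hd H]].
exists (mkposreal d Hd). exact H.
Qed.

Lemma CInt_Cmod_le (f : R -> C) (a b M : R) :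
  a <= b -> ex_CInt f a b -> (forall x, a <= x <= b -> Cmod (f x) <= M) ->
  Cmod (CInt f a b) <= (b - a) * M.
Proof.
intros Hab Hf HM. rewrite Cmod_norm.
apply (@norm_RInt_le_const C_R_NormedModule f a b _ M Hab); [|now apply CInt_correct].
intros x Hx. rewrite <- Cmod_norm. now apply HM.
Qed.

Lemma is_CInt_plus (f g : R -> C) (a b : R) (lf lg : C) :
  is_CInt f a b lf -> is_CInt g a b lg ->
  is_CInt (fun x => f x + g x)%C a b (lf + lg)%C.
Proof. apply (@is_RInt_plus C_R_NormedModule). Qed.

Lemma is_CInt_components (f : R -> C) (a b : R) (l : C) :
  is_RInt (fun x => Re (f x)) a b (Re l) ->
  is_RInt (fun x => Im (f x)) a b (Im l) -> is_CInt f a b l.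
Proof.
intros H1 H2. rewrite (surjective_pairing l).
apply (@is_RInt_fct_extend_pair R_NormedModule R_NormedModule); assumption.
Qed.

(** [C_R_NormedModule] has real scalars, so a complex factor is split into its real and imaginary
    parts. *)
Lemma is_CInt_scal (k : C) (f : R -> C) (a b : R) (l : C) :
  is_CInt f a b l -> is_CInt (fun x => k * f x)%C a b (k * l)%C.
Proof.
intros H.
assert (H1 := @is_RInt_fct_extend_fst R_NormedModule R_NormedModule f a b l H).
assert (H2 := @is_RInt_fct_extend_snd R_NormedModule R_NormedModule f a b l H).
apply is_CInt_components.
- exact (is_RInt_minus _ _ _ _ _ _ (is_RInt_scal _ _ _ (Re k) _ H1)
    (is_RInt_scal _ _ _ (Im k) _ H2)).
- exact (is_RInt_plus _ _ _ _ _ _ (is_RInt_scal _ _ _ (Re k) _ H2)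
    (is_RInt_scal _ _ _ (Im k) _ H1)).
Qed.

Lemma is_CInt_const (k : C) (a b : R) :
  is_CInt (fun _ => k) a b ((b - a)%R * k)%C.
Proof.
replace ((b - a)%R * k)%C with (@scal R_AbsRing C_R_NormedModule (b - a) k).
- apply (@is_RInt_const C_R_NormedModule).
- unfold scal; simpl. unfold prod_scal, scal; simpl. unfold mult; simpl.
  unfold Cmult; simpl. f_equal; ring.
Qed.

(** The midpoint rule is exact on affine functions; in this form the boundary integral of an affine
    function cancels by a field identity. *)
Lemma is_RInt_affine (p q a b : R) :
  is_RInt (fun x => p + x * q) a b ((b - a) * (p + (a + b) / 2 * q)).
Proof.
replace ((b - a) * (p + (a + b) / 2 * q))
  with (minus (p * b + b ^ 2 / 2 * q) (p * a + a ^ 2 / 2 * q)).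
- apply (is_RInt_derive (fun x => p * x + x ^ 2 / 2 * q)).
  + intros x _. auto_derive; [exact I|field].
  + intros x _. apply (ex_derive_continuous (fun y => p + y * q)).
    auto_derive. exact I.
- unfold minus, plus, opp; simpl. field.
Qed.

Lemma is_CInt_affine (p q : C) (a b : R) :
  is_CInt (fun x => p + x * q)%C a b ((b - a)%R * (p + ((a + b) / 2)%R * q))%C.
Proof.
apply is_CInt_components.
- replace (Re _) with ((b - a) * (Re p + (a + b) / 2 * Re q))
    by (unfold Re; simpl; ring).
  eapply is_RInt_ext; [|apply is_RInt_affine].
  intros x _. unfold Re; simpl; ring.
- replace (Im _) with ((b - a) * (Im p + (a + b) / 2 * Im q))
    by (unfold Im; simpl; ring).
  eapply is_RInt_ext; [|apply is_RInt_affine].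
  intros x _. unfold Im; simpl; ring.
Qed.

Lemma CInt_Chasles (f : R -> C) (a b c : R) :
  ex_CInt f a b -> ex_CInt f b c ->
  (CInt f a b + CInt f b c)%C = CInt f a c.
Proof. apply (@RInt_Chasles C_R_CompleteNormedModule). Qed.

(** The integral of [g] dz counterclockwise along the boundary: bottom, right, then top and left
    reversed. On vertical sides dz = i dy, whence the factor [Ci]. *)
Definition rect_int (g : C -> C) (a b c d : R) : C :=
  (CInt (fun x => g (x, c)) a b + Ci * CInt (fun y => g (b, y)) c d
   - CInt (fun x => g (x, d)) a b - Ci * CInt (fun y => g (a, y)) c d)%C.

Definition cont_on_rect (g : C -> C) (a b c d : R) : Prop :=
  forall x y, a <= x <= b -> c <= y <= d -> Ccont g (x, y).

Lemma Cmod_horizontal (x x' y : R) : Cmod ((x, y) - (x', y)) = Rabs (x - x').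
Proof.
replace ((x, y) - (x', y))%C with (RtoC (x - x')); [apply Cmod_R|].
apply injective_projections; simpl; ring.
Qed.

Lemma Cmod_vertical (x y y' : R) : Cmod ((x, y) - (x, y')) = Rabs (y - y').
Proof.
replace ((x, y) - (x, y'))%C with (Ci * RtoC (y - y'))%C.
- rewrite Cmod_mult, Cmod_Ci, Cmod_R. ring.
- apply injective_projections; simpl; ring.
Qed.

Lemma ex_CInt_horizontal (g : C -> C) (a b c d y : R) :
  cont_on_rect g a b c d -> a <= b -> c <= y <= d ->
  ex_CInt (fun x => g (x, y)) a b.
Proof.
intros Hg Hab Hy. apply ex_CInt_cont; [exact Hab|].
intros x Hx eps Heps. destruct (Hg x y Hx Hy eps Heps) as [e [He H]].
exists e. split; [exact He|]. intros x' Hx'. apply H.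
now rewrite Cmod_horizontal.
Qed.

Lemma ex_CInt_vertical (g : C -> C) (a b c d x : R) :
  cont_on_rect g a b c d -> c <= d -> a <= x <= b ->
  ex_CInt (fun y => g (x, y)) c d.
Proof.
intros Hg Hcd Hx. apply ex_CInt_cont; [exact Hcd|].
intros y Hy eps Heps. destruct (Hg x y Hx Hy eps Heps) as [e [He H]].
exists e. split; [exact He|]. intros y' Hy'. apply H.
now rewrite Cmod_vertical.
Qed.

(** Each inner side is traversed twice, in opposite directions. *)
Lemma rect_int_split (g : C -> C) (a m b c n d : R) :
  cont_on_rect g a b c d -> a <= m <= b -> c <= n <= d ->
  rect_int g a b c d =
  (rect_int g a m c n + rect_int g m b c n
   + rect_int g a m n d + rect_int g m b n d)%C.
Proof.
intros Hg Hm Hn. unfold rect_int.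
assert (Hh : forall y, c <= y <= d ->
  CInt (fun x => g (x, y)) a b
  = (CInt (fun x => g (x, y)) a m + CInt (fun x => g (x, y)) m b)%C).
{ intros y Hy. symmetry. apply CInt_Chasles.
  - apply (ex_CInt_horizontal g a m c d y); try tauto.
    intros x y' Hx. apply Hg. lra.
  - apply (ex_CInt_horizontal g m b c d y); try tauto.
    intros x y' Hx. apply Hg. lra. }
assert (Hv : forall x, a <= x <= b ->
  CInt (fun y => g (x, y)) c d
  = (CInt (fun y => g (x, y)) c n + CInt (fun y => g (x, y)) n d)%C).
{ intros x Hx. symmetry. apply CInt_Chasles.
  - apply (ex_CInt_vertical g a b c n x); try tauto.
    intros x' y Hx' Hy. apply Hg; lra.
  - apply (ex_CInt_vertical g a b n d x); try tauto.
    intros x' y Hx' Hy. apply Hg; lra. }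
rewrite (Hh c), (Hh d), (Hv a), (Hv b) by lra. ring.
Qed.

(* Affine functions have zero boundary integral, so only the remainder of the
   first-order expansion at [w0] contributes. *)
Lemma rect_int_local (g : C -> C) (w0 l : C) (a c s t eps r : R) :
  0 <= s -> 0 <= t -> 0 <= eps -> cont_on_rect g a (a + s) c (c + t) ->
  a <= fst w0 <= a + s -> c <= snd w0 <= c + t -> s + t < r ->
  (forall w, Cmod (w - w0) < r ->
     Cmod (g w - g w0 - (w - w0) * l) <= eps * Cmod (w - w0)) ->
  Cmod (rect_int g a (a + s) c (c + t)) <= 2 * eps * (s + t) ^ 2.
Proof.
intros Hs Ht Heps Hg Hx0 Hy0 Hr Hl.
(* [A] is minus the affine part, so [g + A] is the remainder, at most [eps * (s + t)] on the
   rectangle; the perimeter [2 * (s + t)] supplies the other factor of the bound. *)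
set (A := fun w => (- (g w0 + (w - w0) * l))%C).
assert (Hclose : forall x y, a <= x <= a + s -> c <= y <= c + t ->
   Cmod (g (x, y) + A (x, y)) <= eps * (s + t)).
{ intros x y Hx Hy.
  assert (Hd : Cmod ((x, y) - w0) <= s + t).
  { eapply Rle_trans; [apply (Cmod_triangle_sub _ (fst w0, y))|].
    rewrite Cmod_horizontal.
    replace w0 with (fst w0, snd w0) at 3 by (destruct w0; reflexivity).
    rewrite Cmod_vertical.
    apply Rplus_le_compat; apply Rabs_le; lra. }
  replace (g (x, y) + A (x, y))%C with (g (x, y) - g w0 - ((x, y) - w0) * l)%C
    by (unfold A; ring).
  eapply Rle_trans; [apply Hl; lra|]. apply Rmult_le_compat_l; lra. }
assert (HAh : forall y, is_CInt (fun x => A (x, y)) a (a + s)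
   (s * (A (0, y) + ((a + (a + s)) / 2)%R * - l))%C).
{ intros y. replace s with (a + s - a) at 2 by ring.
  eapply is_RInt_ext; [|apply is_CInt_affine].
  intros x _. unfold A. apply injective_projections; simpl; ring. }
assert (HAv : forall x, is_CInt (fun y => A (x, y)) c (c + t)
   (t * (A (x, 0) + ((c + (c + t)) / 2)%R * - (Ci * l)))%C).
{ intros x. replace t with (c + t - c) at 2 by ring.
  eapply is_RInt_ext; [|apply is_CInt_affine].
  intros y _. unfold A. apply injective_projections; simpl; ring. }
assert (Hh : forall y, c <= y <= c + t -> exists I,
   CInt (fun x => g (x, y)) a (a + s) =
     (I - s * (A (0, y) + ((a + (a + s)) / 2)%R * - l))%C
   /\ Cmod I <= s * (eps * (s + t))).
{ intros y Hy.
  assert (Ex := ex_CInt_horizontal g _ _ _ _ y Hg ltac:(lra) Hy).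
  assert (S := is_CInt_plus _ _ _ _ _ _ (CInt_correct _ _ _ Ex) (HAh y)).
  exists (CInt (fun x => g (x, y) + A (x, y))%C a (a + s)). split.
  - rewrite (is_CInt_unique _ _ _ _ S). ring.
  - replace s with (a + s - a) at 2 by ring.
    apply CInt_Cmod_le; [lra|eexists; exact S|]. intros x Hx. now apply Hclose. }
assert (Hv : forall x, a <= x <= a + s -> exists I,
   CInt (fun y => g (x, y)) c (c + t) =
     (I - t * (A (x, 0) + ((c + (c + t)) / 2)%R * - (Ci * l)))%C
   /\ Cmod I <= t * (eps * (s + t))).
{ intros x Hx.
  assert (Ex := ex_CInt_vertical g _ _ _ _ x Hg ltac:(lra) Hx).
  assert (S := is_CInt_plus _ _ _ _ _ _ (CInt_correct _ _ _ Ex) (HAv x)).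
  exists (CInt (fun y => g (x, y) + A (x, y))%C c (c + t)). split.
  - rewrite (is_CInt_unique _ _ _ _ S). ring.
  - replace t with (c + t - c) at 2 by ring.
    apply CInt_Cmod_le; [lra|eexists; exact S|]. intros y Hy. now apply Hclose. }
unfold rect_int.
destruct (Hh c ltac:(lra)) as [I1 [-> B1]].
destruct (Hh (c + t) ltac:(lra)) as [I3 [-> B3]].
destruct (Hv a ltac:(lra)) as [I4 [-> B4]].
destruct (Hv (a + s) ltac:(lra)) as [I2 [-> B2]].
match goal with |- Cmod ?e <= _ =>
  replace e with ((I1 - I3) + Ci * (I2 - I4))%C end.
- eapply Rle_trans; [apply Cmod_triangle|]. rewrite Cmod_mult, Cmod_Ci.
  assert (H1 := Cmod_sub_le I1 I3). assert (H2 := Cmod_sub_le I2 I4).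
  simpl. nra.
- unfold A. apply injective_projections; simpl; field.
Qed.

Lemma nested_intervals (a b : nat -> R) :
  (forall n, a n <= a (S n)) -> (forall n, b (S n) <= b n) ->
  (forall n, a n <= b n) -> exists x, forall n, a n <= x <= b n.
Proof.
intros Ha Hb Hab.
assert (Ha' : forall n k, a n <= a (n + k)%nat).
{ intros n k. induction k as [|k IH]; [rewrite Nat.add_0_r; lra|].
  rewrite Nat.add_succ_r. eapply Rle_trans; [exact IH|apply Ha]. }
assert (Hb' : forall n k, b (n + k)%nat <= b n).
{ intros n k. induction k as [|k IH]; [rewrite Nat.add_0_r; lra|].
  rewrite Nat.add_succ_r. eapply Rle_trans; [apply Hb|exact IH]. }
assert (Hc : forall n m, a n <= b m).
{ intros n m. eapply Rle_trans; [apply (Ha' n m)|].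
  eapply Rle_trans; [apply Hab|]. rewrite Nat.add_comm. apply Hb'. }
destruct (completeness (fun x => exists n, x = a n)) as [x [Hx1 Hx2]].
- exists (b 0%nat). intros x [n ->]. apply Hc.
- exists (a 0%nat), 0%nat. reflexivity.
- exists x. intros n. split.
  + apply Hx1. now exists n.
  + apply Hx2. intros y [m ->]. apply Hc.
Qed.

(** Bisection as an induction principle on rectangles, given by lower left corner and side lengths.
    If [P] failed, it would fail on some quarter, and so on; the nested rectangles close in on a
    point [(x, y)], near which [P] holds on all small rectangles containing that point. *)
Lemma quadrisection (P : R -> R -> R -> R -> Prop) (a c s t : R) :
  0 <= s -> 0 <= t ->
  (forall a c s t, 0 <= s -> 0 <= t ->
    P a c (s / 2) (t / 2) -> P (a + s / 2) c (s / 2) (t / 2) ->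
    P a (c + t / 2) (s / 2) (t / 2) -> P (a + s / 2) (c + t / 2) (s / 2) (t / 2) ->
    P a c s t) ->
  (forall x y, a <= x <= a + s -> c <= y <= c + t ->
    exists r, 0 < r /\ forall a' c' s' t',
      a <= a' -> a' + s' <= a + s -> c <= c' -> c' + t' <= c + t ->
      0 <= s' -> 0 <= t' -> s' + t' < r ->
      a' <= x <= a' + s' -> c' <= y <= c' + t' -> P a' c' s' t') ->
  P a c s t.
Proof.
intros Hs Ht Hsplit Hloc. apply NNPP. intros HP.
(* The conditions on [q] stand under the existential so that [choice] yields a total successor [F].
   A rectangle whose four quarters satisfy [P] is its own successor, a case that [Hsplit] excludes
   when [P] fails on it. *)
assert (Hstep : forall q : R * R * (R * R), exists q' : R * R * (R * R),
  0 <= fst (snd q) -> 0 <= snd (snd q) ->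
  ~ P (fst (fst q)) (snd (fst q)) (fst (snd q)) (snd (snd q)) ->
  ~ P (fst (fst q')) (snd (fst q')) (fst (snd q')) (snd (snd q')) /\
  snd q' = (fst (snd q) / 2, snd (snd q) / 2) /\
  (fst (fst q') = fst (fst q) \/ fst (fst q') = fst (fst q) + fst (snd q) / 2) /\
  (snd (fst q') = snd (fst q) \/ snd (fst q') = snd (fst q) + snd (snd q) / 2)).
{ intros [[u v] [p q]]. simpl.
  destruct (classic (P u v (p / 2) (q / 2))) as [H1|H1];
   [|exists ((u, v), (p / 2, q / 2)); simpl; auto].
  destruct (classic (P (u + p / 2) v (p / 2) (q / 2))) as [H2|H2];
   [|exists ((u + p / 2, v), (p / 2, q / 2)); simpl; auto].
  destruct (classic (P u (v + q / 2) (p / 2) (q / 2))) as [H3|H3];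
   [|exists ((u, v + q / 2), (p / 2, q / 2)); simpl; auto].
  destruct (classic (P (u + p / 2) (v + q / 2) (p / 2) (q / 2))) as [H4|H4];
   [|exists ((u + p / 2, v + q / 2), (p / 2, q / 2)); simpl; auto].
  exists ((u, v), (p, q)). simpl. intros Hp Hq HN. exfalso. apply HN. now apply Hsplit. }
apply choice in Hstep. destruct Hstep as [F HF].
set (Q := fun n => Nat.iter n F ((a, c), (s, t))).
assert (HQ : forall n, snd (Q n) = (s / 2 ^ n, t / 2 ^ n) /\
  ~ P (fst (fst (Q n))) (snd (fst (Q n))) (fst (snd (Q n))) (snd (snd (Q n)))).
{ induction n as [|n [IH1 IH2]].
  - simpl. split; [f_equal; field|exact HP].
  - destruct (HF (Q n)) as [H1 [H2 _]].
    + rewrite IH1. simpl. apply Rdiv_le_0_compat; [exact Hs|apply pow_lt; lra].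
    + rewrite IH1. simpl. apply Rdiv_le_0_compat; [exact Ht|apply pow_lt; lra].
    + exact IH2.
    + change (Q (S n)) with (F (Q n)). split; [|exact H1].
      rewrite H2, IH1. simpl. f_equal; field; apply pow_nonzero; lra. }
assert (Hp : forall n, 0 < 2 ^ n) by (intros n; apply pow_lt; lra).
assert (Hnest : forall n,
  (fst (fst (Q (S n))) = fst (fst (Q n)) \/
   fst (fst (Q (S n))) = fst (fst (Q n)) + s / 2 ^ S n) /\
  (snd (fst (Q (S n))) = snd (fst (Q n)) \/
   snd (fst (Q (S n))) = snd (fst (Q n)) + t / 2 ^ S n)).
{ intros n. destruct (HQ n) as [E HN].
  destruct (HF (Q n)) as [_ [_ H]].
  - rewrite E. simpl. apply Rdiv_le_0_compat; auto.
  - rewrite E. simpl. apply Rdiv_le_0_compat; auto.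
  - exact HN.
  - change (Q (S n)) with (F (Q n)). rewrite E in H. simpl in H.
    replace (s / 2 ^ S n) with (s / 2 ^ n / 2)
      by (simpl; field; apply Rgt_not_eq, Hp).
    replace (t / 2 ^ S n) with (t / 2 ^ n / 2)
      by (simpl; field; apply Rgt_not_eq, Hp).
    exact H. }
assert (Hh : forall u n, 0 <= u -> 0 <= u / 2 ^ S n /\ u / 2 ^ n = 2 * (u / 2 ^ S n)).
{ intros u n Hu. split; [apply Rdiv_le_0_compat; auto|].
  simpl; field; apply Rgt_not_eq, Hp. }
destruct (nested_intervals (fun n => fst (fst (Q n)))
  (fun n => fst (fst (Q n)) + s / 2 ^ n)) as [x Hx].
{ intros n. destruct (Hnest n) as [[H|H] _]; destruct (Hh s n Hs); lra. }
{ intros n. destruct (Hnest n) as [[H|H] _]; destruct (Hh s n Hs); lra. }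
{ intros n. assert (H := Rdiv_le_0_compat s (2 ^ n) Hs (Hp n)). lra. }
destruct (nested_intervals (fun n => snd (fst (Q n)))
  (fun n => snd (fst (Q n)) + t / 2 ^ n)) as [y Hy].
{ intros n. destruct (Hnest n) as [_ [H|H]]; destruct (Hh t n Ht); lra. }
{ intros n. destruct (Hnest n) as [_ [H|H]]; destruct (Hh t n Ht); lra. }
{ intros n. assert (H := Rdiv_le_0_compat t (2 ^ n) Ht (Hp n)). lra. }
assert (Hin : forall n, a <= fst (fst (Q n)) /\ fst (fst (Q n)) + s / 2 ^ n <= a + s /\
   c <= snd (fst (Q n)) /\ snd (fst (Q n)) + t / 2 ^ n <= c + t).
{ induction n as [|n IH]; [simpl; lra|].
  destruct (Hnest n) as [[H1|H1] [H2|H2]];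
  destruct (Hh t n Ht); destruct (Hh s n Hs); rewrite H1, H2; lra. }
destruct (Hloc x y) as [r [Hr H]].
{ specialize (Hx 0%nat). simpl in Hx. lra. }
{ specialize (Hy 0%nat). simpl in Hy. lra. }
assert (Hn : exists n, s / 2 ^ n + t / 2 ^ n < r).
{ destruct (pow_lt_1_zero (/ 2) ltac:(rewrite Rabs_pos_eq; lra) (r / (s + t + 1))
    ltac:(apply Rdiv_lt_0_compat; lra)) as [N HN].
  specialize (HN N (Nat.le_refl N)).
  rewrite Rabs_pos_eq in HN by (apply pow_le; lra).
  apply Rlt_div_r in HN; [|lra]. exists N.
  rewrite pow_inv in HN. assert (H1 := Rinv_0_lt_compat _ (Hp N)).
  unfold Rdiv. nra. }
destruct Hn as [n Hn].
destruct (HQ n) as [E HN]. apply HN. rewrite E. simpl.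
destruct (Hin n) as [I1 [I2 [I3 I4]]].
apply H; try assumption; try apply Rdiv_le_0_compat; auto.
Qed.

(** The bound [2 * eps * (s + t) ^ 2] is suited to [quadrisection]: for a quarter it is four times
    smaller, and the four quarters restore it. Small rectangles satisfy it by differentiability.
    Containment in the original rectangle is carried as a premise inside the predicate. *)
Theorem goursat_rect (g : C -> C) (a b c d : R) :
  a <= b -> c <= d ->
  (forall x y, a <= x <= b -> c <= y <= d -> ex_Cderive g (x, y)) ->
  rect_int g a b c d = 0.
Proof.
intros Hab Hcd Hg.
assert (Hcont : cont_on_rect g a b c d).
{ intros x y Hx Hy. now apply ex_Cderive_cont, Hg. }
apply Cmod_eq_0. apply Rle_antisym; [|apply Cmod_ge_0].
apply le_epsilon. intros e He. rewrite Rplus_0_l.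
set (s := b - a). set (t := d - c).
(* The final bound is then at most [e]; the summand [1] covers degenerate rectangles. *)
set (eps := e / (2 * (s + t + 1) ^ 2)).
assert (Hst : 0 <= s /\ 0 <= t) by (unfold s, t; lra).
assert (Hst2 : 0 < (s + t + 1) ^ 2) by (apply pow_lt; lra).
assert (Heps : 0 < eps) by (unfold eps; apply Rdiv_lt_0_compat; lra).
assert (H : a <= a /\ a + s <= b /\ c <= c /\ c + t <= d ->
  Cmod (rect_int g a (a + s) c (c + t)) <= 2 * eps * (s + t) ^ 2).
{ apply (quadrisection (fun a' c' s' t' =>
    a <= a' /\ a' + s' <= b /\ c <= c' /\ c' + t' <= d ->
    Cmod (rect_int g a' (a' + s') c' (c' + t')) <= 2 * eps * (s' + t') ^ 2));
  try tauto.
  - intros a' c' s' t' Hs Ht H1 H2 H3 H4 Hin.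
    rewrite (rect_int_split g a' (a' + s' / 2) (a' + s') c' (c' + t' / 2) (c' + t'));
     [|intros x y Hx Hy; apply Hcont; lra|lra|lra].
    specialize (H1 ltac:(lra)). specialize (H2 ltac:(lra)).
    specialize (H3 ltac:(lra)). specialize (H4 ltac:(lra)).
    replace (a' + s' / 2 + s' / 2) with (a' + s') in * by lra.
    replace (c' + t' / 2 + t' / 2) with (c' + t') in * by lra.
    eapply Rle_trans; [apply Cmod_triangle|].
    eapply Rle_trans; [apply Rplus_le_compat_r, Cmod_triangle|].
    eapply Rle_trans; [apply Rplus_le_compat_r, Rplus_le_compat_r, Cmod_triangle|].
    simpl in *. lra.
  - intros x y Hx Hy.
    destruct (Hg x y) as [l Hl]; [unfold s, t in *; lra..|].
    destruct (proj1 (is_Cderive_Cmod g (x, y) l) Hl eps Heps) as [r [Hr H]].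
    exists r. split; [exact Hr|].
    intros a' c' s' t' H1 H2 H3 H4 H5 H6 H7 H8 H9 H10.
    apply (rect_int_local g (x, y) l a' c' s' t' eps r); try assumption; try lra.
    intros x' y' Hx' Hy'. apply Hcont; lra. }
replace (a + s) with b in H by (unfold s; ring).
replace (c + t) with d in H by (unfold t; ring).
eapply Rle_trans; [apply H; lra|].
unfold eps. apply Rle_trans with (e * ((s + t) ^ 2 / (s + t + 1) ^ 2)).
{ apply Req_le. field. lra. }
rewrite <- (Rmult_1_r e) at 2. apply Rmult_le_compat_l; [lra|].
apply Rle_div_l; [exact Hst2|]. rewrite Rmult_1_l. apply pow_incr. lra.
Qed.

(** * Integrals over circles *)

Lemma Ccont_mult (f g : C -> C) (z : C) :
  Ccont f z -> Ccont g z -> Ccont (fun w => f w * g w)%C z.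
Proof.
intros Hf Hg eps Heps.
assert (H1 := Cmod_ge_0 (f z)). assert (H2 := Cmod_ge_0 (g z)).
set (e := Rmin 1 (eps / (Cmod (f z) + Cmod (g z) + 2))).
assert (He : 0 < e).
{ apply Rmin_pos; [lra|]. apply Rdiv_lt_0_compat; lra. }
assert (He1 : e <= 1) by apply Rmin_l.
assert (He2 : e * (Cmod (f z) + Cmod (g z) + 2) <= eps).
{ apply Rle_div_r; [lra|apply Rmin_r]. }
destruct (Hf e He) as [d1 [Hd1 K1]]. destruct (Hg e He) as [d2 [Hd2 K2]].
exists (Rmin d1 d2). split; [now apply Rmin_pos|]. intros w Hw.
specialize (K1 w (Rlt_le_trans _ _ _ Hw (Rmin_l _ _))).
specialize (K2 w (Rlt_le_trans _ _ _ Hw (Rmin_r _ _))).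
replace (f w * g w - f z * g z)%C
  with ((f w - f z) * (g w - g z) + ((f w - f z) * g z + f z * (g w - g z)))%C by ring.
eapply Rle_lt_trans; [apply Cmod_triangle|].
eapply Rle_lt_trans; [apply Rplus_le_compat_l, Cmod_triangle|].
rewrite !Cmod_mult.
assert (H3 := Cmod_ge_0 (f w - f z)). assert (H4 := Cmod_ge_0 (g w - g z)).
nra.
Qed.

Lemma Ccont_comp (f g : C -> C) (z : C) :
  Ccont g z -> Ccont f (g z) -> Ccont (fun w => f (g w)) z.
Proof.
intros Hg Hf eps Heps. destruct (Hf eps Heps) as [d [Hd H]].
destruct (Hg d Hd) as [d' [Hd' H']]. exists d'. split; auto.
Qed.

Lemma is_derive_eps (f : R -> R) (x l eps : R) :
  is_derive f x l -> 0 < eps ->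
  exists d, 0 < d /\ forall h, Rabs h < d ->
    Rabs (f (x + h) - f x - h * l) <= eps * Rabs h.
Proof.
intros [_ H] Heps. destruct (H x (fun P HP => HP) (mkposreal eps Heps)) as [d Hd].
exists d. split; [apply cond_pos|]. intros h Hh.
assert (E : x + h - x = h) by ring.
rewrite <- E at 2 3. apply (Hd (x + h)). change (Rabs (x + h - x) < d). now rewrite E.
Qed.

Lemma Cmod_le_components (z : C) : Cmod z <= Rabs (fst z) + Rabs (snd z).
Proof.
replace z with ((fst z, 0) + (0, snd z))%C at 1.
- eapply Rle_trans; [apply Cmod_triangle|]. apply Req_le. f_equal.
  + rewrite <- Cmod_R. reflexivity.
  + replace (0, snd z) with (Ci * snd z)%C.
    * rewrite Cmod_mult, Cmod_Ci, Cmod_R. ring.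
    * apply injective_projections; simpl; ring.
- apply injective_projections; simpl; ring.
Qed.

(** * The complex exponential *)

Definition cexp (w : C) : C := (exp (fst w) * cos (snd w), exp (fst w) * sin (snd w)).

Lemma cexp_plus (w v : C) : cexp (w + v) = (cexp w * cexp v)%C.
Proof.
unfold cexp. simpl. rewrite exp_plus, cos_plus, sin_plus.
apply injective_projections; simpl; ring.
Qed.

Lemma Cmod_cexp (w : C) : Cmod (cexp w) = exp (fst w).
Proof.
unfold Cmod, cexp. simpl fst. simpl snd.
replace ((exp (fst w) * cos (snd w)) ^ 2 + (exp (fst w) * sin (snd w)) ^ 2)
  with (exp (fst w) ^ 2 * ((sin (snd w))² + (cos (snd w))²)) by (unfold Rsqr; ring).
rewrite sin2_cos2, Rmult_1_r. apply sqrt_pow2, Rlt_le, exp_pos.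
Qed.

Lemma cexp_nz (w : C) : cexp w <> 0.
Proof. apply Cmod_gt_0. rewrite Cmod_cexp. apply exp_pos. Qed.

Lemma cexp_pow (x y : R) (n : nat) : (cexp (x, y) ^ n)%C = cexp ((INR n * x)%R, (INR n * y)%R).
Proof.
induction n as [|n IH].
- simpl. rewrite !Rmult_0_l. unfold cexp. simpl.
  rewrite exp_0, cos_0, sin_0. apply injective_projections; simpl; ring.
- rewrite Cpow_S, IH, <- cexp_plus, S_INR. f_equal.
  apply injective_projections; simpl; ring.
Qed.

Lemma cexp_inv (x y : R) : (/ cexp (x, y))%C = cexp ((- x)%R, (- y)%R).
Proof.
assert (H : (cexp (x, y) * cexp ((- x)%R, (- y)%R))%C = 1).
{ rewrite <- cexp_plus. unfold cexp. simpl. rewrite !Rplus_opp_r, exp_0, cos_0, sin_0.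
  apply injective_projections; simpl; ring. }
rewrite <- (Cmult_1_l (cexp ((- x)%R, (- y)%R))), <- (Cinv_l (cexp (x, y))) by apply cexp_nz.
rewrite <- Cmult_assoc, H. ring.
Qed.

Lemma cexp_period (x : R) : cexp (x, 2 * PI) = cexp (x, 0).
Proof. unfold cexp. simpl. now rewrite cos_2PI, sin_2PI, cos_0, sin_0. Qed.

(** The derivative at [0] comes from the first-order expansions of [exp], [cos] and [sin]; the
    functional equation carries it to every point. *)
Lemma is_Cderive_cexp (w : C) : is_Cderive cexp w (cexp w).
Proof.
assert (H0 : forall eps, 0 < eps -> exists d, 0 < d /\ forall v, Cmod v < d ->
   Cmod (cexp v - 1 - v) <= eps * Cmod v).
(* Each of the two components of the remainder is bounded by [3 * e * m], where [m = Cmod v].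
   Requiring [m < e / 2] gives [Rabs (exp x - 1) <= e]. *)
{ intros eps Heps. set (e := Rmin 1 (eps / 6)).
  assert (He : 0 < e) by (apply Rmin_pos; lra).
  assert (He1 : e <= 1) by apply Rmin_l. assert (He2 : e <= eps / 6) by apply Rmin_r.
  destruct (is_derive_eps exp 0 1 e) as [d1 [Hd1 K1]];
   [auto_derive; [exact I|rewrite exp_0; ring]|exact He|].
  destruct (is_derive_eps cos 0 0 e) as [d2 [Hd2 K2]];
   [auto_derive; [exact I|rewrite sin_0; ring]|exact He|].
  destruct (is_derive_eps sin 0 1 e) as [d3 [Hd3 K3]];
   [auto_derive; [exact I|rewrite cos_0; ring]|exact He|].
  assert (Hm : 0 < Rmin (Rmin d1 d2) (Rmin d3 (e / 2))).
  { repeat apply Rmin_pos; lra. }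
  exists (Rmin (Rmin d1 d2) (Rmin d3 (e / 2))). split; [exact Hm|].
  intros v Hv.
  assert (Hv1 : Cmod v < d1) by (eapply Rlt_le_trans; [exact Hv|];
    eapply Rle_trans; [apply Rmin_l|apply Rmin_l]).
  assert (Hv2 : Cmod v < d2) by (eapply Rlt_le_trans; [exact Hv|];
    eapply Rle_trans; [apply Rmin_l|apply Rmin_r]).
  assert (Hv3 : Cmod v < d3) by (eapply Rlt_le_trans; [exact Hv|];
    eapply Rle_trans; [apply Rmin_r|apply Rmin_l]).
  assert (Hv4 : Cmod v < e / 2) by (eapply Rlt_le_trans; [exact Hv|];
    eapply Rle_trans; [apply Rmin_r|apply Rmin_r]).
  assert (Hx : Rabs (fst v) <= Cmod v) by exact (re_le_Cmod v).
  assert (Hy : Rabs (snd v) <= Cmod v)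
    by (eapply Rle_trans; [apply Rmax_r|apply Rmax_Cmod]).
  destruct v as [x y]. simpl fst in *. simpl snd in *. set (m := Cmod (x, y)) in *.
  specialize (K1 x ltac:(lra)). specialize (K2 y ltac:(lra)). specialize (K3 y ltac:(lra)).
  rewrite !Rplus_0_l, ?exp_0, ?cos_0, ?sin_0, ?Rmult_0_r, ?Rmult_1_r, ?Rminus_0_r in *.
  assert (Hex : Rabs (exp x - 1) <= e).
  { replace (exp x - 1) with ((exp x - 1 - x) + x) by ring.
    eapply Rle_trans; [apply Rabs_triang|]. assert (H := Rabs_pos x). nra. }
  assert (Hex2 : 0 < exp x <= 2).
  { split; [apply exp_pos|]. apply Rabs_le_between in Hex. lra. }
  eapply Rle_trans; [apply Cmod_le_components|].
  assert (B1 : Rabs (exp x * cos y - 1 - x) <= 3 * e * m).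
  { replace (exp x * cos y - 1 - x) with (exp x * (cos y - 1) + (exp x - 1 - x)) by ring.
    eapply Rle_trans; [apply Rabs_triang|]. rewrite Rabs_mult, (Rabs_pos_eq (exp x)) by lra.
    assert (H1 : exp x * Rabs (cos y - 1) <= 2 * (e * m)).
    { apply Rmult_le_compat; try apply Rabs_pos; try lra. nra. }
    nra. }
  assert (B2 : Rabs (exp x * sin y - y) <= 3 * e * m).
  { replace (exp x * sin y - y) with (exp x * (sin y - y) + (exp x - 1) * y) by ring.
    eapply Rle_trans; [apply Rabs_triang|]. rewrite !Rabs_mult, (Rabs_pos_eq (exp x)) by lra.
    assert (H1 : exp x * Rabs (sin y - y) <= 2 * (e * m)).
    { apply Rmult_le_compat; try apply Rabs_pos; try lra. nra. }
    assert (H2 : Rabs (exp x - 1) * Rabs y <= e * m).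
    { apply Rmult_le_compat; try apply Rabs_pos; lra. }
    lra. }
  replace (fst (cexp (x, y) - 1 - (x, y))%C) with (exp x * cos y - 1 - x)
    by (simpl; ring).
  replace (snd (cexp (x, y) - 1 - (x, y))%C) with (exp x * sin y - y)
    by (simpl; ring).
  assert (Hm0 : 0 <= m) by apply Cmod_ge_0. nra. }
apply is_Cderive_Cmod. intros eps Heps.
assert (Hw := exp_pos (fst w)).
destruct (H0 (eps / exp (fst w)) ltac:(apply Rdiv_lt_0_compat; lra)) as [d [Hd H]].
exists d. split; [exact Hd|]. intros z Hz.
replace (cexp z) with (cexp w * cexp (z - w))%C.
- replace (cexp w * cexp (z - w) - cexp w - (z - w) * cexp w)%C
    with (cexp w * (cexp (z - w) - 1 - (z - w)))%C by ring.
  rewrite Cmod_mult, Cmod_cexp.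
  replace (eps * Cmod (z - w)) with (exp (fst w) * (eps / exp (fst w) * Cmod (z - w)))
    by (field; lra).
  apply Rmult_le_compat_l; [lra|]. now apply H.
- rewrite <- cexp_plus. f_equal. ring.
Qed.

(* Coquelicot puts two normed module structures on [C] over itself. *)
Lemma is_Cderive_AbsRing (f : C -> C) (z l : C) :
  @is_derive C_AbsRing (AbsRing_NormedModule C_AbsRing) f z l <-> is_Cderive f z l.
Proof. split; intros [_ H]; (split; [apply is_linear_scal_l|exact H]). Qed.

Lemma ex_Cderive_mult (f g : C -> C) (z : C) :
  ex_Cderive f z -> ex_Cderive g z -> ex_Cderive (fun w => f w * g w)%C z.
Proof.
intros [lf Hf] [lg Hg]. eexists. apply is_Cderive_AbsRing.
apply is_Cderive_AbsRing in Hf. apply is_Cderive_AbsRing in Hg.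
exact (@is_derive_mult C_AbsRing f g z lf lg Hf Hg Cmult_comm).
Qed.

Lemma ex_Cderive_comp (f g : C -> C) (z : C) :
  ex_Cderive f (g z) -> ex_Cderive g z -> ex_Cderive (fun w => f (g w)) z.
Proof.
intros [lf Hf] [lg Hg]. eexists. apply is_Cderive_AbsRing in Hg.
exact (@is_derive_comp C_AbsRing C_NormedModule f g z lf lg Hf Hg).
Qed.

Lemma Ci_neq_0 : Ci <> 0.
Proof. intros H. injection H. lra. Qed.

(** In Goursat's theorem for the rectangle over [[x1, x2]] of height [2 * PI], the two horizontal
    sides cancel by periodicity. *)
Lemma strip_int_const (g : C -> C) (x1 x2 : R) :
  x1 <= x2 -> (forall x y, x1 <= x <= x2 -> ex_Cderive g (x, y)) ->
  (forall x, g (x, 2 * PI) = g (x, 0)) ->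
  CInt (fun y => g (x1, y)) 0 (2 * PI) = CInt (fun y => g (x2, y)) 0 (2 * PI).
Proof.
intros Hx Hg Hp.
assert (H := goursat_rect g x1 x2 0 (2 * PI) Hx ltac:(assert (H := PI_RGT_0); lra)
  ltac:(intros; now apply Hg)).
unfold rect_int in H.
replace (fun x => g (x, 2 * PI)) with (fun x => g (x, 0)) in H
  by (apply functional_extensionality; intros; now rewrite Hp).
set (I1 := CInt (fun y => g (x1, y)) 0 (2 * PI)) in *.
set (I2 := CInt (fun y => g (x2, y)) 0 (2 * PI)) in *.
assert (H' : (Ci * (I2 - I1))%C = 0) by (rewrite <- H; ring).
assert (E : (I2 - I1)%C = 0).
{ rewrite <- (Cmult_1_l (I2 - I1)), <- (Cinv_l Ci) by apply Ci_neq_0.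
  rewrite <- Cmult_assoc, H'. ring. }
replace I2 with ((I2 - I1) + I1)%C by ring. rewrite E. ring.
Qed.

(** Compactness of the segment over [x0] makes the modulus of continuity uniform in [y]. Continuity
    of [g] is assumed over [x0] alone, so integrability at a nearby [x] is a premise. *)
Lemma strip_int_continuous (g : C -> C) (x0 eps : R) :
  (forall y, Ccont g (x0, y)) -> 0 < eps ->
  exists d, 0 < d /\ forall x, Rabs (x - x0) < d -> ex_CInt (fun y => g (x, y)) 0 (2 * PI) ->
    Cmod (CInt (fun y => g (x, y)) 0 (2 * PI) - CInt (fun y => g (x0, y)) 0 (2 * PI)) <= eps.
Proof.
intros Hg Heps.
assert (Hpi := PI_RGT_0).
(* Each coordinate of the integrand varies by less than [e], the integrand by at most [2 * e], over
   a length of [2 * PI]. *)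
set (e := eps / (4 * PI)).
assert (He : 0 < e) by (apply Rdiv_lt_0_compat; lra).
assert (Huc : forall (p : C -> R), (forall z w : C, Rabs (p z - p w) <= Cmod (z - w)) ->
  exists d : posreal, forall x y, 0 <= y <= 2 * PI -> Rabs (x - x0) < d ->
     Rabs (p (g (x, y)) - p (g (x0, y))) < e).
{ intros p Hp.
  destruct (uniform_continuity_2d_1d (fun y x => p (g (x, y))) 0 (2 * PI) x0)
    with (eps := mkposreal e He) as [d H].
  - intros y _ e'. destruct (Hg y e' (cond_pos e')) as [d [Hd H]].
    assert (Hd2 : 0 < d / 2) by lra. exists (mkposreal _ Hd2). intros u v Hu Hv.
    simpl in Hu, Hv.
    eapply Rle_lt_trans; [apply Hp|]. apply H.
    eapply Rle_lt_trans; [apply Cmod_le_components|]. simpl.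
    unfold Rminus in Hu, Hv. lra.
  - exists d. intros x y Hy Hx.
    assert (Hx' := Hx). apply Rabs_lt_between in Hx'. assert (Hd := cond_pos d).
    apply (H y x0 y x); try lra. rewrite Rminus_diag, Rabs_R0. exact Hd. }
destruct (Huc fst) as [d1 H1].
{ intros z w. exact (re_le_Cmod (z - w)). }
destruct (Huc snd) as [d2 H2].
{ intros z w. eapply Rle_trans; [|apply Rmax_Cmod]. apply Rmax_r. }
exists (Rmin d1 d2). split; [apply Rmin_pos; apply cond_pos|]. intros x Hx Ex.
assert (Ex0 : ex_CInt (fun y => g (x0, y)) 0 (2 * PI)).
{ apply (ex_CInt_vertical g x0 x0); try lra. intros x' y Hx' _.
  replace x' with x0 by lra. apply Hg. }
assert (S := is_CInt_plus _ _ _ _ _ _ (CInt_correct _ _ _ Ex)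
  (is_CInt_scal (- (1))%C _ _ _ _ (CInt_correct _ _ _ Ex0))).
replace (_ - _)%C with (CInt (fun y => g (x, y) + - (1) * g (x0, y))%C 0 (2 * PI)).
2: { rewrite (is_CInt_unique _ _ _ _ S). ring. }
replace eps with ((2 * PI - 0) * (2 * e)) by (unfold e; field; lra).
apply CInt_Cmod_le; [lra|eexists; exact S|]. intros y Hy.
replace (g (x, y) + - (1) * g (x0, y))%C with (g (x, y) - g (x0, y))%C by ring.
eapply Rle_trans; [apply Cmod_le_components|].
specialize (H1 x y Hy (Rlt_le_trans _ _ _ Hx (Rmin_l _ _))).
specialize (H2 x y Hy (Rlt_le_trans _ _ _ Hx (Rmin_r _ _))).
simpl. unfold Rminus in H1, H2. lra.
Qed.

(* In the coordinate [z = cexp w], circles about the origin become vertical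
   segments; the puncture [a] lies on a single vertical line, which continuity
   lets us cross. *)
Lemma circle_int_removable (q : C -> C) (a : C) (R0 x : R) :
  (forall z, Cmod z < R0 -> Ccont q z) ->
  (forall z, Cmod z < R0 -> z <> a -> ex_Cderive q z) ->
  exp x < R0 ->
  CInt (fun y => q (cexp (x, y)) * cexp (x, y))%C 0 (2 * PI) = 0.
Proof.
intros Hc Hd Hx.
set (g := fun w => (q (cexp w) * cexp w)%C).
set (phi := fun t => CInt (fun y => g (t, y)) 0 (2 * PI)).
change (phi x = 0).
assert (Hpi := PI_RGT_0).
assert (HE : forall t y, Cmod (cexp (t, y)) = exp t) by (intros; apply Cmod_cexp).
assert (Hcont : forall t y, exp t < R0 -> Ccont g (t, y)).
{ intros t y Ht. apply Ccont_mult.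
  - apply Ccont_comp; [apply ex_Cderive_cont; eexists; apply is_Cderive_cexp|].
    apply Hc. now rewrite HE.
  - apply ex_Cderive_cont; eexists; apply is_Cderive_cexp. }
assert (Hint : forall t, exp t < R0 -> ex_CInt (fun y => g (t, y)) 0 (2 * PI)).
{ intros t Ht. apply (ex_CInt_vertical g t t); try lra. intros x' y Hx' _.
  replace x' with t by lra. now apply Hcont. }
assert (Hexp : forall u v, u <= v -> exp u <= exp v).
{ intros u v [H| ->]; [left; now apply exp_increasing|lra]. }
assert (Hstep : forall t1 t2, t1 <= t2 -> exp t2 < R0 ->
  (forall t, t1 <= t <= t2 -> exp t <> Cmod a) -> phi t1 = phi t2).
{ intros t1 t2 H12 H2 Ha. apply strip_int_const; [exact H12| |].
  - intros t y Ht. apply ex_Cderive_mult; [|eexists; apply is_Cderive_cexp].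
    apply ex_Cderive_comp; [|eexists; apply is_Cderive_cexp].
    apply Hd.
    + rewrite HE. eapply Rle_lt_trans; [apply Hexp, Ht|exact H2].
    + intros E. apply (Ha t Ht). now rewrite <- E, HE.
  - intros t. unfold g. now rewrite cexp_period. }
(* [al] is the abscissa of the line carrying the puncture. From [t], Goursat reaches [al - m] or
   [al + m] without touching that line, since [m] is at most the distance from [t] to [al];
   continuity at [al] bridges the rest. *)
assert (Hcross : forall al, exp al = Cmod a -> forall t, exp t < R0 -> exp al < R0 -> phi t = phi al).
{ intros al Hal t Ht Hal0.
  destruct (Req_dec t al) as [->|Hne]; [reflexivity|].
  assert (Z : Cmod (phi t - phi al) = 0).
  { apply Rle_antisym; [|apply Cmod_ge_0]. apply le_epsilon. intros eps Heps.
    rewrite Rplus_0_l.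
    destruct (strip_int_continuous g al eps (fun y => Hcont al y Hal0) Heps) as [d [Hd0 H]].
    set (m := Rmin (d / 2) (Rabs (t - al))).
    assert (Hm : 0 < m).
    { apply Rmin_pos; [lra|]. apply Rabs_pos_lt. lra. }
    assert (Hm1 : m <= d / 2) by apply Rmin_l.
    assert (Hm2 : m <= Rabs (t - al)) by apply Rmin_r.
    assert (Hinj : forall s, s <> al -> exp s <> Cmod a).
    { intros s Hs E. apply Hs. apply exp_inv. now rewrite Hal. }
    destruct (Rle_lt_dec t al) as [Hle|Hlt].
    - rewrite Rabs_left1 in Hm2 by lra.
      rewrite (Hstep t (al - m)).
      + apply H; [rewrite Rabs_left1; lra|]. apply Hint.
        eapply Rle_lt_trans; [apply (Hexp _ al); lra|exact Hal0].
      + lra.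
      + eapply Rle_lt_trans; [apply (Hexp _ al); lra|exact Hal0].
      + intros s Hs. apply Hinj. lra.
    - rewrite Rabs_pos_eq in Hm2 by lra.
      rewrite <- (Hstep (al + m) t).
      + apply H; [rewrite Rabs_pos_eq; lra|]. apply Hint.
        eapply Rle_lt_trans; [apply (Hexp _ t); lra|exact Ht].
      + lra.
      + exact Ht.
      + intros s Hs. apply Hinj. lra. }
  apply Cmod_eq_0 in Z. replace (phi t) with (phi t - phi al + phi al)%C by ring.
  rewrite Z. ring. }
(* The puncture matters only if [0 < Cmod a < R0]: [cexp] never vanishes, and a puncture of modulus
   at least [R0] lies to the right of the strip. *)
assert (Hconst : forall t, t <= x -> phi t = phi x).
{ intros t Ht.
  assert (Htx : exp t < R0) by (eapply Rle_lt_trans; [apply Hexp, Ht|exact Hx]).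
  destruct (Req_dec (Cmod a) 0) as [E0|E0].
  - apply Hstep; [exact Ht|exact Hx|]. intros s _. rewrite E0.
    apply Rgt_not_eq, exp_pos.
  - assert (Ha := Cmod_ge_0 a).
    assert (Hal : exp (ln (Cmod a)) = Cmod a) by (apply exp_ln; lra).
    destruct (Rlt_le_dec (Cmod a) R0) as [Hin|Hout].
    + rewrite (Hcross _ Hal t Htx), (Hcross _ Hal x Hx); [reflexivity|lra..].
    + apply Hstep; [exact Ht|exact Hx|]. intros s Hs E.
      assert (H := Hexp s x ltac:(lra)). lra. }
assert (HR0 : 0 < R0) by (eapply Rlt_trans; [apply exp_pos|exact Hx]).
apply Cmod_eq_0. apply Rle_antisym; [|apply Cmod_ge_0].
apply le_epsilon. intros eps Heps. rewrite Rplus_0_l.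
destruct (Hc 0) with (eps := 1) as [d [Hd0 Hq]]; [rewrite Cmod_0; lra|lra|].
assert (HK := Cmod_ge_0 (q 0)).
set (K := Cmod (q 0) + 1) in *.
(* On the circle of radius [m] the function [q] is bounded by [K], so the integral is at most
   [2 * PI * K * m <= eps]; [m <= exp x] keeps [ln m] to the left of [x]. *)
set (m := Rmin (Rmin (d / 2) (exp x)) (eps / (2 * PI * K))).
assert (HKpos : 0 < K) by (unfold K; lra).
assert (Hm : 0 < m).
{ apply Rmin_pos; [apply Rmin_pos; [lra|apply exp_pos]|].
  apply Rdiv_lt_0_compat; [lra|]. apply Rmult_lt_0_compat; lra. }
assert (Hm1 : m <= d / 2) by (eapply Rle_trans; [apply Rmin_l|apply Rmin_l]).
assert (Hm2 : m <= exp x) by (eapply Rle_trans; [apply Rmin_l|apply Rmin_r]).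
assert (Hm3 : m <= eps / (2 * PI * K)) by apply Rmin_r.
assert (Hlnm : exp (ln m) = m) by now apply exp_ln.
rewrite <- (Hconst (ln m)).
2: { rewrite <- (ln_exp x). apply ln_le; lra. }
assert (Hb : Cmod (CInt (fun y => g (ln m, y)) 0 (2 * PI)) <= (2 * PI - 0) * (K * m)).
{ apply CInt_Cmod_le; [lra|apply Hint; rewrite Hlnm; lra|].
  intros y _. unfold g. rewrite Cmod_mult, HE, Hlnm.
  apply Rmult_le_compat_r; [lra|].
  specialize (Hq (cexp (ln m, y))).
  replace (cexp (ln m, y) - 0)%C with (cexp (ln m, y)) in Hq by ring.
  rewrite HE, Hlnm in Hq. specialize (Hq ltac:(lra)).
  assert (H := Cmod_sub_ge (q (cexp (ln m, y))) (q 0)). unfold K. lra. }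
apply Rle_div_r in Hm3; [|apply Rmult_lt_0_compat; lra].
unfold phi. lra.
Qed.

(** * Taylor expansion *)

Lemma is_CInt_sum_n (F : nat -> R -> C) (a b : R) (l : nat -> C) (n : nat) :
  (forall k, is_CInt (F k) a b (l k)) ->
  is_CInt (fun x => sum_n (fun k => F k x) n) a b (sum_n l n).
Proof.
intros H. induction n as [|n IH].
- rewrite sum_O. eapply is_RInt_ext; [|apply H]. intros x _. now rewrite sum_O.
- rewrite sum_Sn. eapply is_RInt_ext; [|exact (is_CInt_plus _ _ _ _ _ _ IH (H (S n)))].
  intros x _. now rewrite sum_Sn.
Qed.

Lemma curve_bounded (f : R -> C) (a b : R) :
  a <= b -> (forall x, a <= x <= b -> curve_cont f x) ->
  exists B, forall x, a <= x <= b -> Cmod (f x) <= B.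
Proof.
intros Hab Hf. destruct (continuity_ab_maj (fun x => Cmod (f x)) a b Hab) as [M [HM _]].
- intros x Hx. apply continuity_pt_filterlim, filterlim_locally. intros eps.
  destruct (Hf x Hx eps (cond_pos eps)) as [d [Hd H]].
  exists (mkposreal d Hd). intros y Hy. specialize (H y Hy).
  assert (H1 := Cmod_sub_ge (f y) (f x)). assert (H2 := Cmod_sub_ge (f x) (f y)).
  rewrite Cmod_sub_sym in H2.
  change (Rabs (Cmod (f y) - Cmod (f x)) < eps). apply Rabs_lt_between. lra.
- exists (Cmod (f M)). exact HM.
Qed.

(** Orthogonality of powers on a circle: for [k > 0] the integrand has an explicit primitive of
    period [2 * PI]. *)
Lemma is_CInt_cexp_pow (x : R) (k : nat) :
  is_CInt (fun y => (/ cexp (x, y)) ^ k)%C 0 (2 * PI)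
    (if Nat.eq_dec k 0 then RtoC (2 * PI) else RtoC 0).
Proof.
destruct (Nat.eq_dec k 0) as [->|Hk].
- replace (RtoC (2 * PI)) with ((2 * PI - 0)%R * 1)%C by (rewrite Rminus_0_r; ring).
  apply is_CInt_const.
- assert (HkR : INR k <> 0) by now apply not_0_INR.
  apply is_RInt_ext with (fun y => cexp ((INR k * - x)%R, (INR k * - y)%R)).
  { intros y _. now rewrite cexp_inv, cexp_pow. }
  set (m := exp (INR k * - x)).
  assert (P := fun u : R => sin_period u k). assert (P' := fun u : R => cos_period u k).
  apply is_CInt_components.
  + replace (Re 0) with (minus (m * sin (INR k * (2 * PI)) / INR k)
       (m * sin (INR k * 0) / INR k)).
    * apply (is_RInt_derive (fun y => m * sin (INR k * y) / INR k)
        (fun y => Re (cexp ((INR k * - x)%R, (INR k * - y)%R)))).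
      -- intros y _. unfold Re, cexp. simpl. fold m.
         auto_derive; [exact I|]. replace (INR k * - y) with (- (INR k * y)) by ring.
         rewrite cos_neg. field. exact HkR.
      -- intros y _. apply (ex_derive_continuous (fun y => m * cos (INR k * - y))).
         auto_derive. exact I.
    * replace (INR k * (2 * PI)) with (0 + 2 * INR k * PI) by ring.
      rewrite P. rewrite Rmult_0_r, sin_0. unfold minus, plus, opp; simpl.
      field. exact HkR.
  + replace (Im 0) with (minus (m * cos (INR k * (2 * PI)) / INR k)
       (m * cos (INR k * 0) / INR k)).
    * apply (is_RInt_derive (fun y => m * cos (INR k * y) / INR k)
        (fun y => Im (cexp ((INR k * - x)%R, (INR k * - y)%R)))).
      -- intros y _. unfold Im, cexp. simpl. fold m.
         auto_derive; [exact I|]. replace (INR k * - y) with (- (INR k * y)) by ring.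
         rewrite sin_neg. field. exact HkR.
      -- intros y _. apply (ex_derive_continuous (fun y => m * sin (INR k * - y))).
         auto_derive. exact I.
    * replace (INR k * (2 * PI)) with (0 + 2 * INR k * PI) by ring.
      rewrite P', Rmult_0_r, cos_0. unfold minus, plus, opp; simpl.
      field. exact HkR.
Qed.

Lemma geom_sum_C (u : C) (n : nat) :
  ((1 - u) * sum_n (fun k => u ^ k) n)%C = (1 - u ^ S n)%C.
Proof.
induction n as [|n IH].
- rewrite sum_O. simpl. ring.
- rewrite sum_Sn. change plus with Cplus. rewrite Cmult_plus_distr_l, IH.
  rewrite !Cpow_S. ring.
Qed.

(** Cauchy's coefficient integral of f(z) / z^(n+1) over the circle of radius [r] about [0], divided
    by 2 pi i; the substitution dz = i z dy absorbs one power of z. *)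
Definition circle_coef (f : C -> C) (r : R) (n : nat) : C :=
  (RtoC (/ (2 * PI)) *
   CInt (fun y => f (cexp (ln r, y)) * (/ cexp (ln r, y)) ^ n) 0 (2 * PI))%C.

(** With [l] the derivative of [f] at [a], this value fills the removable singularity. *)
Definition diff_quot (f : C -> C) (a l z : C) : C :=
  if excluded_middle_informative (z = a) then l else ((f z - f a) / (z - a))%C.

Lemma diff_quot_neq (f : C -> C) (a l z : C) :
  z <> a -> diff_quot f a l z = ((f z - f a) / (z - a))%C.
Proof.
intros H. unfold diff_quot. now destruct (excluded_middle_informative (z = a)).
Qed.

Lemma Csub_neq_0 (z a : C) : z <> a -> (z - a)%C <> 0.
Proof.
intros H E. apply H. replace z with (z - a + a)%C by ring. rewrite E. ring.
Qed.

Lemma diff_quot_cont (f : C -> C) (a l : C) :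
  is_Cderive f a l -> Ccont (diff_quot f a l) a.
Proof.
intros Hl eps Heps.
destruct (proj1 (is_Cderive_Cmod f a l) Hl (eps / 2) ltac:(lra)) as [d [Hd H]].
exists d. split; [exact Hd|]. intros w Hw.
replace (diff_quot f a l a) with l
  by (unfold diff_quot; now destruct (excluded_middle_informative (a = a))).
destruct (excluded_middle_informative (w = a)) as [->|Hne].
- unfold diff_quot. destruct (excluded_middle_informative (a = a)); [|tauto].
  replace (l - l)%C with (RtoC 0) by ring. rewrite Cmod_0. exact Heps.
- rewrite diff_quot_neq by exact Hne. assert (Hn := Csub_neq_0 _ _ Hne).
  replace ((f w - f a) / (w - a) - l)%C
    with ((f w - f a - (w - a) * l) / (w - a))%C by (field; exact Hn).
  rewrite Cmod_div by exact Hn. assert (Hp := proj1 (Cmod_gt_0 _) Hn).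
  apply Rle_lt_trans with (eps / 2); [|lra].
  apply Rle_div_l; [exact Hp|]. now apply H.
Qed.

Lemma ex_Cderive_inv (z : C) : z <> 0 -> ex_Cderive Cinv z.
Proof.
intros Hz. exists (- / (z * z))%C. apply is_Cderive_Cmod. intros eps Heps.
assert (Hm := proj1 (Cmod_gt_0 z) Hz). set (m := Cmod z) in *.
exists (Rmin (m / 2) (eps * m ^ 3 / 2)). split.
{ apply Rmin_pos; [lra|]. assert (H := pow_lt m 3 Hm). nra. }
intros w Hw.
assert (H1 := Rlt_le_trans _ _ _ Hw (Rmin_l _ _)).
assert (H2 := Rlt_le_trans _ _ _ Hw (Rmin_r _ _)).
assert (H3 : m / 2 <= Cmod w).
{ assert (H := Cmod_sub_ge z w). rewrite Cmod_sub_sym in H. fold m in H. lra. }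
assert (Hw0 : w <> 0) by (apply Cmod_gt_0; lra).
replace (/ w - / z - (w - z) * - / (z * z))%C with ((w - z) * (w - z) / (z * z * w))%C
  by (field; split; assumption).
rewrite Cmod_div by (repeat apply Cmult_neq_0; assumption).
rewrite !Cmod_mult. fold m. assert (H0 := Cmod_ge_0 (w - z)).
apply Rle_div_l; [repeat apply Rmult_lt_0_compat; lra|].
replace (eps * Cmod (w - z) * (m * m * Cmod w)) with ((eps * m ^ 2 * Cmod w) * Cmod (w - z)) by ring.
apply Rmult_le_compat_r; [exact H0|].
apply Rle_trans with (eps * m ^ 2 * (m / 2)); [lra|].
apply Rmult_le_compat_l; [|exact H3]. apply Rmult_le_pos; [lra|apply pow2_ge_0].
Qed.

Lemma is_Cderive_ext_loc (f g : C -> C) (z l : C) (e : R) :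
  0 < e -> (forall w, Cmod (w - z) < e -> f w = g w) ->
  is_Cderive f z l -> is_Cderive g z l.
Proof.
intros He Hfg Hf. apply is_Cderive_Cmod. intros eps Heps.
destruct (proj1 (is_Cderive_Cmod f z l) Hf eps Heps) as [r [Hr H]].
exists (Rmin e r). split; [now apply Rmin_pos|]. intros w Hw.
rewrite <- !Hfg.
- apply H. eapply Rlt_le_trans; [exact Hw|apply Rmin_r].
- replace (z - z)%C with (RtoC 0) by ring. now rewrite Cmod_0.
- eapply Rlt_le_trans; [exact Hw|apply Rmin_l].
Qed.

Lemma diff_quot_derive (f : C -> C) (a l z : C) :
  z <> a -> ex_Cderive f z -> ex_Cderive (diff_quot f a l) z.
Proof.
intros Hne [lf Hf].
assert (Hp := proj1 (Cmod_gt_0 _) (Csub_neq_0 _ _ Hne)).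
assert (Hid : is_Cderive (fun w => w - a)%C z (RtoC 1)).
{ apply is_Cderive_Cmod. intros eps Heps. exists 1. split; [lra|]. intros w _.
  replace (w - a - (z - a) - (w - z) * 1)%C with (RtoC 0) by ring.
  rewrite Cmod_0. apply Rmult_le_pos; [lra|apply Cmod_ge_0]. }
assert (Hfa : is_Cderive (fun w => f w - f a)%C z lf).
{ apply is_Cderive_Cmod. intros eps Heps.
  destruct (proj1 (is_Cderive_Cmod f z lf) Hf eps Heps) as [r [Hr H]].
  exists r. split; [exact Hr|]. intros w Hw.
  replace (f w - f a - (f z - f a))%C with (f w - f z)%C by ring. now apply H. }
destruct (ex_Cderive_mult (fun w => f w - f a)%C (fun w => / (w - a))%C z) as [L HL].
- now exists lf.
- apply (ex_Cderive_comp Cinv (fun w => w - a)%C z); [|now exists (RtoC 1)].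
  now apply ex_Cderive_inv, Csub_neq_0.
- exists L. eapply is_Cderive_ext_loc with (e := Cmod (z - a)); [exact Hp| |exact HL].
  intros w Hw. simpl. rewrite diff_quot_neq; [reflexivity|].
  intros ->. rewrite Cmod_sub_sym in Hw. lra.
Qed.

Lemma circle_curve_cont (f : C -> C) (x y : R) :
  Ccont f (cexp (x, y)) -> curve_cont (fun t => f (cexp (x, t))) y.
Proof.
intros Hf eps Heps.
assert (H : Ccont (fun w => f (cexp w)) (x, y)).
{ apply (Ccont_comp f cexp); [apply ex_Cderive_cont; eexists; apply is_Cderive_cexp|exact Hf]. }
destruct (H eps Heps) as [d [Hd H']]. exists d. split; [exact Hd|].
intros t Ht. apply H'. now rewrite Cmod_vertical.
Qed.

(** The vanishing circle integral of the difference quotient at [a] is Cauchy's integral formula in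
    disguise. Combined with a finite geometric sum in [a / z], it gives an explicit error for each
    partial sum, so no interchange of sum and integral occurs. *)
Lemma cauchy_taylor_disc (f : C -> C) (R0 r : R) (a : C) :
  (forall z, Cmod z < R0 -> ex_Cderive f z) -> 0 < r < R0 -> Cmod a < r ->
  is_Cpseries (circle_coef f r) a (f a).
Proof.
intros Hf Hr Ha.
destruct (Hf a ltac:(lra)) as [l Hl].
set (q := diff_quot f a l).
assert (Hpi := PI_RGT_0).
assert (Hln : exp (ln r) = r) by (apply exp_ln; lra).
set (e := fun y => cexp (ln r, y)).
assert (He : forall y, Cmod (e y) = r) by (intros y; unfold e; now rewrite Cmod_cexp).
assert (Hqc : forall z, Cmod z < R0 -> Ccont q z).
{ intros z Hz. destruct (excluded_middle_informative (z = a)) as [->|Hne].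
  - now apply diff_quot_cont.
  - apply ex_Cderive_cont. apply diff_quot_derive; auto. }
assert (H0 := circle_int_removable q a R0 (ln r) Hqc
  (fun z Hz Hne => diff_quot_derive f a l z Hne (Hf z Hz)) ltac:(lra)).
assert (Hcurve : forall g, (forall z, Cmod z < R0 -> Ccont g z) ->
  forall y, curve_cont (fun y => g (e y)) y).
{ intros g Hg y. apply circle_curve_cont. apply Hg. fold (e y). rewrite He. lra. }
assert (Hid : forall z, Ccont (fun w => w) z).
{ intros z eps Heps. exists eps. auto. }
assert (Hcurve2 : forall g k, (forall z, Cmod z < R0 -> Ccont g z) ->
  ex_CInt (fun y => g (e y) * (/ e y) ^ k)%C 0 (2 * PI)).
{ intros g k Hg. apply ex_CInt_cont; [lra|]. intros y _.
  apply (circle_curve_cont (fun z => g z * (/ z) ^ k)%C).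
  apply Ccont_mult; [apply Hg; fold (e y); rewrite He; lra|].
  assert (Hi : Ccont Cinv (cexp (ln r, y)))
    by (apply ex_Cderive_cont, ex_Cderive_inv, cexp_nz).
  induction k as [|k IH].
  - intros eps Heps. exists 1. split; [lra|]. intros w _. simpl.
    replace (1 - 1)%C with (RtoC 0) by ring. now rewrite Cmod_0.
  - exact (Ccont_mult _ _ _ Hi IH). }
destruct (curve_bounded (fun y => q (e y) * e y)%C 0 (2 * PI) ltac:(lra)) as [B HB].
{ intros y _. apply (Hcurve (fun z => q z * z)%C). intros z Hz.
  apply Ccont_mult; auto. }
assert (HB0 : 0 <= B).
{ eapply Rle_trans; [apply Cmod_ge_0|apply (HB 0); lra]. }
assert (Hcf : forall z, Cmod z < R0 -> Ccont f z).
{ intros z Hz. now apply ex_Cderive_cont, Hf. }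
set (c := circle_coef f r).
assert (Hmain : forall n, Cmod (sum_n (fun k => c k * a ^ k)%C n - f a) <=
   B * (Cmod a / r) ^ S n).
{ intros n.
  assert (I1 : is_CInt (fun y => sum_n (fun k => a ^ k * (f (e y) * (/ e y) ^ k))%C n)
     0 (2 * PI) (sum_n (fun k => a ^ k * (RtoC (2 * PI) * c k))%C n)).
  { apply (is_CInt_sum_n (fun k y => a ^ k * (f (e y) * (/ e y) ^ k))%C).
    intros k. apply is_CInt_scal.
    replace (RtoC (2 * PI) * c k)%C
      with (CInt (fun y => f (e y) * (/ e y) ^ k)%C 0 (2 * PI)).
    - apply CInt_correct. now apply Hcurve2.
    - unfold c, circle_coef. fold e. rewrite Cmult_assoc, <- RtoC_mult, Rinv_r by lra.
      now rewrite Cmult_1_l. }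
  assert (I2 : is_CInt (fun y => sum_n (fun k => a ^ k * (/ e y) ^ k)%C n)
     0 (2 * PI) (RtoC (2 * PI))).
  { replace (RtoC (2 * PI)) with (sum_n (fun k => a ^ k *
       (if Nat.eq_dec k 0 then RtoC (2 * PI) else RtoC 0))%C n).
    - apply (is_CInt_sum_n (fun k y => a ^ k * (/ e y) ^ k)%C).
      intros k. apply is_CInt_scal, is_CInt_cexp_pow.
    - clear. induction n as [|n IH]; [rewrite sum_O; simpl; ring|].
      rewrite sum_Sn, IH. change plus with Cplus. simpl. ring. }
  assert (I3 : is_CInt (fun y => q (e y) * e y)%C 0 (2 * PI) (RtoC 0)).
  { rewrite <- H0. apply CInt_correct.
    apply ex_CInt_cont; [lra|]. intros y _. apply (Hcurve (fun z => q z * z)%C).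
    intros z Hz. apply Ccont_mult; auto. }
  (* With [s] the geometric sum in [u = a / e y], the integrand is
     [(f (e y) - f a) * s - q (e y) * e y]. Since [f (e y) - f a = q (e y) * e y * (1 - u)], it
     collapses to [- q (e y) * e y * u ^ S n]. *)
  assert (I4 := is_CInt_plus _ _ _ _ _ _ I1 (is_CInt_plus _ _ _ _ _ _
    (is_CInt_scal (- f a)%C _ _ _ _ I2) (is_CInt_scal (- (1))%C _ _ _ _ I3))).
  cbv beta in I4.
  assert (Hpt : forall y, 0 <= y <= 2 * PI ->
    Cmod (sum_n (fun k => a ^ k * (f (e y) * (/ e y) ^ k)) n +
      (- f a * sum_n (fun k => a ^ k * (/ e y) ^ k) n + - (1) * (q (e y) * e y)))%C
    <= B * (Cmod a / r) ^ S n).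
  { intros y Hy. set (u := (a / e y)%C).
    assert (Hey : e y <> 0) by apply cexp_nz.
    assert (Hne : e y <> a) by (intros E; assert (H := He y); rewrite E in H; lra).
    assert (Hne' := Csub_neq_0 _ _ Hne).
    replace (sum_n (fun k => a ^ k * (f (e y) * (/ e y) ^ k)) n)%C
      with (f (e y) * sum_n (fun k => u ^ k) n)%C.
    2: { symmetry. etransitivity; [|exact (@sum_n_mult_l C_Ring (f (e y)) (fun k => u ^ k)%C n)].
      apply sum_n_ext. intros k. change (@eq C (a ^ k * (f (e y) * (/ e y) ^ k))%C (f (e y) * u ^ k)%C).
      unfold u, Cdiv. rewrite Cpow_mult_l. ring. }
    replace (sum_n (fun k => a ^ k * (/ e y) ^ k) n)%C with (sum_n (fun k => u ^ k) n)%C.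
    2: { apply sum_n_ext. intros k. unfold u, Cdiv. now rewrite Cpow_mult_l. }
    assert (G := geom_sum_C u n). set (s := sum_n (fun k => (u ^ k)%C) n) in *.
    replace (f (e y) * s + (- f a * s + - (1) * (q (e y) * e y)))%C
      with (- (q (e y) * e y * u ^ S n))%C.
    - rewrite Cmod_opp, Cmod_mult, Cmod_pow. unfold u. rewrite Cmod_div, He by exact Hey.
      apply Rmult_le_compat_r; [|now apply HB].
      apply pow_le, Rdiv_le_0_compat; [apply Cmod_ge_0|lra].
    - assert (E1 : (q (e y) * e y * (1 - u))%C = (f (e y) - f a)%C).
      { unfold q, u. rewrite diff_quot_neq by exact Hne. field. split; assumption. }
      replace (u ^ S n)%C with (1 - (1 - u) * s)%C by (rewrite G; ring).
      replace (- (q (e y) * e y * (1 - (1 - u) * s)))%C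
        with ((q (e y) * e y * (1 - u)) * s - q (e y) * e y)%C by ring.
      rewrite E1. ring. }
  assert (HI := CInt_Cmod_le _ 0 (2 * PI) _ ltac:(lra) (ex_intro _ _ I4) Hpt).
  rewrite (is_CInt_unique _ _ _ _ I4) in HI.
  replace (sum_n (fun k => a ^ k * (RtoC (2 * PI) * c k))%C n)
    with (RtoC (2 * PI) * sum_n (fun k => c k * a ^ k)%C n)%C in HI.
  2: { symmetry. etransitivity; [|exact (@sum_n_mult_l C_Ring (RtoC (2 * PI)) (fun k => c k * a ^ k)%C n)].
      apply sum_n_ext. intros k. change (@eq C (a ^ k * (RtoC (2 * PI) * c k))%C (RtoC (2 * PI) * (c k * a ^ k))%C).
      ring. }
  match type of HI with Cmod ?t <= _ => replace t with
    (RtoC (2 * PI) * (sum_n (fun k => c k * a ^ k)%C n - f a))%C in HI by ring end.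
  rewrite Cmod_mult, Cmod_R, Rabs_pos_eq, Rminus_0_r in HI by lra.
  apply Rmult_le_reg_l in HI; [exact HI|lra]. }
apply is_Cpseries_term, is_Cseries_Cmod. intros eps Heps.
assert (Hq : 0 <= Cmod a / r < 1).
{ split; [apply Rdiv_le_0_compat; [apply Cmod_ge_0|lra]|]. apply Rlt_div_l; lra. }
destruct (pow_lt_1_zero (Cmod a / r) ltac:(rewrite Rabs_pos_eq; lra) (eps / (B + 1))
    ltac:(apply Rdiv_lt_0_compat; lra)) as [N HN].
exists N. intros n Hn. eapply Rle_lt_trans; [apply Hmain|].
specialize (HN (S n) ltac:(lia)).
rewrite Rabs_pos_eq in HN by (apply pow_le; lra).
apply Rlt_div_r in HN; [|lra].
assert (H := pow_le (Cmod a / r) (S n) (proj1 Hq)). nra.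
Qed.

Lemma circle_coef_bound (f : C -> C) (R0 r M : R) (n : nat) :
  (forall z, Cmod z < R0 -> ex_Cderive f z) -> 0 < r < R0 ->
  (forall z, Cmod z = r -> Cmod (f z) <= M) ->
  Cmod (circle_coef f r n) * r ^ n <= M.
Proof.
intros Hf Hr HM. assert (Hpi := PI_RGT_0).
assert (Hln : exp (ln r) = r) by (apply exp_ln; lra).
assert (He : forall y, Cmod (cexp (ln r, y)) = r) by (intros y; now rewrite Cmod_cexp).
unfold circle_coef.
assert (H : Cmod (CInt (fun y => f (cexp (ln r, y)) * (/ cexp (ln r, y)) ^ n)%C 0 (2 * PI))
   <= (2 * PI - 0) * (M * / r ^ n)).
{ apply CInt_Cmod_le; [lra| |].
  - apply ex_CInt_cont; [lra|]. intros y _.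
    apply (circle_curve_cont (fun z => f z * (/ z) ^ n)%C).
    apply Ccont_mult; [apply ex_Cderive_cont, Hf; rewrite He; lra|].
    assert (Hi : Ccont Cinv (cexp (ln r, y)))
      by (apply ex_Cderive_cont, ex_Cderive_inv, cexp_nz).
    induction n as [|n IH].
    + intros eps Heps. exists 1. split; [lra|]. intros w _. simpl.
      replace (1 - 1)%C with (RtoC 0) by ring. now rewrite Cmod_0.
    + exact (Ccont_mult _ _ _ Hi IH).
  - intros y _. rewrite Cmod_mult, Cmod_pow, Cmod_inv, He, pow_inv by apply cexp_nz.
    apply Rmult_le_compat_r; [|now apply HM].
    apply Rlt_le, Rinv_0_lt_compat, pow_lt. lra. }
rewrite Cmod_mult, Cmod_R, Rabs_pos_eq by (apply Rlt_le, Rinv_0_lt_compat; lra).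
assert (Hrn := pow_lt r n (proj1 Hr)).
apply Rle_trans with (/ (2 * PI) * ((2 * PI - 0) * (M * / r ^ n)) * r ^ n).
- apply Rmult_le_compat_r; [lra|]. apply Rmult_le_compat_l; [|exact H].
  apply Rlt_le, Rinv_0_lt_compat; lra.
- apply Req_le. field. split; lra.
Qed.

(** The coefficients are computed at radius [R0 / 2]. Uniqueness shows that every other radius gives
    the same ones, which extends both the expansion and Cauchy's estimate to all radii below
    [R0]. *)
Theorem taylor_disc (f : C -> C) (z0 : C) (R0 : R) :
  0 < R0 -> (forall z, Cmod (z - z0) < R0 -> ex_Cderive f z) ->
  exists c : nat -> C,
    (forall z, Cmod (z - z0) < R0 -> is_Cpseries c (z - z0)%C (f z)) /\
    (forall r M n, 0 < r < R0 -> (forall z, Cmod (z - z0) = r -> Cmod (f z) <= M) ->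
      Cmod (c n) * r ^ n <= M).
Proof.
intros HR Hf. set (g := fun w => f (w + z0)%C).
assert (Hg : forall w, Cmod w < R0 -> ex_Cderive g w).
{ intros w Hw. destruct (Hf (w + z0)%C) as [l Hl].
  { now replace (w + z0 - z0)%C with w by ring. }
  exists l. apply is_Cderive_Cmod. intros eps Heps.
  destruct (proj1 (is_Cderive_Cmod f _ l) Hl eps Heps) as [d [Hd H]].
  exists d. split; [exact Hd|]. intros v Hv. unfold g.
  replace (v - w)%C with (v + z0 - (w + z0))%C in * by ring. now apply H. }
assert (Hu : forall r, 0 < r < R0 -> forall n, circle_coef g r n = circle_coef g (R0 / 2) n).
{ intros r Hr. apply is_Cpseries_coef_unique with g (Rmin r (R0 / 2)).
  - apply Rmin_pos; lra.
  - intros z Hz. apply (cauchy_taylor_disc g R0); auto.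
    eapply Rlt_le_trans; [exact Hz|apply Rmin_l].
  - intros z Hz. apply (cauchy_taylor_disc g R0); auto; [lra|].
    eapply Rlt_le_trans; [exact Hz|apply Rmin_r]. }
exists (circle_coef g (R0 / 2)). split.
- intros z Hz. assert (H0 := Cmod_ge_0 (z - z0)).
  set (r := (Cmod (z - z0) + R0) / 2).
  assert (Hr : 0 < r < R0) by (unfold r; lra).
  replace (circle_coef g (R0 / 2)) with (circle_coef g r)
    by (apply functional_extensionality, Hu, Hr).
  replace (f z) with (g (z - z0)%C) by (unfold g; f_equal; ring).
  apply (cauchy_taylor_disc g R0); auto. unfold r; lra.
- intros r M n Hr HM. rewrite <- (Hu r Hr).
  apply circle_coef_bound with R0; auto. intros z Hz. apply HM.
  now replace (z + z0 - z0)%C with z by ring.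
Qed.

(** * Components, extensions and the identity theorem *)

Lemma open_Cmod (V : C -> Prop) :
  open V <->
  forall z, V z -> exists d, 0 < d /\ forall w, Cmod (w - z) < d -> V w.
Proof.
split; intros H z Hz; apply (locally_Cmod z V), H, Hz.
Qed.

Lemma open_open_disc (z : C) (r : R) : open (open_disc z r).
Proof.
apply open_Cmod. intros w Hw. exists (r - Cmod (w - z)).
unfold open_disc in *. split; [lra|]. intros v Hv.
assert (H := Cmod_triangle_sub v w z). lra.
Qed.

Definition convex (A : C -> Prop) : Prop :=
  forall z w t, A z -> A w -> 0 <= t <= 1 -> A (z + t * (w - z))%C.

(** On the segment from [p] in [V] to [q] in [W], let [T] be the supremum of the parameters sent
    into [V]. If [g T] is in [V], openness forces [T = 1] and [q] is common; if it is in [W], so is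
    [g t] for a parameter [t] close to [T] that is sent into [V]. *)
Lemma convex_connected (A : C -> Prop) : convex A -> connected A.
Proof.
intros HA V W HV HW Hcov [p [Ap Vp]] [q [Aq Wq]].
rewrite open_Cmod in HV. rewrite open_Cmod in HW.
apply NNPP. intros Hno.
set (g := fun t : R => (p + t * (q - p))%C).
assert (Hg0 : g 0 = p) by (unfold g; ring).
assert (Hg1 : g 1 = q) by (unfold g; ring).
assert (HgA : forall t, 0 <= t <= 1 -> A (g t)) by (intros t Ht; now apply HA).
assert (Hgd : forall s t, Cmod (g s - g t) <= Rabs (s - t) * (Cmod (q - p) + 1)).
{ intros s t. unfold g.
  replace (p + s * (q - p) - (p + t * (q - p)))%C with (RtoC (s - t) * (q - p))%C
    by (rewrite RtoC_minus; ring).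
  rewrite Cmod_mult, Cmod_R. apply Rmult_le_compat_l; [apply Rabs_pos|lra]. }
assert (HK : 0 < Cmod (q - p) + 1) by (assert (H := Cmod_ge_0 (q - p)); lra).
set (K := Cmod (q - p) + 1) in *.
destruct (completeness (fun t => 0 <= t <= 1 /\ V (g t))) as [T [HT1 HT2]].
- exists 1. intros t [Ht _]. lra.
- exists 0. split; [lra|]. now rewrite Hg0.
- assert (H0T : 0 <= T) by (apply HT1; split; [lra|]; now rewrite Hg0).
  assert (HT : T <= 1) by (apply HT2; intros t [Ht _]; lra).
  destruct (Hcov (g T) (HgA T ltac:(lra))) as [HVT|HWT].
  + destruct (Rle_lt_or_eq_dec T 1 HT) as [HlT|E].
    * destruct (HV _ HVT) as [d [Hd H]].
      set (m := Rmin (1 - T) (d / (2 * K))).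
      assert (Hm : 0 < m).
      { apply Rmin_pos; [lra|]. apply Rdiv_lt_0_compat; lra. }
      assert (Hm1 : m <= 1 - T) by apply Rmin_l.
      assert (Hm2 : m * (2 * K) <= d) by (apply Rle_div_r; [lra|apply Rmin_r]).
      assert (HTm : T + m <= T); [|lra].
      apply HT1. split; [lra|]. apply H.
      eapply Rle_lt_trans; [apply Hgd|].
      replace (T + m - T) with m by ring. rewrite Rabs_pos_eq by lra. nra.
    * apply Hno. exists q. rewrite <- E in Hg1. rewrite Hg1 in HVT. auto.
  + destruct (HW _ HWT) as [d [Hd H]].
    set (m := d / (2 * K)).
    assert (Hm : 0 < m) by (apply Rdiv_lt_0_compat; lra).
    assert (HmK : m * (2 * K) = d) by (unfold m; field; lra).
    assert (Ht : exists t, (0 <= t <= 1 /\ V (g t)) /\ T - m < t).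
    { apply NNPP. intros Hn. assert (HTm : T <= T - m); [|lra].
      apply HT2. intros t Ht. apply Rnot_lt_le. intros Hlt. apply Hn. now exists t. }
    destruct Ht as [t [[Ht HVt] Htm]].
    assert (HtT : t <= T) by (apply HT1; auto).
    apply Hno. exists (g t). split; [now apply HgA|]. split; [exact HVt|].
    apply H. eapply Rle_lt_trans; [apply Hgd|].
    rewrite Rabs_left1 by lra. nra.
Qed.

Lemma convex_open_disc (z : C) (r : R) : convex (open_disc z r).
Proof.
intros u v t Hu Hv Ht. unfold open_disc in *.
replace (u + t * (v - u) - z)%C
  with (RtoC (1 - t) * (u - z) + RtoC t * (v - z))%C
  by (rewrite RtoC_minus; ring).
eapply Rle_lt_trans; [apply Cmod_triangle|].
rewrite !Cmod_mult, !Cmod_R, !Rabs_pos_eq by lra.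
destruct (Req_dec t 0) as [->|Hne]; [lra|].
apply Rle_lt_trans with ((1 - t) * r + t * Cmod (v - z)); [|nra].
apply Rplus_le_compat_r, Rmult_le_compat_l; lra.
Qed.

Lemma convex_inter (A B : C -> Prop) : convex A -> convex B -> convex (inter A B).
Proof. intros HA HB z w t [H1 H2] [H3 H4] Ht. split; [now apply HA|now apply HB]. Qed.

Lemma unit_disc_open_disc (z : C) : unit_disc z <-> open_disc 0 1 z.
Proof.
unfold unit_disc, open_disc. now replace (z - 0)%C with z by ring.
Qed.

Lemma convex_unit_disc : convex unit_disc.
Proof.
intros z w t Hz Hw Ht. apply unit_disc_open_disc. apply convex_open_disc;
[apply (proj1 (unit_disc_open_disc z))|apply (proj1 (unit_disc_open_disc w))|];
assumption.
Qed.

Lemma open_unit_disc : open unit_disc.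
Proof.
apply open_Cmod. intros z Hz.
destruct (proj1 (open_Cmod _) (open_open_disc 0 1) z) as [d [Hd H]].
- exact (proj1 (unit_disc_open_disc z) Hz).
- exists d. split; [exact Hd|]. intros w Hw.
  exact (proj2 (unit_disc_open_disc w) (H w Hw)).
Qed.

Lemma open_inter (A B : C -> Prop) : open A -> open B -> open (inter A B).
Proof.
intros HA HB. apply open_Cmod. intros z [Hz1 Hz2].
destruct (proj1 (open_Cmod A) HA z Hz1) as [d1 [Hd1 H1]].
destruct (proj1 (open_Cmod B) HB z Hz2) as [d2 [Hd2 H2]].
exists (Rmin d1 d2). split; [now apply Rmin_pos|]. intros w Hw. split.
- apply H1. eapply Rlt_le_trans; [exact Hw|apply Rmin_l].
- apply H2. eapply Rlt_le_trans; [exact Hw|apply Rmin_r].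
Qed.

(** Such a trace is therefore its own only component whenever it is nonempty, which removes
    components from [totally_unbounded]. *)
Lemma disc_cap_connected (z : C) (r : R) : connected (inter (open_disc z r) unit_disc).
Proof.
apply convex_connected, convex_inter; [apply convex_open_disc|apply convex_unit_disc].
Qed.

Lemma component_of_connected (A Y : C -> Prop) :
  connected A -> component A Y -> forall z, Y z <-> A z.
Proof.
intros HA [x [Hx HY]] z. rewrite HY. split.
- intros [S [_ [HS [_ Hz]]]]. now apply HS.
- intros Hz. exists A. auto.
Qed.

Lemma connected_component_self (A : C -> Prop) (x : C) :
  connected A -> A x -> component A A.
Proof.
intros HA Hx. exists x. split; [exact Hx|]. intros y. split.
- intros Hy. exists A. auto.
- intros [S [_ [HS [_ Hz]]]]. now apply HS.
Qed.

Lemma connected_union (A B : C -> Prop) (x : C) :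
  connected A -> connected B -> A x -> B x -> connected (fun z => A z \/ B z).
Proof.
intros HA HB Ax Bx V W HV HW Hcov HexV HexW.
assert (Hcase : forall P Q : C -> Prop, open P -> open Q ->
  (forall z, A z \/ B z -> P z \/ Q z) -> P x -> (exists z, (A z \/ B z) /\ Q z) ->
  exists z, (A z \/ B z) /\ P z /\ Q z).
{ intros P Q HP HQ Hc Px [w [[Aw|Bw] Qw]].
  - destruct (HA P Q HP HQ) as [z [Hz1 Hz2]]; eauto.
  - destruct (HB P Q HP HQ) as [z [Hz1 Hz2]]; eauto. }
destruct (Hcov x (or_introl Ax)) as [Vx|Wx].
- exact (Hcase V W HV HW Hcov Vx HexW).
- destruct (Hcase W V HW HV) as [z [Hz [H1 H2]]]; eauto.
  intros z Hz. specialize (Hcov z Hz). tauto.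
Qed.

Lemma component_absorbs (A Y S : C -> Prop) (y : C) :
  component A Y -> connected S -> (forall z, S z -> A z) -> S y -> Y y ->
  forall z, S z -> Y z.
Proof.
intros [x [Hx HY]] HS HSA Sy Yy z Sz.
apply HY in Yy. destruct Yy as [T [HT [HTA [Tx Ty]]]].
apply HY. exists (fun z => T z \/ S z). split; [now apply connected_union with y|].
split; [intros w [Hw|Hw]; auto|auto].
Qed.

Lemma component_sub (A Y : C -> Prop) : component A Y -> forall z, Y z -> A z.
Proof.
intros [x [Hx HY]] z Hz. apply HY in Hz. destruct Hz as [S [_ [HS [_ Hz]]]]. auto.
Qed.

Lemma component_nonempty (A Y : C -> Prop) : component A Y -> exists z, Y z.
Proof.
intros [x [Hx HY]]. exists x. apply HY. exists (fun z => z = x).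
repeat split; [|intros z ->; exact Hx].
intros V W _ _ _ [z [-> Vz]] [w [-> Ww]]. exists x. auto.
Qed.

Lemma open_disc_center (z : C) (r : R) : 0 < r -> open_disc z r z.
Proof.
intros Hr. unfold open_disc. replace (z - z)%C with (RtoC 0) by ring. now rewrite Cmod_0.
Qed.

(* If no boundary point of [U] on the circle were adherent to [Y], then [Y]
   would be open and closed in [U]. *)
Lemma component_adherent_circle (U Y : C -> Prop) :
  Defs.domain U -> (exists zeta, unit_circle zeta /\ U zeta) ->
  component (inter U unit_disc) Y ->
  exists zeta, unit_circle zeta /\ U zeta /\
    forall d, 0 < d -> exists z, Y z /\ open_disc zeta d z.
Proof.
intros [HU [HUc _]] [z1 [Hz1 Uz1]] HY. apply NNPP. intros Hno.
assert (HUo := proj1 (open_Cmod _) HU).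
assert (HUDo := proj1 (open_Cmod _) (open_inter _ _ HU open_unit_disc)).
assert (Habs : forall z d, 0 < d -> (forall w, Cmod (w - z) < d -> inter U unit_disc w) ->
   (exists w, Y w /\ open_disc z d w) -> forall w, open_disc z d w -> Y w).
{ intros z d Hd Hsub [w [Yw Dw]].
  apply (component_absorbs _ Y (open_disc z d) w HY); auto.
  apply convex_connected, convex_open_disc. }
(* [W] is the exterior of [Y]. A point of [U] outside [W] is adherent to [Y]; if its modulus is
   below [1] it lies in [Y], and modulus [1] or more is contradictory. *)
set (W := fun z => exists d, 0 < d /\ forall w, open_disc z d w -> ~ Y w).
destruct (HUc Y W) as [z [_ [Yz [d [Hd Hz]]]]].
- apply open_Cmod. intros z Yz.
  destruct (HUDo z (component_sub _ _ HY z Yz)) as [d [Hd H]].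
  exists d. split; [exact Hd|]. apply (Habs z d Hd H).
  exists z. split; [exact Yz|now apply open_disc_center].
- apply open_Cmod. intros z [d [Hd H]]. exists (d / 2). split; [lra|].
  intros w Hw. exists (d / 2). split; [lra|]. intros v Hv. apply H.
  unfold open_disc in *. assert (H1 := Cmod_triangle_sub v w z). lra.
- intros z Uz. destruct (classic (W z)) as [Hw|Hw]; [now right|left].
  assert (Hadh : forall d, 0 < d -> exists w, Y w /\ open_disc z d w).
  { intros d Hd. apply NNPP. intros Hn. apply Hw. exists d. split; [exact Hd|].
    intros w Dw Yw. apply Hn. now exists w. }
  destruct (Rtotal_order (Cmod z) 1) as [Hlt|[Heq|Hgt]].
  + destruct (HUDo z (conj Uz Hlt)) as [d [Hd H]].
    apply (Habs z d Hd H); auto. now apply open_disc_center.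
  + exfalso. apply Hno. exists z. auto.
  + exfalso. destruct (Hadh (Cmod z - 1)) as [w [Yw Dw]]; [lra|].
    assert (Hw1 := proj2 (component_sub _ _ HY w Yw)). unfold unit_disc, open_disc in *.
    rewrite Cmod_sub_sym in Dw. assert (H := Cmod_sub_ge z w). lra.
- destruct (component_nonempty _ _ HY) as [y Yy]. exists y. split; [|exact Yy].
  exact (proj1 (component_sub _ _ HY y Yy)).
- exists z1. split; [exact Uz1|]. apply NNPP. intros Hw. apply Hno. exists z1.
  split; [exact Hz1|]. split; [exact Uz1|].
  intros d Hd. apply NNPP. intros Hn. apply Hw. exists d. split; [exact Hd|].
  intros w Dw Yw. apply Hn. now exists w.
- apply (Hz z); [now apply open_disc_center|exact Yz].
Qed.

Definition cap (z : C) (r : R) (w : C) : Prop := open_disc z r w /\ unit_disc w.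

(** Take [zeta] on the circle adherent to the given component and a disc about [zeta] inside the
    domain. The trace of this disc is connected and meets the component, hence lies in it. *)
Lemma extendable_local (f : C -> C) :
  extendable f -> exists zeta r F, unit_circle zeta /\ 0 < r /\
    holomorphic_on (open_disc zeta r) F /\ forall z, cap zeta r z -> f z = F z.
Proof.
intros [U [F [HU [Hc [HF [Y [HY HfF]]]]]]].
destruct (component_adherent_circle U Y HU Hc HY) as [zeta [Hz [Uz Hadh]]].
destruct (proj1 (open_Cmod U) (proj1 HU) zeta Uz) as [r [Hr H]].
exists zeta, r, F. split; [exact Hz|]. split; [exact Hr|]. split.
- intros z Hzr. apply HF, H, Hzr.
- destruct (Hadh r Hr) as [y [Yy Dy]].
  intros z Hzc. apply HfF.
  apply (component_absorbs _ Y (inter (open_disc zeta r) unit_disc) y HY); auto.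
  + apply disc_cap_connected.
  + intros w [Hw1 Hw2]. split; auto.
  + split; [exact Dy|]. exact (proj2 (component_sub _ _ HY y Yy)).
Qed.

Lemma is_Cpseries_zero_near (c : nat -> C) (u : C -> C) (z0 : C) (r d : R) :
  0 < d -> 0 < r ->
  (forall z, Cmod (z - z0) < r -> is_Cpseries c (z - z0)%C (u z)) ->
  (forall z, Cmod (z - z0) < d -> u z = 0) ->
  forall z, Cmod (z - z0) < r -> u z = 0.
Proof.
intros Hd Hr Hc Hu z Hz.
assert (Hzero : forall w, is_Cpseries (fun _ => RtoC 0) w (RtoC 0)).
{ intros w. apply is_Cpseries_term, is_Cseries_Cmod. intros eps Heps. exists 0%nat.
  intros n _. replace (sum_n _ n) with (RtoC 0).
  - replace (0 - 0)%C with (RtoC 0) by ring. now rewrite Cmod_0.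
  - induction n as [|n IH]; [rewrite sum_O; ring|].
    rewrite sum_Sn, <- IH. change plus with Cplus. ring. }
assert (E : forall n, c n = RtoC 0).
{ apply (is_Cpseries_coef_unique c (fun _ => RtoC 0) (fun w => u (w + z0)%C) (Rmin r d)).
  - now apply Rmin_pos.
  - intros w Hw. assert (H := Hc (w + z0)%C).
    replace (w + z0 - z0)%C with w in H by ring. apply H.
    eapply Rlt_le_trans; [exact Hw|apply Rmin_l].
  - intros w Hw. rewrite Hu; [apply Hzero|].
    replace (w + z0 - z0)%C with w by ring.
    eapply Rlt_le_trans; [exact Hw|apply Rmin_r]. }
replace c with (fun _ : nat => RtoC 0) in Hc
  by (apply functional_extensionality; intros n; now rewrite E).
exact (is_Cseries_unique _ _ _ (proj1 (is_Cpseries_term _ _ _) (Hc z Hz))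
  (proj1 (is_Cpseries_term _ _ _) (Hzero (z - z0)%C))).
Qed.

Lemma identity_theorem (A : C -> Prop) (u : C -> C) (z0 : C) (d0 : R) :
  open A -> connected A -> holomorphic_on A u ->
  A z0 -> 0 < d0 -> (forall z, Cmod (z - z0) < d0 -> u z = 0) ->
  forall z, A z -> u z = 0.
Proof.
intros HA HAc Hu Az0 Hd0 Hu0 z1 Az1. assert (HAo := proj1 (open_Cmod A) HA).
set (V := fun z => exists d, 0 < d /\ forall w, Cmod (w - z) < d -> u w = 0).
assert (V1 : V z1).
{ apply NNPP. intros HV1.
  destruct (HAc V (fun z => A z /\ ~ V z)) as [z [_ [H1 [_ H2]]]]; [| | | | |tauto].
  - apply open_Cmod. intros z [d [Hd H]]. exists (d / 2). split; [lra|].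
    intros w Hw. exists (d / 2). split; [lra|]. intros v Hv. apply H.
    assert (H1 := Cmod_triangle_sub v w z). lra.
  (* If [u] vanished near some [w] within [d / 3] of [z], its expansion about [w] on radius
     [2 * d / 3] would be zero, and that disc covers the one of radius [d / 3] about [z]. *)
  - apply open_Cmod. intros z [Az HVz]. destruct (HAo z Az) as [d [Hd H]].
    exists (d / 3). split; [lra|]. intros w Hw. split; [apply H; lra|].
    intros [e [He Hw0]]. apply HVz.
    destruct (taylor_disc u w (2 * d / 3)) as [c [Hc _]]; [lra| |].
    + intros v Hv. apply Hu, H. assert (H1 := Cmod_triangle_sub v w z). lra.
    + exists (d / 3). split; [lra|]. intros v Hv.
      apply (is_Cpseries_zero_near c u w (2 * d / 3) e); auto; [lra|].
      rewrite Cmod_sub_sym in Hw. assert (H1 := Cmod_triangle_sub v z w). lra.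
  - intros z Az. destruct (classic (V z)); auto.
  - exists z0. split; [exact Az0|]. now exists d0.
  - exists z1. auto. }
destruct V1 as [d [Hd H]]. apply H.
replace (z1 - z1)%C with (RtoC 0) by ring. now rewrite Cmod_0.
Qed.

(** * The G-delta property *)

Lemma coef_unique (f : C -> C) (a : nat -> C) :
  (forall z, unit_disc z -> is_Cpseries a z (f z)) -> forall n, coef f n = a n.
Proof.
intros Ha.
assert (H : forall z, unit_disc z -> is_Cpseries (coef f) z (f z)).
{ unfold coef. apply epsilon_spec. now exists a. }
apply is_Cpseries_coef_unique with f 1; [lra|exact H|exact Ha].
Qed.

(** Taylor's theorem supplies the witness on which the [epsilon] in [coef] relies. *)
Lemma coef_spec (f : C -> C) (z : C) :
  hol_disc f -> unit_disc z -> is_Cpseries (coef f) z (f z).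
Proof.
intros [Hf _] Hz. revert z Hz. unfold coef. apply epsilon_spec.
destruct (taylor_disc f 0 1) as [c [Hc _]]; [lra| |].
- intros z Hz. apply Hf. exact (proj2 (unit_disc_open_disc z) Hz).
- exists c. intros z Hz. replace z with (z - 0)%C at 1 by ring.
  apply Hc. exact (proj1 (unit_disc_open_disc z) Hz).
Qed.

Definition taylor_at (f : C -> C) (z0 : C) (c : nat -> C) : Prop :=
  forall z, Cmod (z - z0) < 1 - Cmod z0 -> is_Cpseries c (z - z0)%C (f z).

Lemma inner_disc (z0 z : C) : Cmod (z - z0) < 1 - Cmod z0 -> unit_disc z.
Proof. intros Hz. unfold unit_disc. assert (H := Cmod_sub_ge z z0). lra. Qed.

Lemma taylor_at_exists (f : C -> C) (z0 : C) :
  hol_disc f -> unit_disc z0 -> exists c, taylor_at f z0 c.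
Proof.
intros [Hf _] Hz0. destruct (taylor_disc f z0 (1 - Cmod z0)) as [c [Hc _]].
- unfold unit_disc in Hz0. lra.
- intros z Hz. apply Hf. now apply inner_disc with z0.
- now exists c.
Qed.

Lemma taylor_at_C_derive (f : C -> C) (z0 : C) (c : nat -> C) :
  unit_disc z0 -> taylor_at f z0 c -> C_derive f z0 = c 1%nat.
Proof.
intros Hz0 Hc. apply is_C_derive_unique.
apply (Cpseries_is_derive_center c f z0 (1 - Cmod z0)); [|exact Hc].
unfold unit_disc in Hz0. lra.
Qed.

Lemma hol_disc_sub_bound (f g : C -> C) (del : R) (z : C) :
  hol_disc f -> hol_disc g -> (forall k, Cmod (coef f k - coef g k) <= del) ->
  unit_disc z -> Cmod (f z - g z) <= del / (1 - Cmod z).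
Proof.
intros Hf Hg Hd Hz.
assert (S := is_Cpseries_plus_scal (- (1))%C _ _ _ _ _ (coef_spec f z Hf Hz) (coef_spec g z Hg Hz)).
replace (f z + - (1) * g z)%C with (f z - g z)%C in S by ring.
apply (proj1 (is_Cpseries_term _ _ _)) in S.
assert (Hq : Rabs (Cmod z) < 1) by (rewrite Rabs_pos_eq; [exact Hz|apply Cmod_ge_0]).
replace (del / (1 - Cmod z)) with (Series (fun n => del * Cmod z ^ n)).
- apply is_Cseries_bound with (1 := S).
  + intros n. rewrite Cmod_mult, Cmod_pow.
    apply Rmult_le_compat_r; [apply pow_le, Cmod_ge_0|].
    replace (coef f n + - (1) * coef g n)%C with (coef f n - coef g n)%C by ring.
    apply Hd.
  + apply (ex_series_scal_l del (fun n => Cmod z ^ n)). now apply ex_series_geom.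
- rewrite Series_scal_l, Series_geom by exact Hq. reflexivity.
Qed.

Lemma ex_Cderive_plus_scal (f g : C -> C) (k z : C) :
  ex_Cderive f z -> ex_Cderive g z -> ex_Cderive (fun w => f w + k * g w)%C z.
Proof.
intros [lf Hf] Hg.
assert (Hc : ex_Cderive (fun _ => k) z) by (exists zero; apply is_derive_const).
destruct (ex_Cderive_mult _ _ z Hc Hg) as [l Hl].
eexists. exact (@is_derive_plus C_AbsRing C_NormedModule f _ z lf l Hf Hl).
Qed.

(* Cauchy's estimate on the circle of radius [(1 - |z0|) / 2] about [z0]. *)
Lemma taylor_at_close (f g : C -> C) (z0 : C) (c c' : nat -> C) (del : R) (n : nat) :
  hol_disc f -> hol_disc g -> unit_disc z0 ->
  taylor_at f z0 c -> taylor_at g z0 c' ->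
  (forall k, Cmod (coef f k - coef g k) <= del) ->
  Cmod (c n - c' n) * ((1 - Cmod z0) / 2) ^ n <= del / ((1 - Cmod z0) / 2).
Proof.
intros Hf Hg Hz0 Hc Hc' Hd. unfold unit_disc in Hz0.
set (r := (1 - Cmod z0) / 2). assert (Hr : 0 < r) by (unfold r; lra).
set (u := fun z => (f z + - (1) * g z)%C).
destruct (taylor_disc u z0 (1 - Cmod z0)) as [b [Hb HM]]; [lra| |].
{ intros z Hz. apply inner_disc in Hz.
  apply ex_Cderive_plus_scal; [now apply Hf|now apply Hg]. }
assert (E : forall k, b k = (c k + - (1) * c' k)%C).
{ apply is_Cpseries_coef_unique with (fun w => u (w + z0)%C) (1 - Cmod z0); [lra| |];
  intros w Hw; assert (Ew : (w + z0 - z0)%C = w) by ring.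
  - rewrite <- Ew at 1. apply Hb. now rewrite Ew.
  - rewrite <- Ew at 1. apply is_Cpseries_plus_scal; [apply Hc|apply Hc']; now rewrite Ew. }
replace (c n - c' n)%C with (b n) by (rewrite E; ring).
apply HM; [unfold r; lra|].
intros z Hz.
assert (Hdel : 0 <= del) by (eapply Rle_trans; [apply Cmod_ge_0|apply (Hd 0%nat)]).
assert (Hzr : Cmod z <= 1 - r).
{ assert (H := Cmod_sub_ge z z0). unfold r in *. lra. }
replace (u z) with (f z - g z)%C by (unfold u; ring).
eapply Rle_trans; [apply (hol_disc_sub_bound f g del); auto; unfold unit_disc; lra|].
apply Rmult_le_compat_l; [exact Hdel|]. apply Rinv_le_contravar; lra.
Qed.

(** * A countable family of discs crossing the unit circle *)

Definition dense_seq (n : nat) : R :=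
  let (a, b) := Cantor.of_nat n in
  let (s, t) := Cantor.of_nat a in (INR s - INR t) / INR (S b).

(** With [1 / (N + 1) < y - x] and [m] the least integer above [x * (N + 1)], the fraction
    [m / (N + 1)] lies strictly between. *)
Lemma dense_seq_between (x y : R) : x < y -> exists n, x < dense_seq n < y.
Proof.
intros Hxy.
assert (HN : exists N : nat, / INR (S N) < y - x).
{ destruct (archimed_cor1 (y - x)) as [N [HN1 HN2]]; [lra|].
  exists (pred N). now rewrite Nat.succ_pred by lia. }
destruct HN as [N HN]. assert (HNp : 0 < INR (S N)) by (apply lt_0_INR; lia).
set (m := up (x * INR (S N))).
destruct (archimed (x * INR (S N))) as [H1 H2]. fold m in H1, H2.
(* [m] may be negative, so it is coded as the difference of its positive and negative parts. *)
exists (Cantor.to_nat (Cantor.to_nat (Z.to_nat m, Z.to_nat (- m)), N)).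
unfold dense_seq. rewrite !Cantor.cancel_of_to.
replace (INR (Z.to_nat m) - INR (Z.to_nat (- m))) with (IZR m).
2: { rewrite !INR_IZR_INZ, <- minus_IZR. f_equal. lia. }
assert (E : / INR (S N) * INR (S N) = 1) by (field; lra).
split.
- apply Rlt_div_r; lra.
- apply Rlt_div_l; [exact HNp|]. nra.
Qed.

Definition valid (z0 : C) (r : R) : Prop := Cmod z0 < 1 < Cmod z0 + r.

Definition ratC (i j : nat) : C := (dense_seq i, dense_seq j).

Lemma circle_point_in_disc (z0 : C) (r : R) :
  valid z0 r -> exists zeta, unit_circle zeta /\ open_disc z0 r zeta.
Proof.
intros [H0 Hr].
destruct (Req_dec (Cmod z0) 0) as [E|E].
- exists (RtoC 1). unfold unit_circle, open_disc. split; [apply Cmod_1|].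
  apply Cmod_eq_0 in E. subst z0. rewrite Cmod_0 in Hr.
  replace (1 - 0)%C with (RtoC 1) by ring. rewrite Cmod_1. lra.
- assert (Hp : 0 < Cmod z0) by (assert (H := Cmod_ge_0 z0); lra).
  exists (RtoC (/ Cmod z0) * z0)%C. unfold unit_circle, open_disc. split.
  + rewrite Cmod_mult, Cmod_R, Rabs_pos_eq by (apply Rlt_le, Rinv_0_lt_compat, Hp).
    now field.
  + replace (RtoC (/ Cmod z0) * z0 - z0)%C with (RtoC (/ Cmod z0 - 1) * z0)%C
      by (rewrite RtoC_minus; ring).
    assert (H1 : 1 < / Cmod z0) by (rewrite <- Rinv_1 at 1; apply Rinv_lt_contravar; lra).
    rewrite Cmod_mult, Cmod_R, Rabs_pos_eq by lra.
    replace ((/ Cmod z0 - 1) * Cmod z0) with (1 - Cmod z0) by (field; lra). lra.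
Qed.

Lemma extendable_of_cap (f F : C -> C) (z0 : C) (r : R) :
  valid z0 r -> holomorphic_on (open_disc z0 r) F ->
  (forall z, cap z0 r z -> f z = F z) -> extendable f.
Proof.
intros Hv HF HfF.
assert (Hr0 : 0 < r) by (destruct Hv; lra).
exists (open_disc z0 r), F. split.
{ split; [apply open_open_disc|]. split; [apply convex_connected, convex_open_disc|].
  exists z0. now apply open_disc_center. }
split; [now apply circle_point_in_disc|]. split; [exact HF|].
exists (inter (open_disc z0 r) unit_disc). split; [|exact HfF].
apply connected_component_self with z0; [apply disc_cap_connected|].
split; [now apply open_disc_center|apply Hv].
Qed.

Lemma cap_nonempty (zeta : C) (r : R) :
  unit_circle zeta -> 0 < r -> exists z, cap zeta r z.
Proof.
intros Hz Hr. unfold unit_circle in Hz. set (t := Rmin (r / 2) (1 / 2)).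
assert (Ht : 0 < t) by (apply Rmin_pos; lra).
assert (Ht1 : t <= r / 2) by apply Rmin_l. assert (Ht2 : t <= 1 / 2) by apply Rmin_r.
exists (RtoC (1 - t) * zeta)%C. unfold cap, open_disc, unit_disc. split.
- replace (RtoC (1 - t) * zeta - zeta)%C with (RtoC (- t) * zeta)%C
    by (rewrite RtoC_minus, RtoC_opp; ring).
  rewrite Cmod_mult, Cmod_R, Hz, Rabs_Ropp, Rabs_pos_eq; lra.
- rewrite Cmod_mult, Cmod_R, Hz, Rabs_pos_eq; lra.
Qed.

(** The centre is a rational point within [e / 2] of [(1 - e) * zeta], hence within [3 * e / 2] of
    [zeta]; a radius between [3 * e / 2] and [2 * e] reaches past the circle. The factor [2] keeps
    the doubled disc inside the given one: [3 * e / 2 + 4 * e <= 6 * e <= eps]. *)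
Lemma ratC_approx (zeta : C) (eps : R) :
  unit_circle zeta -> 0 < eps -> exists i j k,
    valid (ratC i j) (dense_seq k) /\
    Cmod (ratC i j - zeta) + 2 * dense_seq k <= eps.
Proof.
intros Hz Heps. unfold unit_circle in Hz. set (e := Rmin (eps / 6) (1 / 2)).
assert (He : 0 < e) by (apply Rmin_pos; lra).
assert (He1 : e <= eps / 6) by apply Rmin_l. assert (He2 : e <= 1 / 2) by apply Rmin_r.
set (p := (RtoC (1 - e) * zeta)%C).
destruct (dense_seq_between (fst p - e / 4) (fst p + e / 4)) as [i Hi]; [lra|].
destruct (dense_seq_between (snd p - e / 4) (snd p + e / 4)) as [j Hj]; [lra|].
destruct (dense_seq_between (3 * e / 2) (2 * e)) as [k Hk]; [lra|].
exists i, j, k.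
assert (Hp : Cmod (ratC i j - p) < e / 2).
{ eapply Rle_lt_trans; [apply Cmod_le_components|]. simpl.
  assert (H1 : Rabs (dense_seq i + - fst p) < e / 4) by (apply Rabs_lt_between; lra).
  assert (H2 : Rabs (dense_seq j + - snd p) < e / 4) by (apply Rabs_lt_between; lra).
  simpl in H1, H2. lra. }
assert (Hpz : Cmod (p - zeta) = e).
{ unfold p. replace (RtoC (1 - e) * zeta - zeta)%C with (RtoC (- e) * zeta)%C
    by (rewrite RtoC_minus, RtoC_opp; ring).
  rewrite Cmod_mult, Cmod_R, Hz, Rabs_Ropp, Rabs_pos_eq; lra. }
assert (Hpm : Cmod p = 1 - e).
{ unfold p. rewrite Cmod_mult, Cmod_R, Hz, Rabs_pos_eq; lra. }
assert (H1 := Cmod_triangle_sub (ratC i j) p zeta).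
assert (H2 := Cmod_sub_ge (ratC i j) p).
assert (H3 := Cmod_sub_ge zeta (ratC i j)). rewrite Cmod_sub_sym in H3.
unfold valid. lra.
Qed.

Lemma cap_sub (z0 zeta : C) (r eps : R) :
  Cmod (z0 - zeta) + r <= eps -> forall z, open_disc z0 r z -> open_disc zeta eps z.
Proof.
intros H z Hz. unfold open_disc in *. assert (H1 := Cmod_triangle_sub z z0 zeta). lra.
Qed.

(** A valid disc contains a small disc about some point of the circle, and every disc about a point
    of the circle contains a valid disc of the family. *)
Lemma totally_unbounded_iff (g : C -> C) :
  totally_unbounded g <->
  forall i j k, valid (ratC i j) (dense_seq k) -> forall m : nat,
    exists z, cap (ratC i j) (dense_seq k) z /\ INR m < Cmod (g z).
Proof.
split.
- intros Hg i j k Hv m. destruct (circle_point_in_disc _ _ Hv) as [zeta [Hz Hd]].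
  set (z0 := ratC i j) in *. set (r := dense_seq k) in *. unfold open_disc in Hd.
  set (eps := r - Cmod (zeta - z0)). assert (Heps : 0 < eps) by (unfold eps; lra).
  destruct (cap_nonempty zeta eps Hz Heps) as [x Hx].
  apply NNPP. intros Hn.
  apply (Hg zeta eps Hz Heps (inter (open_disc zeta eps) unit_disc)).
  + apply connected_component_self with x; [apply disc_cap_connected|exact Hx].
  + exists (INR m). intros z [Hz1 Hz2]. apply Rnot_lt_le. intros Hlt. apply Hn.
    exists z. split; [|exact Hlt]. split; [|exact Hz2].
    apply (cap_sub zeta z0 eps r); [unfold eps; lra|exact Hz1].
- intros Hg zeta eps Hz Heps Y HY [M HM].
  destruct (ratC_approx zeta eps Hz Heps) as [i [j [k [Hv Hk]]]].
  assert (HMm : exists m : nat, M <= INR m).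
  { destruct (INR_archimed 1 M Rlt_0_1) as [m Hm]. exists m. lra. }
  destruct HMm as [m Hm].
  destruct (Hg i j k Hv m) as [z [[Hz1 Hz2] Hlt]].
  assert (Hr : 0 < dense_seq k) by (destruct Hv; lra).
  assert (H1 : Cmod (g z) <= M); [|lra]. apply HM.
  apply (component_of_connected _ _ (disc_cap_connected zeta eps) HY).
  split; [|exact Hz2]. apply (cap_sub (ratC i j) zeta (dense_seq k)); [lra|exact Hz1].
Qed.

Lemma power_series_sum (c : nat -> C) (z0 : C) (r M : R) :
  0 < r -> (forall n, Cmod (c n) * r ^ n <= M) ->
  exists F : C -> C, forall z, Cmod (z - z0) < r -> is_Cpseries c (z - z0)%C (F z).
Proof.
intros Hr HM.
apply (choice (fun z l => Cmod (z - z0) < r -> is_Cpseries c (z - z0)%C l)).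
intros z. destruct (Rlt_le_dec (Cmod (z - z0)) r) as [Hz|Hz].
- assert (Hq : 0 <= Cmod (z - z0) / r < 1).
  { split; [apply Rdiv_le_0_compat; [apply Cmod_ge_0|lra]|]. apply Rlt_div_l; lra. }
  destruct (ex_Cseries_le (fun n => c n * (z - z0) ^ n)%C
    (fun n => M * (Cmod (z - z0) / r) ^ n)) as [l Hl].
  + intros n. rewrite Cmod_mult, Cmod_pow.
    replace (Cmod (z - z0) ^ n) with (r ^ n * (Cmod (z - z0) / r) ^ n)
      by (rewrite <- Rpow_mult_distr; f_equal; field; lra).
    rewrite <- Rmult_assoc. apply Rmult_le_compat_r; [now apply pow_le|apply HM].
  + apply (ex_series_scal_l M (fun n => (Cmod (z - z0) / r) ^ n)). apply ex_series_geom. rewrite Rabs_pos_eq; lra.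
  + exists l. intros _. now apply is_Cpseries_term.
- exists (RtoC 0). intros H. lra.
Qed.

(** If [c n * r ^ n] is bounded, the Taylor series sums to some [F] on the whole disc, and [F]
    agrees with [f] near [z0], hence on the connected trace. Conversely an extension is holomorphic
    on the double of some valid disc. *)
Lemma non_extendable_iff (f : C -> C) :
  hol_disc f ->
  (non_extendable f <->
   forall i j k, valid (ratC i j) (dense_seq k) -> forall m : nat,
     ~ exists c, taylor_at f (ratC i j) c /\
         forall n, Cmod (c n) * dense_seq k ^ n <= INR m).
Proof.
intros Hf. split.
- intros Hne i j k Hv m [c [Hc Hm]]. apply Hne.
  set (z0 := ratC i j) in *. set (r := dense_seq k) in *.
  assert (Hr : 0 < r) by (destruct Hv; lra).
  destruct (power_series_sum c z0 r (INR m) Hr Hm) as [F HF].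
  assert (HFd : holomorphic_on (open_disc z0 r) F).
  { intros z Hz. destruct (Cpseries_is_derive c F z0 z r HF Hz) as [l [Hl _]].
    now exists l. }
  apply (extendable_of_cap f F z0 r Hv HFd).
  intros z Hz.
  assert (H0 : (f z + - (1) * F z)%C = 0).
  { apply (identity_theorem (inter (open_disc z0 r) unit_disc)
      (fun w => f w + - (1) * F w)%C z0 (1 - Cmod z0)).
    - apply open_inter; [apply open_open_disc|apply open_unit_disc].
    - apply disc_cap_connected.
    - intros w [Hw1 Hw2]. apply ex_Cderive_plus_scal; [now apply Hf|now apply HFd].
    - split; [now apply open_disc_center|apply Hv].
    - destruct Hv; lra.
    - intros w Hw. replace (F w) with (f w); [ring|].
      apply (is_Cseries_unique _ _ _ (proj1 (is_Cpseries_term _ _ _) (Hc w Hw))).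
      apply (proj1 (is_Cpseries_term _ _ _)), HF. destruct Hv; lra.
    - exact Hz. }
  replace (f z) with (f z + - (1) * F z + F z)%C by ring. rewrite H0. ring.
- intros H Hext. destruct (extendable_local f Hext) as [zeta [eps [F [Hz [Heps [HF HfF]]]]]].
  destruct (ratC_approx zeta eps Hz Heps) as [i [j [k [Hv Hk]]]].
  set (z0 := ratC i j) in *. set (r := dense_seq k) in *.
  assert (Hr : 0 < r) by (destruct Hv; lra).
  assert (Hsub : forall z, open_disc z0 (2 * r) z -> open_disc zeta eps z)
    by now apply cap_sub.
  (* Convergence of this expansion at the interior point [z0 + r] bounds [c n * r ^ n]. *)
  destruct (taylor_disc F z0 (2 * r)) as [c [Hc _]]; [lra| |].
  { intros z Hzr. apply HF. now apply Hsub. }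
  assert (Er : (z0 + r - z0)%C = RtoC r) by ring.
  assert (Hb : exists M, forall n, Cmod (c n) * r ^ n <= M).
  { assert (H1 := Hc (z0 + r)%C). rewrite Er, Cmod_R, Rabs_pos_eq in H1 by lra.
    specialize (H1 ltac:(lra)). apply (proj1 (is_Cpseries_term _ _ _)), is_Cseries_bounded in H1.
    destruct H1 as [M HM]. exists M. intros n. specialize (HM n).
    rewrite Cmod_mult, Cmod_pow, Cmod_R, Rabs_pos_eq in HM by lra. exact HM. }
  destruct Hb as [M HM].
  destruct (INR_archimed 1 M Rlt_0_1) as [m Hm].
  apply (H i j k Hv m). exists c. split.
  + intros z Hzd. rewrite HfF.
    * apply Hc. fold z0 in Hzd. destruct Hv. lra.
    * split; [apply Hsub; unfold open_disc; fold z0 in Hzd; destruct Hv; lra|].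
      now apply inner_disc with z0.
  + intros n. specialize (HM n). fold r. lra.
Qed.

(** Uniform control of the coefficient sup norm by the metric: the only property of [d] that the
    openness arguments use. *)
Definition dominates_coef (X : (C -> C) -> Prop) (d : (C -> C) -> (C -> C) -> R) : Prop :=
  forall del, 0 < del -> exists r, 0 < r /\ forall f g, X f -> X g -> d f g < r ->
    forall k, Cmod (coef f k - coef g k) <= del.

Lemma Gdelta_countable (X : (C -> C) -> Prop) (d : (C -> C) -> (C -> C) -> R)
    (A : (C -> C) -> Prop) (O : nat -> nat -> nat -> nat -> (C -> C) -> Prop) :
  (forall i j k m, open_in X d (O i j k m)) ->
  (forall f, X f -> (A f <-> forall i j k m, O i j k m f)) ->
  Gdelta_in X d A.
Proof.
intros HO HA.
exists (fun n => let (a, b) := Cantor.of_nat n in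
  let (i, j) := Cantor.of_nat a in let (k, m) := Cantor.of_nat b in O i j k m).
split.
- intros n. destruct (Cantor.of_nat n) as [a b].
  destruct (Cantor.of_nat a), (Cantor.of_nat b). apply HO.
- intros f Hf. rewrite (HA f Hf). split.
  + intros H n. destruct (Cantor.of_nat n) as [a b].
    destruct (Cantor.of_nat a), (Cantor.of_nat b). apply H.
  + intros H i j k m.
    specialize (H (Cantor.to_nat (Cantor.to_nat (i, j), Cantor.to_nat (k, m)))).
    rewrite !Cantor.cancel_of_to in H. exact H.
Qed.

(** Common source of both families of open sets: index [1] serves the derivative at a point,
    arbitrary [n] the growth of the coefficients. *)
Lemma open_taylor_coef (X : (C -> C) -> Prop) (d : (C -> C) -> (C -> C) -> R)
    (z0 : C) (n : nat) (t : R) :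
  (forall f, X f -> hol_disc f) -> dominates_coef X d ->
  unit_disc z0 ->
  open_in X d (fun f => exists c, taylor_at f z0 c /\ t < Cmod (c n)).
Proof.
intros X_hol d_coef Hz0 f Xf [c [Hc Ht]].
set (r := (1 - Cmod z0) / 2). assert (Hr : 0 < r) by (unfold r, unit_disc in *; lra).
assert (Hrn := pow_lt r n Hr).
set (gap := Cmod (c n) - t). assert (Hgap : 0 < gap) by (unfold gap; lra).
(* [taylor_at_close] divides by [r ^ n * r], so the n-th coefficient moves by at most [gap / 2]. *)
destruct (d_coef (gap / 2 * r ^ n * r)) as [e [He H]].
{ apply Rmult_lt_0_compat; [apply Rmult_lt_0_compat|]; lra. }
exists e. split; [exact He|]. intros g Xg Hfg.
destruct (taylor_at_exists g z0 (X_hol g Xg) Hz0) as [c' Hc'].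
exists c'. split; [exact Hc'|].
assert (H1 := taylor_at_close f g z0 c c' _ n (X_hol f Xf) (X_hol g Xg) Hz0 Hc Hc'
  (H f g Xf Xg Hfg)). fold r in H1.
replace (gap / 2 * r ^ n * r / r) with (gap / 2 * r ^ n) in H1 by (field; lra).
apply Rmult_le_reg_r in H1; [|exact Hrn].
assert (H2 := Cmod_sub_ge (c n) (c' n)). unfold gap in *. lra.
Qed.

(** Validity is a premise inside each open set, so that indices of invalid discs contribute the
    whole space. *)
Lemma Gdelta_totally_unbounded (X : (C -> C) -> Prop) (d : (C -> C) -> (C -> C) -> R) :
  (forall f, X f -> hol_disc f) -> dominates_coef X d ->
  Gdelta_in X d (fun f => totally_unbounded (C_derive f)).
Proof.
intros X_hol d_coef. apply Gdelta_countable with (fun i j k m f => valid (ratC i j) (dense_seq k) ->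
  exists z, cap (ratC i j) (dense_seq k) z /\ INR m < Cmod (C_derive f z)).
- intros i j k m f Xf Hf.
  destruct (classic (valid (ratC i j) (dense_seq k))) as [Hv|Hv].
  + destruct (Hf Hv) as [z [Hz Hm]].
    destruct (taylor_at_exists f z (X_hol f Xf) (proj2 Hz)) as [c Hc].
    rewrite (taylor_at_C_derive f z c (proj2 Hz) Hc) in Hm.
    destruct (open_taylor_coef X d z 1 (INR m) X_hol d_coef (proj2 Hz) f Xf) as [r [Hr H]]; [now exists c|].
    exists r. split; [exact Hr|]. intros g Xg Hfg _. exists z. split; [exact Hz|].
    destruct (H g Xg Hfg) as [c' [Hc' Hm']].
    now rewrite (taylor_at_C_derive g z c' (proj2 Hz) Hc').
  + exists 1. split; [lra|]. tauto.
- intros f _. rewrite totally_unbounded_iff.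
  split; intros H i j k; [intros m Hv|intros Hv m]; now apply H.
Qed.

Lemma Gdelta_non_extendable (X : (C -> C) -> Prop) (d : (C -> C) -> (C -> C) -> R) :
  (forall f, X f -> hol_disc f) -> dominates_coef X d ->
  Gdelta_in X d non_extendable.
Proof.
intros X_hol d_coef. apply Gdelta_countable with (fun i j k m f => valid (ratC i j) (dense_seq k) ->
  ~ exists c, taylor_at f (ratC i j) c /\ forall n, Cmod (c n) * dense_seq k ^ n <= INR m).
- intros i j k m f Xf Hf.
  destruct (classic (valid (ratC i j) (dense_seq k))) as [Hv|Hv].
  + specialize (Hf Hv). set (z0 := ratC i j) in *. set (r0 := dense_seq k) in *.
    assert (Hr0 : 0 < r0) by (destruct Hv; lra).
    destruct (taylor_at_exists f z0 (X_hol f Xf) (proj1 Hv)) as [c Hc].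
    (* The Taylor sequence at [z0] exists, so the negated existential amounts to a single index
       violating the bound, a condition that is open in [f]. *)
    assert (Hn : exists n, INR m < Cmod (c n) * r0 ^ n).
    { apply NNPP. intros Hn. apply Hf. exists c. split; [exact Hc|]. intros n.
      apply Rnot_lt_le. intros Hlt. apply Hn. now exists n. }
    destruct Hn as [n Hn]. assert (Hp := pow_lt r0 n Hr0).
    destruct (open_taylor_coef X d z0 n (INR m / r0 ^ n) X_hol d_coef (proj1 Hv) f Xf) as [r [Hr H]].
    { exists c. split; [exact Hc|]. apply Rlt_div_l; lra. }
    exists r. split; [exact Hr|]. intros g Xg Hfg _ [c2 [Hc2 Hm2]].
    destruct (H g Xg Hfg) as [c' [Hc' Hm']].
    assert (E : c' n = c2 n).
    { apply (is_Cpseries_coef_unique c' c2 (fun w => g (w + z0)%C) (1 - Cmod z0)).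
      - destruct Hv; lra.
      - intros w Hw. assert (Ew : (w + z0 - z0)%C = w) by ring.
        rewrite <- Ew at 1. apply Hc'. now rewrite Ew.
      - intros w Hw. assert (Ew : (w + z0 - z0)%C = w) by ring.
        rewrite <- Ew at 1. apply Hc2. now rewrite Ew. }
    rewrite E in Hm'. specialize (Hm2 n). apply Rlt_div_l in Hm'; lra.
  + exists 1. split; [lra|]. tauto.
- intros f Xf. rewrite (non_extendable_iff f (X_hol f Xf)).
  split; intros H i j k; [intros m Hv|intros Hv m]; now apply H.
Qed.

(** * A lacunary series and density *)

Lemma hol_disc_of_coef (c : nat -> C) (M : R) :
  (forall n, Cmod (c n) <= M) ->
  exists h, hol_disc h /\ forall n, coef h n = c n.
Proof.
intros HM.
destruct (power_series_sum c 0 1 M) as [F HF]; [lra| |].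
{ intros n. rewrite pow1, Rmult_1_r. apply HM. }
set (h := fun z => if Rlt_dec (Cmod z) 1 then F z else RtoC 0).
assert (HhF : forall z, unit_disc z -> h z = F z).
{ intros z Hz. unfold h. destruct (Rlt_dec (Cmod z) 1); [reflexivity|contradiction]. }
exists h. split; [split|].
- intros z Hz.
  destruct (Cpseries_is_derive c F 0 z 1 HF (proj1 (unit_disc_open_disc z) Hz)) as [l [Hl _]].
  destruct (proj1 (open_Cmod _) open_unit_disc z Hz) as [d [Hd H]].
  exists l. apply is_Cderive_ext_loc with F d; [exact Hd| |exact Hl].
  intros w Hw. symmetry. now apply HhF, H.
- intros z Hz. unfold h. destruct (Rlt_dec (Cmod z) 1); [contradiction|reflexivity].
- apply coef_unique. intros z Hz. rewrite HhF by exact Hz.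
  replace z with (z - 0)%C at 1 by ring. apply HF.
  exact (proj1 (unit_disc_open_disc z) Hz).
Qed.

(** The value is 2^(-k) at n = 16^k and [0] elsewhere; since 16^k = 2^(4k), the quotient
    [Nat.log2 n / 4] is the only candidate for [k]. *)
Definition lac (n : nat) : R :=
  let k := (Nat.log2 n / 4)%nat in
  if Nat.eq_dec n (16 ^ k) then (/ 2) ^ k else 0.

Lemma lac_pow (k : nat) : lac (16 ^ k) = (/ 2) ^ k.
Proof.
unfold lac. assert (E : (Nat.log2 (16 ^ k) / 4 = k)%nat).
{ replace (16 ^ k)%nat with (2 ^ (4 * k))%nat by (rewrite Nat.pow_mul_r; reflexivity).
  rewrite Nat.log2_pow2 by lia. rewrite Nat.mul_comm. apply Nat.div_mul. lia. }
rewrite E. destruct (Nat.eq_dec (16 ^ k) (16 ^ k)); [reflexivity|contradiction].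
Qed.

Lemma lac_0 (n : nat) : (forall k, n <> (16 ^ k)%nat) -> lac n = 0.
Proof.
intros H. unfold lac. destruct (Nat.eq_dec n _) as [E|E]; [|reflexivity].
exfalso. exact (H _ E).
Qed.

Lemma lac_bounds (n : nat) : 0 <= lac n <= 1.
Proof.
unfold lac. destruct (Nat.eq_dec n _) as [E|E]; [|lra].
split; [apply pow_le; lra|]. rewrite <- (pow1 (Nat.log2 n / 4)). apply pow_incr. lra.
Qed.

(** Stated over a monoid because it serves both the real p-th powers and the complex terms of the
    derivative. *)
Lemma sum_n_lacunary {G : AbelianMonoid} (F : nat -> G) (m : nat) :
  (forall n, (forall k, n <> (16 ^ k)%nat) -> F n = zero) ->
  sum_n F (16 ^ m) = sum_n (fun k => F (16 ^ k)%nat) m.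
Proof.
intros HF. induction m as [|m IH].
- rewrite sum_O. simpl Nat.pow. rewrite sum_Sn, sum_O, HF, plus_zero_l; [reflexivity|].
  intros k E. assert (H := Nat.pow_nonzero 16 k ltac:(lia)). lia.
- assert (Hgap : forall j, (16 ^ m + j < 16 ^ S m)%nat ->
    sum_n F (16 ^ m + j) = sum_n F (16 ^ m)).
  { induction j as [|j IHj]; intros Hj; [now rewrite Nat.add_0_r|].
    rewrite Nat.add_succ_r, sum_Sn, IHj by lia. rewrite HF, plus_zero_r; [reflexivity|].
    intros k E. destruct (Nat.le_gt_cases k m) as [Hk|Hk].
    - assert (H := Nat.pow_le_mono_r 16 k m ltac:(lia) Hk). lia.
    - assert (H := Nat.pow_le_mono_r 16 (S m) k ltac:(lia) Hk). lia. }
  assert (Hp : (16 ^ m < 16 ^ S m)%nat) by (apply Nat.pow_lt_mono_r; lia).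
  rewrite sum_Sn, <- IH.
  rewrite <- (Hgap (16 ^ S m - 16 ^ m - 1)%nat) by lia.
  remember (16 ^ S m)%nat as N. destruct N as [|N]; [lia|].
  rewrite sum_Sn. f_equal. f_equal. lia.
Qed.

Lemma rpow_pos (x p : R) : 0 < x -> rpow x p = Rpower x p.
Proof. intros H. unfold rpow. destruct (Rlt_dec 0 x); [reflexivity|contradiction]. Qed.

Lemma rpow_0 (p : R) : rpow 0 p = 0.
Proof. unfold rpow. destruct (Rlt_dec 0 0); [lra|reflexivity]. Qed.

Lemma rpow_ge_0 (x p : R) : 0 <= rpow x p.
Proof. unfold rpow. destruct (Rlt_dec 0 x); [apply Rlt_le, exp_pos|lra]. Qed.

Lemma ex_series_bounded_nonneg (b : nat -> R) (M : R) :
  (forall n, 0 <= b n) -> (forall n, sum_n b n <= M) -> ex_series b.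
Proof.
intros Hb HM. destruct (ex_finite_lim_seq_incr (sum_n b) M) as [l Hl].
- intros n. rewrite sum_Sn. unfold plus; simpl. specialize (Hb (S n)). lra.
- exact HM.
- now exists l.
Qed.

Lemma sum_n_incr_le (b : nat -> R) (n m : nat) :
  (forall k, 0 <= b k) -> (n <= m)%nat -> sum_n b n <= sum_n b m.
Proof.
intros Hb Hnm. induction Hnm as [|m Hnm IH]; [lra|].
rewrite sum_Sn. unfold plus; simpl. specialize (Hb (S m)). lra.
Qed.

(** The nonzero terms form the geometric series of ratio 2^(-p), below [1] for every [p > 0]. *)
Lemma ex_series_rpow_lac (p : R) :
  0 < p -> ex_series (fun n => rpow (lac n) p).
Proof.
intros Hp. set (q := Rpower (/ 2) p).
assert (Hq : 0 < q < 1).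
{ split; [apply exp_pos|]. unfold q, Rpower. rewrite <- exp_0. apply exp_increasing.
  rewrite ln_Rinv by lra. assert (H := ln_lt_2). nra. }
apply ex_series_bounded_nonneg with (Series (fun n => q ^ n)).
{ intros n. apply rpow_ge_0. }
intros n.
assert (Hn : (n <= 16 ^ n)%nat) by (apply Nat.lt_le_incl, Nat.pow_gt_lin_r; lia).
eapply Rle_trans; [apply (sum_n_incr_le _ n (16 ^ n)); [intros; apply rpow_ge_0|exact Hn]|].
rewrite sum_n_lacunary.
2: { intros k Hk. rewrite lac_0 by exact Hk. apply rpow_0. }
rewrite (sum_n_ext _ (fun k => q ^ k)).
- apply sum_n_le_Series; [intros k; apply pow_le; lra|].
  apply ex_series_geom. rewrite Rabs_pos_eq; lra.
- intros k. rewrite lac_pow, rpow_pos by (apply pow_lt; lra).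
  unfold q. rewrite <- !Rpower_pow by (try apply exp_pos; lra).
  rewrite !Rpower_mult. f_equal. ring.
Qed.

(** Term [K] has modulus [8 ^ K / 2]. The earlier terms add up to at most [8 ^ K / 7], and term
    [K + i] is at most [8 ^ K * (/ 8) ^ i], so the later ones also stay below [8 ^ K / 7]; 1/2 - 1/7
    - 1/7 = 3/14. The summand [(/ 8) ^ j / 7] is the part of the tail allowance still unspent after
    [j] terms and makes the induction close. *)
Lemma Cmod_lacunary_ge (z : C) (K j : nat) :
  Cmod z ^ (16 ^ K) = / 2 -> Cmod z <= 1 ->
  8 ^ K * (3 / 14 + (/ 8) ^ j / 7) <=
  Cmod (sum_n (fun k => RtoC (8 ^ k) * z ^ (16 ^ k))%C (K + j)).
Proof.
intros Hz Hz1. set (S := sum_n (fun k => RtoC (8 ^ k) * z ^ (16 ^ k))%C).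
assert (H8 : forall k, 0 < 8 ^ k) by (intros k; apply pow_lt; lra).
assert (Ht : forall k, Cmod (RtoC (8 ^ k) * z ^ (16 ^ k)) = 8 ^ k * Cmod z ^ (16 ^ k)).
{ intros k. rewrite Cmod_mult, Cmod_pow, Cmod_R, Rabs_pos_eq; [reflexivity|].
  apply Rlt_le, H8. }
assert (Hlow : forall m, Cmod (S m) <= 8 * 8 ^ m / 7).
{ induction m as [|m IH].
  - unfold S. rewrite sum_O, Ht.
    assert (H : Cmod z ^ (16 ^ 0) <= 1).
    { rewrite <- (pow1 (16 ^ 0)). apply pow_incr. split; [apply Cmod_ge_0|exact Hz1]. }
    change (8 ^ 0) with 1. lra.
  - unfold S. rewrite sum_Sn. fold S. change plus with Cplus.
    eapply Rle_trans; [apply Cmod_triangle|]. rewrite Ht.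
    assert (H : Cmod z ^ (16 ^ Datatypes.S m) <= 1).
    { rewrite <- (pow1 (16 ^ Datatypes.S m)). apply pow_incr.
      split; [apply Cmod_ge_0|exact Hz1]. }
    assert (H' := Rmult_le_compat_l _ _ _ (Rlt_le _ _ (H8 (Datatypes.S m))) H).
    change (8 ^ Datatypes.S m) with (8 * 8 ^ m) in *. lra. }
induction j as [|j IH].
- rewrite Nat.add_0_r. change ((/ 8) ^ 0) with 1.
  destruct K as [|K].
  + unfold S. rewrite sum_O, Ht, Hz. change (8 ^ 0) with 1. lra.
  + unfold S. rewrite sum_Sn. fold S. change plus with Cplus.
    specialize (Hlow K).
    assert (H1 := Cmod_sub_ge (RtoC (8 ^ Datatypes.S K) * z ^ (16 ^ Datatypes.S K))
      (- S K)).
    rewrite Cmod_opp, Ht, Hz in H1.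
    match type of H1 with _ <= Cmod ?t => match goal with |- _ <= Cmod ?u =>
      replace u with t by ring end end.
    change (8 ^ Datatypes.S K) with (8 * 8 ^ K) in *. lra.
- rewrite Nat.add_succ_r. unfold S. rewrite sum_Sn. fold S. change plus with Cplus.
  set (i := Datatypes.S j) in *.
  assert (Htail : Cmod (RtoC (8 ^ Datatypes.S (K + j)) * z ^ (16 ^ Datatypes.S (K + j)))
     <= 8 ^ K * (/ 8) ^ i).
  { rewrite Ht. replace (Datatypes.S (K + j)) with (K + i)%nat by (unfold i; lia).
    rewrite pow_add, Nat.pow_add_r, pow_mult, Hz.
    rewrite Rmult_assoc. apply Rmult_le_compat_l; [apply Rlt_le, H8|].
    apply Rle_trans with (8 ^ i * (/ 2) ^ (6 * i)).
    - apply Rmult_le_compat_l; [apply Rlt_le, H8|].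
      (* Thus 2^(-16^i) is at most 64^(-i), which turns the growth 8^i into the decay 8^(-i). *)
      assert (Hi : (6 * i <= 16 ^ i)%nat).
      { generalize i. clear. induction i as [|i IH]; [simpl; lia|]. rewrite Nat.pow_succ_r'.
        assert (H := Nat.pow_nonzero 16 i ltac:(lia)). lia. }
      replace (16 ^ i)%nat with (6 * i + (16 ^ i - 6 * i))%nat by lia.
      rewrite pow_add. rewrite <- (Rmult_1_r ((/ 2) ^ (6 * i))) at 2.
      apply Rmult_le_compat_l; [apply pow_le; lra|].
      rewrite <- (pow1 (16 ^ i - 6 * i)). apply pow_incr. lra.
    - rewrite pow_mult, <- Rpow_mult_distr. apply Req_le. f_equal. simpl. field. }
  assert (H1 := Cmod_sub_ge (S (K + j)%nat)
    (- (RtoC (8 ^ Datatypes.S (K + j)) * z ^ (16 ^ Datatypes.S (K + j))))).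
  rewrite Cmod_opp in H1.
  match type of H1 with _ <= Cmod ?t => match goal with |- _ <= Cmod ?u =>
    replace u with t by ring end end.
  assert (E : (/ 8) ^ j = 8 * (/ 8) ^ i) by (unfold i; simpl; field).
  rewrite E in IH. assert (HK := H8 K). nra.
Qed.

Lemma lacunary_exists :
  exists h, hol_disc h /\ (forall n, coef h n = RtoC (lac n)) /\
    totally_unbounded (C_derive h).
Proof.
destruct (hol_disc_of_coef (fun n => RtoC (lac n)) 1) as [h [Hh Hc]].
{ intros n. rewrite Cmod_R, Rabs_pos_eq; apply lac_bounds. }
exists h. split; [exact Hh|]. split; [exact Hc|].
intros zeta eps Hzeta Heps Y HY [M HM]. unfold unit_circle in Hzeta.
(* The first condition brings the point [z] on the radius to [zeta] within [eps] of [zeta]; the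
   second makes the lower bound exceed [M]. The factor [5] below works because 5 * 3/14 > 1. *)
assert (HK : exists K, ln 2 / 16 ^ K < eps /\ M < 8 ^ K * (3 / 14)).
{ destruct (pow_lt_1_zero (/ 16) ltac:(rewrite Rabs_pos_eq; lra) (eps / 1) ltac:(lra)) as [N1 H1].
  destruct (Pow_x_infinity 8 ltac:(rewrite Rabs_pos_eq; lra) (5 * (Rabs M + 1))) as [N2 H2].
  exists (N1 + N2)%nat. split.
  - specialize (H1 (N1 + N2)%nat ltac:(lia)).
    rewrite Rabs_pos_eq, pow_inv in H1 by (apply pow_le; lra).
    assert (Hl : ln 2 < 1) by (rewrite <- (ln_exp 1); apply ln_increasing; [lra|];
      assert (He := exp_ineq1 1 ltac:(lra)); lra).
    assert (Hp : 0 < / 16 ^ (N1 + N2)) by (apply Rinv_0_lt_compat, pow_lt; lra).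
    unfold Rdiv. nra.
  - specialize (H2 (N1 + N2)%nat ltac:(lia)).
    rewrite Rabs_pos_eq in H2 by (apply pow_le; lra).
    assert (H3 := Rle_abs M). assert (H4 := Rabs_pos M). lra. }
destruct HK as [K [HK1 HK2]].
assert (H16 : 0 < 16 ^ K) by (apply pow_lt; lra).
assert (Hln2 := ln_lt_2).
set (x := ln 2 / 16 ^ K) in *.
assert (Hx : 0 < x) by (unfold x; apply Rdiv_lt_0_compat; lra).
(* This radius solves [rho ^ (16 ^ K) = / 2], as [Cmod_lacunary_ge] demands, and [1 - rho < x]. *)
set (rho := exp (- x)).
assert (Hrho : 0 < rho < 1).
{ split; [apply exp_pos|]. unfold rho. rewrite <- exp_0. apply exp_increasing. lra. }
assert (Hrho1 : 1 - x < rho).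
{ assert (H := exp_ineq1 (- x) ltac:(lra)). unfold rho. lra. }
assert (HrK : rho ^ (16 ^ K) = / 2).
{ unfold rho. rewrite <- Rpower_pow by apply exp_pos. unfold Rpower. rewrite ln_exp, pow_INR.
  replace (INR 16) with 16 by (simpl; ring).
  replace (16 ^ K * - x) with (- ln 2) by (unfold x; field; lra).
  rewrite exp_Ropp, exp_ln; lra. }
set (z := (RtoC rho * zeta)%C).
assert (Hz : Cmod z = rho).
{ unfold z. rewrite Cmod_mult, Hzeta, Cmod_R, Rabs_pos_eq; lra. }
assert (Hzd : unit_disc z) by (unfold unit_disc; lra).
assert (Yz : Y z).
{ apply (component_of_connected _ _ (disc_cap_connected zeta eps) HY).
  split; [|exact Hzd]. unfold open_disc.
  replace (z - zeta)%C with (RtoC (rho - 1) * zeta)%C by (unfold z; rewrite RtoC_minus; ring).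
  rewrite Cmod_mult, Hzeta, Cmod_R, Rabs_left; lra. }
specialize (HM z Yz).
assert (Hser : forall w, Cmod (w - 0) < 1 -> is_Cpseries (coef h) (w - 0)%C (h w)).
{ intros w Hw. apply (proj2 (unit_disc_open_disc w)) in Hw.
  replace (w - 0)%C with w by ring. now apply coef_spec. }
destruct (Cpseries_is_derive (coef h) h 0 z 1 Hser (proj1 (unit_disc_open_disc z) Hzd))
  as [l [Hl Hls]].
rewrite (is_C_derive_unique _ _ _ Hl) in HM.
(* Multiplying the derivative by [z] turns [z ^ pred n] into [z ^ n], so that the nonzero terms
   become [8 ^ k * z ^ (16 ^ k)]. *)
apply (is_Cseries_scal z) in Hls.
apply is_Cseries_Cmod with (eps := 8 ^ K * (3 / 14) - M) in Hls; [|lra].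
destruct Hls as [N HN].
specialize (HN (16 ^ (K + N))%nat).
assert (HNn : (N <= 16 ^ (K + N))%nat).
{ assert (H := Nat.pow_gt_lin_r 16 (K + N) ltac:(lia)). lia. }
specialize (HN HNn). rewrite sum_n_lacunary in HN.
2: { intros n Hn. rewrite Hc, lac_0 by exact Hn. match goal with |- ?u = _ => change (@eq C u (RtoC 0)) end. ring. }
rewrite (sum_n_ext _ (fun k => RtoC (8 ^ k) * z ^ (16 ^ k))%C) in HN.
2: { intros k. rewrite Hc, lac_pow. replace (z - 0)%C with z by ring.
  assert (Hp := Nat.pow_nonzero 16 k ltac:(lia)).
  replace (8 ^ k) with ((/ 2) ^ k * INR (16 ^ k)).
  - rewrite RtoC_mult. destruct (16 ^ k)%nat as [|m]; [lia|].
    simpl pred. rewrite Cpow_S.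
    match goal with |- ?u = ?v => change (@eq C u v) end. ring.
  - rewrite pow_INR, <- Rpow_mult_distr. f_equal. simpl. field. }
assert (H1 := Cmod_lacunary_ge z K N ltac:(now rewrite Hz) ltac:(lra)).
assert (H2 : Cmod (z * l) <= M).
{ rewrite Cmod_mult, Hz. assert (H := Cmod_ge_0 l). nra. }
match type of HN with Cmod (?u - ?v) < _ => assert (H3 := Cmod_sub_ge u v) end.
assert (H4 : 0 < (/ 8) ^ N) by (apply pow_lt; lra).
assert (H8 : 0 < 8 ^ K) by (apply pow_lt; lra).
nra.
Qed.

(** * Density by perturbation *)

(** Cantor's nested intervals: stage [n] keeps the outer quarter lying on the side of the midpoint
    away from [u n]. *)
Lemma avoid_sequence (u : nat -> R) (a b : R) :
  a < b -> exists x, a < x < b /\ forall n, x <> u n.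
Proof.
intros Hab.
set (step := fun (n : nat) (p : R * R) =>
  if Rle_dec (u n) ((fst p + snd p) / 2)
  then ((fst p + 3 * snd p) / 4, snd p) else (fst p, (3 * fst p + snd p) / 4)).
(* Starting from the middle third keeps the limit strictly between [a] and [b]. *)
set (I := nat_rect (fun _ => (R * R)%type) ((2 * a + b) / 3, (a + 2 * b) / 3) step).
assert (HI : forall n, fst (I n) < snd (I n)).
{ induction n as [|n IH]; [simpl; lra|].
  change (I (S n)) with (step n (I n)). unfold step.
  destruct (Rle_dec _ _); simpl; lra. }
destruct (nested_intervals (fun n => fst (I n)) (fun n => snd (I n))) as [x Hx].
- intros n. change (I (S n)) with (step n (I n)). specialize (HI n). unfold step.
  destruct (Rle_dec _ _); simpl; lra.
- intros n. change (I (S n)) with (step n (I n)). specialize (HI n). unfold step.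
  destruct (Rle_dec _ _); simpl; lra.
- intros n. apply Rlt_le, HI.
- exists x. split.
  + specialize (Hx 0%nat). simpl in Hx. lra.
  + intros n E. specialize (Hx (S n)). specialize (HI n).
    change (I (S n)) with (step n (I n)) in Hx. unfold step in Hx.
    destruct (Rle_dec _ _); simpl in Hx; lra.
Qed.

Definition perturb (f h : C -> C) (c : R) (z : C) : C := (f z + RtoC c * h z)%C.

Lemma C_derive_perturb (f h : C -> C) (c : R) (z : C) :
  hol_disc f -> hol_disc h -> unit_disc z ->
  C_derive (perturb f h c) z = (C_derive f z + RtoC c * C_derive h z)%C.
Proof.
intros Hf Hh Hz.
destruct (taylor_at_exists f z Hf Hz) as [a Ha].
destruct (taylor_at_exists h z Hh Hz) as [b Hb].
rewrite (taylor_at_C_derive f z a Hz Ha), (taylor_at_C_derive h z b Hz Hb).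
apply (taylor_at_C_derive _ z (fun n => a n + RtoC c * b n)%C Hz).
intros w Hw. apply is_Cpseries_plus_scal; auto.
Qed.

(** A whole interval of parameters is required, because a sequence of values of [c] has to be
    discarded from it. *)
Definition perturbation_small (X : (C -> C) -> Prop)
    (d : (C -> C) -> (C -> C) -> R) (h : C -> C) : Prop :=
  forall f r, X f -> 0 < r -> exists eta, 0 < eta /\
    forall c, 0 < c < eta -> X (perturb f h c) /\ d f (perturb f h c) < r.

(* For each disc in the countable family, [f' + c h'] is bounded on its trace
   for at most one value of [c]. *)
Lemma dense_totally_unbounded (X : (C -> C) -> Prop)
    (d : (C -> C) -> (C -> C) -> R) (h : C -> C) :
  (forall f, X f -> hol_disc f) -> hol_disc h -> totally_unbounded (C_derive h) ->
  perturbation_small X d h ->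
  dense_in X d (fun f => totally_unbounded (C_derive f)).
Proof.
intros X_hol Hh Hhu HX f Xf r Hr. assert (Hf := X_hol f Xf).
destruct (HX f r Xf Hr) as [eta [Heta Hc]].
set (bad := fun (n : nat) (c : R) =>
  let (a, k) := Cantor.of_nat n in let (i, j) := Cantor.of_nat a in
  valid (ratC i j) (dense_seq k) /\ exists m : nat,
    forall z, cap (ratC i j) (dense_seq k) z ->
      Cmod (C_derive (perturb f h c) z) <= INR m).
(* For two distinct bad values the difference [(c - c') * h'] would be bounded on the trace, against
   the total unboundedness of [h']. *)
assert (Huniq : forall n c c', bad n c -> bad n c' -> c = c').
{ intros n c c'. unfold bad. destruct (Cantor.of_nat n) as [a k].
  destruct (Cantor.of_nat a) as [i j].
  intros [Hv [m Hm]] [_ [m' Hm']]. apply NNPP. intros Hne.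
  assert (Hab : 0 < Rabs (c - c')) by (apply Rabs_pos_lt; lra).
  destruct (INR_archimed (Rabs (c - c')) (INR m + INR m') Hab) as [M HM].
  destruct (proj1 (totally_unbounded_iff _) Hhu i j k Hv M) as [z [Hz Hlt]].
  specialize (Hm z Hz). specialize (Hm' z Hz).
  rewrite C_derive_perturb in Hm, Hm' by (try assumption; apply Hz).
  assert (H1 := Cmod_sub_le (C_derive f z + RtoC c * C_derive h z)
    (C_derive f z + RtoC c' * C_derive h z)).
  replace (C_derive f z + RtoC c * C_derive h z -
    (C_derive f z + RtoC c' * C_derive h z))%C
    with (RtoC (c - c') * C_derive h z)%C in H1 by (rewrite RtoC_minus; ring).
  rewrite Cmod_mult, Cmod_R in H1. nra. }
(* [epsilon] returns the bad value of disc [n] if there is one and an arbitrary real otherwise, so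
   the values to avoid form a sequence. *)
destruct (avoid_sequence (fun n => epsilon (inhabits 0) (bad n)) 0 eta Heta) as [c [Hc1 Hc2]].
destruct (Hc c Hc1) as [HXg Hd].
exists (perturb f h c). split; [exact HXg|]. split; [|exact Hd].
apply totally_unbounded_iff. intros i j k Hv m. apply NNPP. intros Hn.
set (n := Cantor.to_nat (Cantor.to_nat (i, j), k)).
assert (Hbad : bad n c).
{ unfold bad, n. rewrite !Cantor.cancel_of_to. split; [exact Hv|]. exists m.
  intros z Hz. apply Rnot_lt_le. intros Hlt. apply Hn. now exists z. }
apply (Hc2 n). apply (Huniq n); [exact Hbad|].
apply epsilon_spec. now exists c.
Qed.

(** Continuity bounds [F] near [zeta], and Cauchy's estimate for the coefficient of index [1] on
    circles of radius [d / 4] bounds its derivative. *)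
Lemma holomorphic_derive_bounded (F : C -> C) (zeta : C) (r : R) :
  0 < r -> holomorphic_on (open_disc zeta r) F ->
  exists d M, 0 < d <= r /\ forall z, open_disc zeta d z -> Cmod (C_derive F z) <= M.
Proof.
intros Hr HF.
destruct (ex_Cderive_cont F zeta (HF zeta (open_disc_center _ _ Hr)) 1 Rlt_0_1) as [d0 [Hd0 H0]].
set (d := Rmin d0 r). assert (Hd : 0 < d) by now apply Rmin_pos.
assert (Hd1 : d <= d0) by apply Rmin_l. assert (Hd2 : d <= r) by apply Rmin_r.
exists (d / 2), ((Cmod (F zeta) + 1) / (d / 4)). split; [lra|].
intros z Hz. unfold open_disc in Hz.
destruct (taylor_disc F z (d / 2)) as [c [Hc HM]]; [lra| |].
{ intros w Hw. apply HF. unfold open_disc. assert (H := Cmod_triangle_sub w z zeta). lra. }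
rewrite (is_C_derive_unique F z (c 1%nat))
  by (apply (Cpseries_is_derive_center c F z (d / 2)); [lra|exact Hc]).
apply Rle_div_r; [lra|].
specialize (HM (d / 4) (Cmod (F zeta) + 1) 1%nat ltac:(lra)).
rewrite pow_1 in HM. apply HM. intros w Hw.
assert (H := Cmod_triangle_sub w z zeta). specialize (H0 w ltac:(lra)).
assert (H1 := Cmod_sub_ge (F w) (F zeta)). lra.
Qed.

Lemma totally_unbounded_non_extendable (f : C -> C) :
  hol_disc f -> totally_unbounded (C_derive f) -> non_extendable f.
Proof.
intros Hf Hu Hext.
destruct (extendable_local f Hext) as [zeta [r [F [Hz [Hr [HF HfF]]]]]].
destruct (holomorphic_derive_bounded F zeta r Hr HF) as [d [M [Hd HM]]].
destruct (cap_nonempty zeta d Hz (proj1 Hd)) as [x Hx].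
apply (Hu zeta d Hz (proj1 Hd) (inter (open_disc zeta d) unit_disc)).
- apply connected_component_self with x; [apply disc_cap_connected|exact Hx].
- exists M. intros z Hzd.
  replace (C_derive f z) with (C_derive F z); [now apply HM, Hzd|].
  symmetry. apply is_C_derive_unique.
  assert (Hzr : inter (open_disc zeta r) unit_disc z).
  { split; [|apply Hzd]. destruct Hzd as [H _]. unfold open_disc in *. lra. }
  destruct (HF z (proj1 Hzr)) as [l Hl].
  rewrite (is_C_derive_unique _ _ _ Hl).
  destruct (proj1 (open_Cmod _)
    (open_inter _ _ (open_open_disc zeta r) open_unit_disc) z Hzr) as [e [He H]].
  apply is_Cderive_ext_loc with F e; [exact He| |exact Hl].
  intros w Hw. symmetry. now apply HfF, H.
Qed.

(** * The metrics *)

Lemma rpow_mult_distr (x y p : R) :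
  0 <= x -> 0 <= y -> rpow (x * y) p = rpow x p * rpow y p.
Proof.
intros [Hx|<-] [Hy|<-]; rewrite ?Rmult_0_l, ?Rmult_0_r, ?rpow_0; try ring.
rewrite !rpow_pos by nra. symmetry. now apply Rpower_mult_distr.
Qed.

Lemma rpow_lt (x y p : R) : 0 < p -> 0 <= x < y -> rpow x p < rpow y p.
Proof.
intros Hp [[Hx|<-] Hy].
- rewrite !rpow_pos by lra. apply Rlt_Rpower_l; lra.
- rewrite rpow_0, rpow_pos by lra. apply exp_pos.
Qed.

Lemma rpow_le (x y p : R) : 0 < p -> 0 <= x <= y -> rpow x p <= rpow y p.
Proof.
intros Hp [Hx [Hy| ->]]; [|lra]. apply Rlt_le, rpow_lt; lra.
Qed.

Lemma rpow_rpow_inv (x p : R) : 0 < p -> 0 <= x -> rpow (rpow x p) (1 / p) = x.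
Proof.
intros Hp [Hx|<-].
- rewrite (rpow_pos x) by exact Hx. rewrite rpow_pos by apply exp_pos.
  rewrite Rpower_mult. replace (p * (1 / p)) with 1 by (field; lra).
  now apply Rpower_1.
- now rewrite !rpow_0.
Qed.

Lemma rpow_inv_rpow (x p : R) : 0 < p -> 0 <= x -> rpow (rpow x (1 / p)) p = x.
Proof.
intros Hp Hx. replace p with (1 / (1 / p)) at 2 by (field; lra).
apply rpow_rpow_inv; [|exact Hx]. apply Rdiv_lt_0_compat; lra.
Qed.

Lemma rpow_small (p r : R) :
  0 < p -> 0 < r -> exists eta, 0 < eta /\ forall c, 0 <= c < eta -> rpow c p < r.
Proof.
intros Hp Hr. exists (rpow r (1 / p)). split.
- rewrite rpow_pos by exact Hr. apply exp_pos.
- intros c Hc. rewrite <- (rpow_inv_rpow r p Hp) by lra. now apply rpow_lt.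
Qed.

(** From [x + y <= 2 * Rmax x y]; this crude constant treats [p < 1] and [p >= 1] alike. *)
Lemma rpow_plus_le (x y p : R) :
  0 < p -> 0 <= x -> 0 <= y -> rpow (x + y) p <= rpow 2 p * (rpow x p + rpow y p).
Proof.
intros Hp Hx Hy. assert (H1 := rpow_ge_0 x p). assert (H2 := rpow_ge_0 y p).
assert (H3 := rpow_ge_0 2 p).
destruct (Rle_lt_dec x y) as [H|H].
- apply Rle_trans with (rpow (2 * y) p); [apply rpow_le; lra|].
  rewrite rpow_mult_distr by lra. apply Rmult_le_compat_l; lra.
- apply Rle_trans with (rpow (2 * x) p); [apply rpow_le; lra|].
  rewrite rpow_mult_distr by lra. apply Rmult_le_compat_l; lra.
Qed.

Lemma ex_series_le_nonneg (a b : nat -> R) :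
  (forall n, 0 <= a n <= b n) -> ex_series b -> ex_series a.
Proof.
intros Hab. apply (@ex_series_le R_AbsRing R_CompleteNormedModule).
intros n. change (Rabs (a n) <= b n). rewrite Rabs_pos_eq; apply Hab.
Qed.

Lemma ex_series_rpow_combine (a b : nat -> C) (k : C) (p : R) :
  0 < p -> ex_series (fun n => rpow (Cmod (a n)) p) ->
  ex_series (fun n => rpow (Cmod (b n)) p) ->
  ex_series (fun n => rpow (Cmod (a n + k * b n)) p).
Proof.
intros Hp Ha Hb.
apply ex_series_le_nonneg with (fun n =>
  rpow 2 p * (rpow (Cmod (a n)) p + rpow (Cmod k) p * rpow (Cmod (b n)) p)).
- intros n. split; [apply rpow_ge_0|].
  rewrite <- rpow_mult_distr by apply Cmod_ge_0. rewrite <- Cmod_mult.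
  eapply Rle_trans; [|apply rpow_plus_le; [exact Hp|apply Cmod_ge_0|apply Cmod_ge_0]].
  apply rpow_le; [exact Hp|]. split; [apply Cmod_ge_0|apply Cmod_triangle].
- apply (ex_series_scal_l (rpow 2 p)
    (fun n => rpow (Cmod (a n)) p + rpow (Cmod k) p * rpow (Cmod (b n)) p)).
  apply (ex_series_plus (fun n => rpow (Cmod (a n)) p)); [exact Ha|].
  apply (ex_series_scal_l (rpow (Cmod k) p) _ Hb).
Qed.

Lemma lpa_sub_series (p : R) (f g : C -> C) :
  0 < p -> lpa p f -> lpa p g ->
  ex_series (fun n => rpow (Cmod (coef f n - coef g n)) p).
Proof.
intros Hp [_ Hf] [_ Hg].
eapply ex_series_ext; [|exact (ex_series_rpow_combine _ _ (- (1))%C p Hp Hf Hg)].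
intros n. simpl. f_equal. f_equal. ring.
Qed.

Lemma rpow_le_dist_lp (p : R) (f g : C -> C) (k : nat) :
  0 < p -> lpa p f -> lpa p g ->
  rpow (Cmod (coef f k - coef g k)) p <=
  Series (fun n => rpow (Cmod (coef f n - coef g n)) p).
Proof.
intros Hp Hf Hg.
eapply Rle_trans; [|apply (sum_n_le_Series _ k);
  [intros; apply rpow_ge_0|now apply lpa_sub_series]].
destruct k as [|k]; [rewrite sum_O; lra|].
rewrite sum_Sn. unfold plus; simpl.
assert (H := sum_n_le_sum_n (fun _ => 0)
  (fun n => rpow (Cmod (coef f n - coef g n)) p) k (fun n _ => rpow_ge_0 _ _)).
rewrite sum_n_const, Rmult_0_r in H. lra.
Qed.

Lemma dist_lp_ge_0 (p : R) (f g : C -> C) :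
  0 < p -> lpa p f -> lpa p g -> 0 <= dist_lp p f g.
Proof.
intros Hp Hf Hg. unfold dist_lp. cbv zeta. destruct (Rle_dec 1 p); [apply rpow_ge_0|].
eapply Rle_trans; [|apply (rpow_le_dist_lp p f g 0 Hp Hf Hg)]. apply rpow_ge_0.
Qed.

Lemma lpa_dominates (p : R) : 0 < p -> dominates_coef (lpa p) (dist_lp p).
Proof.
intros Hp del Hdel.
assert (H1p : 0 < 1 / p) by (apply Rdiv_lt_0_compat; lra).
destruct (Rle_dec 1 p) as [H1|H1].
- exists del. split; [exact Hdel|]. intros f g Hf Hg Hd k.
  unfold dist_lp in Hd. cbv zeta in Hd. destruct (Rle_dec 1 p); [|contradiction].
  rewrite <- (rpow_rpow_inv (Cmod _) p Hp) by apply Cmod_ge_0.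
  eapply Rle_trans; [|apply Rlt_le, Hd].
  apply rpow_le; [exact H1p|]. split; [apply rpow_ge_0|now apply rpow_le_dist_lp].
- exists (rpow del p). split; [rewrite rpow_pos by exact Hdel; apply exp_pos|].
  intros f g Hf Hg Hd k.
  unfold dist_lp in Hd. cbv zeta in Hd. destruct (Rle_dec 1 p); [contradiction|].
  rewrite <- (rpow_rpow_inv (Cmod _) p Hp) by apply Cmod_ge_0.
  rewrite <- (rpow_rpow_inv del p Hp) by lra.
  apply rpow_le; [exact H1p|]. split; [apply rpow_ge_0|].
  eapply Rle_trans; [apply rpow_le_dist_lp; assumption|now apply Rlt_le].
Qed.

Definition lac_coef (h : C -> C) : Prop :=
  hol_disc h /\ forall n, coef h n = RtoC (lac n).

Lemma Cmod_lac (n : nat) : Cmod (RtoC (lac n)) = lac n.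
Proof. rewrite Cmod_R. apply Rabs_pos_eq, lac_bounds. Qed.

Lemma hol_disc_perturb (f h : C -> C) (c : R) :
  hol_disc f -> hol_disc h -> hol_disc (perturb f h c).
Proof.
intros [Hf Hf0] [Hh Hh0]. split.
- intros z Hz. apply ex_Cderive_plus_scal; auto.
- intros z Hz. unfold perturb. rewrite Hf0, Hh0 by exact Hz. ring.
Qed.

Lemma coef_perturb (f h : C -> C) (c : R) (n : nat) :
  hol_disc f -> hol_disc h ->
  coef (perturb f h c) n = (coef f n + RtoC c * coef h n)%C.
Proof.
intros Hf Hh. revert n. apply coef_unique. intros z Hz.
apply is_Cpseries_plus_scal; now apply coef_spec.
Qed.

Lemma Cmod_coef_perturb (f h : C -> C) (c : R) (n : nat) :
  hol_disc f -> lac_coef h -> 0 <= c ->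
  Cmod (coef f n - coef (perturb f h c) n) = c * lac n.
Proof.
intros Hf [Hh Hl] Hc. rewrite coef_perturb, Hl by assumption.
replace (coef f n - (coef f n + RtoC c * RtoC (lac n)))%C
  with (- (RtoC c * RtoC (lac n)))%C by ring.
rewrite Cmod_opp, Cmod_mult, Cmod_lac, Cmod_R, Rabs_pos_eq by exact Hc. reflexivity.
Qed.

Lemma lpa_perturb (p : R) (f h : C -> C) (c : R) :
  0 < p -> lpa p f -> lac_coef h -> lpa p (perturb f h c).
Proof.
intros Hp [Hf Hs] [Hh Hl]. split; [now apply hol_disc_perturb|].
eapply ex_series_ext; [|apply (ex_series_rpow_combine (coef f) (coef h) (RtoC c) p Hp Hs)].
- intros n. simpl. now rewrite coef_perturb.
- eapply ex_series_ext; [|exact (ex_series_rpow_lac p Hp)].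
  intros n. simpl. now rewrite Hl, Cmod_lac.
Qed.

(** The p-th power sum of the difference is exactly [rpow c p * S] with [S] independent of [f], so
    [eta] can precede [f]. *)
Lemma dist_lp_perturb_small (p r : R) (h : C -> C) :
  0 < p -> 0 < r -> lac_coef h ->
  exists eta, 0 < eta /\ forall f c, hol_disc f -> 0 < c < eta ->
    dist_lp p f (perturb f h c) < r.
Proof.
intros Hp Hr Hh. set (S := Series (fun n => rpow (lac n) p)).
assert (HS : 0 <= S).
{ eapply Rle_trans; [|apply (sum_n_le_Series _ 0);
   [intros; apply rpow_ge_0|now apply ex_series_rpow_lac]].
  rewrite sum_O. apply rpow_ge_0. }
assert (Hsmall : forall t, 0 < t -> exists eta, 0 < eta /\
  forall f c, hol_disc f -> 0 < c < eta ->
  0 <= Series (fun n => rpow (Cmod (coef f n - coef (perturb f h c) n)) p) < t).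
{ intros t Ht. destruct (rpow_small p (t / (S + 1)) Hp) as [eta [Heta H]].
  { apply Rdiv_lt_0_compat; lra. }
  exists eta. split; [exact Heta|]. intros f c Hf Hc.
  specialize (H c ltac:(lra)). apply Rlt_div_r in H; [|lra].
  replace (Series _) with (rpow c p * S).
  - assert (H1 := rpow_ge_0 c p). split; [now apply Rmult_le_pos|nra].
  - unfold S. rewrite <- Series_scal_l. apply Series_ext. intros n.
    rewrite Cmod_coef_perturb by (assumption || lra).
    symmetry. apply rpow_mult_distr; [lra|apply lac_bounds]. }
unfold dist_lp. cbv zeta. destruct (Rle_dec 1 p).
- destruct (Hsmall (rpow r p)) as [eta [Heta H]].
  { rewrite rpow_pos by exact Hr. apply exp_pos. }
  exists eta. split; [exact Heta|]. intros f c Hf Hc.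
  rewrite <- (rpow_rpow_inv r p Hp) by lra. apply rpow_lt; [|now apply H].
  apply Rdiv_lt_0_compat; lra.
- destruct (Hsmall r Hr) as [eta [Heta H]]. exists eta. split; [exact Heta|].
  intros f c Hf Hc. now apply H.
Qed.

Lemma lpa_perturbation (p : R) (h : C -> C) :
  0 < p -> lac_coef h -> perturbation_small (lpa p) (dist_lp p) h.
Proof.
intros Hp Hh f r Hf Hr.
destruct (dist_lp_perturb_small p r h Hp Hr Hh) as [eta [Heta H]].
exists eta. split; [exact Heta|]. intros c Hc.
split; [now apply lpa_perturb|]. apply H; [apply Hf|exact Hc].
Qed.

(** Bounds make the [Sup_seq] finite, so that [real] returns the supremum and not its default value
    at infinity. *)
Lemma Sup_seq_bounded (u : nat -> R) (B : R) :
  (forall n, 0 <= u n <= B) ->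
  (forall n, u n <= real (Sup_seq (fun n => Finite (u n)))) /\
  real (Sup_seq (fun n => Finite (u n))) <= B.
Proof.
intros Hu. assert (H := Sup_seq_correct (fun n => Finite (u n))).
destruct (Sup_seq (fun n => Finite (u n))) as [l| |]; simpl in H |- *.
- split.
  + intros n. apply le_epsilon. intros eps Heps.
    apply Rlt_le, (proj1 (H (mkposreal eps Heps)) n).
  + apply le_epsilon. intros eps Heps.
    destruct (proj2 (H (mkposreal eps Heps))) as [n Hn]. simpl in Hn.
    specialize (Hu n). lra.
- destruct (H B) as [n Hn]. specialize (Hu n). lra.
- specialize (H 0 0%nat). specialize (Hu 0%nat). lra.
Qed.

Lemma linfa_dominates : dominates_coef linfa dist_linf.
Proof.
intros del Hdel. exists del. split; [exact Hdel|].
intros f g [_ [M HM]] [_ [N HN]] Hd k. unfold dist_linf in Hd.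
destruct (Sup_seq_bounded (fun n => Cmod (coef f n - coef g n)) (M + N)) as [H _].
- intros n. split; [apply Cmod_ge_0|]. eapply Rle_trans; [apply Cmod_sub_le|].
  specialize (HM n). specialize (HN n). lra.
- specialize (H k). cbv beta in H. lra.
Qed.

Lemma dist_linf_perturb (f h : C -> C) (c : R) :
  hol_disc f -> lac_coef h -> 0 <= c -> dist_linf f (perturb f h c) <= c.
Proof.
intros Hf Hh Hc. unfold dist_linf.
apply (Sup_seq_bounded (fun n => Cmod (coef f n - coef (perturb f h c) n)) c).
intros n. split; [apply Cmod_ge_0|]. rewrite Cmod_coef_perturb by assumption.
assert (H := lac_bounds n). nra.
Qed.

Lemma linfa_perturbation (h : C -> C) :
  lac_coef h -> perturbation_small linfa dist_linf h.
Proof.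
intros Hh f r [Hf [M HM]] Hr. exists r. split; [exact Hr|]. intros c Hc. split.
- split; [apply hol_disc_perturb; [exact Hf|apply Hh]|]. exists (M + c). intros n.
  rewrite coef_perturb by (exact Hf || apply Hh).
  eapply Rle_trans; [apply Cmod_triangle|]. apply Rplus_le_compat; [apply HM|].
  rewrite (proj2 Hh), Cmod_mult, Cmod_lac, Cmod_R, Rabs_pos_eq by lra.
  assert (H := lac_bounds n). nra.
- eapply Rle_lt_trans; [apply dist_linf_perturb; auto; lra|apply Hc].
Qed.

Lemma c0a_linfa (f : C -> C) : c0a f -> linfa f.
Proof.
intros [Hf H0]. split; [exact Hf|].
destruct (proj1 (filterlim_Cmod eventually _ _) H0 1 Rlt_0_1) as [N HN].
apply (bounded_of_tail_bounded (fun n => Cmod (coef f n)) N 1). intros n Hn.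
specialize (HN n Hn). replace (coef f n - 0)%C with (coef f n) in HN by ring. lra.
Qed.

Lemma lac_lim : is_lim_seq lac 0.
Proof.
eapply is_lim_seq_ext; [|exact (ex_series_lim_0 _ (ex_series_rpow_lac 1 Rlt_0_1))].
intros n. simpl. destruct (proj1 (lac_bounds n)) as [H|<-]; [|apply rpow_0].
rewrite rpow_pos by exact H. now apply Rpower_1.
Qed.

Lemma c0a_perturbation (h : C -> C) :
  lac_coef h -> perturbation_small c0a dist_linf h.
Proof.
intros Hh f r [Hf H0] Hr. exists r. split; [exact Hr|]. intros c Hc. split.
- split; [apply hol_disc_perturb; [exact Hf|apply Hh]|].
  apply (filterlim_Cmod eventually). intros eps Heps.
  destruct (proj1 (filterlim_Cmod eventually _ _) H0 (eps / 2) ltac:(lra)) as [N1 H1].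
  assert (He2 : 0 < eps / (2 * c)) by (apply Rdiv_lt_0_compat; lra).
  destruct (proj2 (is_lim_seq_spec lac 0) lac_lim (mkposreal _ He2)) as [N2 H2].
  exists (N1 + N2)%nat. intros n Hn.
  specialize (H1 n ltac:(lia)). specialize (H2 n ltac:(lia)). simpl in H2.
  rewrite Rminus_0_r, Rabs_pos_eq in H2 by apply lac_bounds.
  apply Rlt_div_r in H2; [|lra].
  rewrite coef_perturb by (exact Hf || apply Hh).
  replace (coef f n + RtoC c * coef h n - 0)%C
    with ((coef f n - 0) + RtoC c * coef h n)%C by ring.
  eapply Rle_lt_trans; [apply Cmod_triangle|].
  rewrite (proj2 Hh), Cmod_mult, Cmod_lac, Cmod_R, Rabs_pos_eq by lra. lra.
- eapply Rle_lt_trans; [apply dist_linf_perturb; auto; lra|apply Hc].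
Qed.

Lemma dominates_coef_sub (X Y : (C -> C) -> Prop) (d : (C -> C) -> (C -> C) -> R) :
  (forall f, X f -> Y f) -> dominates_coef Y d -> dominates_coef X d.
Proof.
intros HXY HY del Hdel. destruct (HY del Hdel) as [r [Hr H]].
exists r. split; [exact Hr|]. auto.
Qed.

(** * The intersection spaces and their metric *)

Lemma decreasing_gt_limit (q : R) (p : nat -> R) :
  (forall n, p (S n) < p n) -> is_lim_seq p q -> forall n, q < p n.
Proof.
intros Hp Hl n.
assert (H := is_lim_seq_decr_compare p q Hl (fun n => Rlt_le _ _ (Hp n)) (S n)).
specialize (Hp n). lra.
Qed.

(** The bound [(/ 2) ^ n] is summable and handles large indices; the bound by the distance itself
    handles the finitely many small ones. *)
Lemma Xq_term_bounds (q : R) (p : nat -> R) (f g : C -> C) (n : nat) :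
  0 <= q -> q < p n -> Xq q f -> Xq q g ->
  0 <= dist_lp (p n) f g /\
  0 <= 1 / 2 ^ n * (dist_lp (p n) f g / (1 + dist_lp (p n) f g)) <= (/ 2) ^ n /\
  1 / 2 ^ n * (dist_lp (p n) f g / (1 + dist_lp (p n) f g)) <= (/ 2) ^ n * dist_lp (p n) f g.
Proof.
intros Hq Hp Hf Hg.
assert (Hd := dist_lp_ge_0 (p n) f g ltac:(lra) (Hf _ Hp) (Hg _ Hp)).
set (t := dist_lp (p n) f g) in *.
replace (1 / 2 ^ n) with ((/ 2) ^ n) by (rewrite pow_inv; unfold Rdiv; ring).
assert (H2 : 0 < (/ 2) ^ n) by (apply pow_lt; lra).
assert (H3 : 0 <= t / (1 + t)) by (apply Rdiv_le_0_compat; lra).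
assert (H4 : t / (1 + t) <= 1) by (apply Rle_div_l; lra).
assert (H5 : t / (1 + t) <= t) by (apply Rle_div_l; nra).
split; [exact Hd|]. split; nra.
Qed.

(** The term of index [0] alone suffices: t / (1 + t) is increasing, so it recovers
    [dist_lp (p 0) f g < r] from the distance. *)
Lemma Xq_dominates (q : R) (p : nat -> R) :
  0 <= q -> (forall n, q < p n) -> dominates_coef (Xq q) (dist_Xq p).
Proof.
intros Hq Hp del Hdel.
destruct (lpa_dominates (p 0%nat) ltac:(specialize (Hp 0%nat); lra) del Hdel) as [r [Hr H]].
exists (r / (1 + r)). split; [apply Rdiv_lt_0_compat; lra|].
intros f g Hf Hg Hd. apply H; [now apply Hf|now apply Hg|].
set (b := fun n => 1 / 2 ^ n * (dist_lp (p n) f g / (1 + dist_lp (p n) f g))).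
assert (Hb : forall n, 0 <= b n <= (/ 2) ^ n).
{ intros n. apply (Xq_term_bounds q p f g n Hq (Hp n) Hf Hg). }
assert (H0 : b 0%nat <= dist_Xq p f g).
{ rewrite <- (sum_O b). apply (sum_n_le_Series b); [apply Hb|].
  apply ex_series_le_nonneg with (1 := Hb). apply ex_series_geom.
  rewrite Rabs_pos_eq; lra. }
destruct (Xq_term_bounds q p f g 0 Hq (Hp 0%nat) Hf Hg) as [H1 _].
unfold b in H0. simpl in H0. set (t := dist_lp (p 0%nat) f g) in *.
assert (H2 : t / (1 + t) < r / (1 + r)) by lra.
apply (Rmult_lt_compat_r ((1 + t) * (1 + r))) in H2; [|apply Rmult_lt_0_compat; lra].
replace (t / (1 + t) * ((1 + t) * (1 + r))) with (t * (1 + r)) in H2 by (field; lra).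
replace (r / (1 + r) * ((1 + t) * (1 + r))) with (r * (1 + t)) in H2 by (field; lra).
lra.
Qed.

Lemma Xq_perturbation (q : R) (p : nat -> R) (h : C -> C) :
  0 <= q -> (forall n, q < p n) -> lac_coef h -> perturbation_small (Xq q) (dist_Xq p) h.
Proof.
intros Hq Hp Hh f r Hf Hr.
(* All terms are compared with [r / 8 * (3 / 4) ^ n], whose sum is [r / 2]. Up to [N] the distances
   are below [r / 8]; beyond it, 1/2 = 2/3 * 3/4 and [(2 / 3) ^ n < r / 8]. *)
destruct (pow_lt_1_zero (2 / 3) ltac:(rewrite Rabs_pos_eq; lra) (r / 8) ltac:(lra)) as [N HN].
specialize (HN N (Nat.le_refl N)). rewrite Rabs_pos_eq in HN by (apply pow_le; lra).
assert (Hfh : hol_disc f) by apply (Hf (q + 1) ltac:(lra)).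
assert (Heta : exists eta, 0 < eta /\ forall c n, 0 < c < eta -> (n <= N)%nat ->
  dist_lp (p n) f (perturb f h c) < r / 8).
{ clear HN. induction N as [|N [eta [Heta IH]]].
  - destruct (dist_lp_perturb_small (p 0%nat) (r / 8) h) as [eta [Heta H]];
     [specialize (Hp 0%nat); lra|lra|exact Hh|].
    exists eta. split; [exact Heta|]. intros c n Hc Hn. replace n with 0%nat by lia. auto.
  - destruct (dist_lp_perturb_small (p (S N)) (r / 8) h) as [eta' [Heta' H]];
     [specialize (Hp (S N)); lra|lra|exact Hh|].
    exists (Rmin eta eta'). split; [now apply Rmin_pos|]. intros c n Hc Hn.
    assert (H1 := Rmin_l eta eta'). assert (H2 := Rmin_r eta eta').
    destruct (Nat.eq_dec n (S N)) as [->|Hne]; [apply H; [exact Hfh|lra]|].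
    apply IH; [lra|lia]. }
destruct Heta as [eta [Heta Hd]].
exists eta. split; [exact Heta|]. intros c Hc.
assert (Hg : Xq q (perturb f h c)).
{ intros s Hs. apply lpa_perturb; [lra|now apply Hf|exact Hh]. }
split; [exact Hg|].
apply Rle_lt_trans with (Series (fun n => r / 8 * (3 / 4) ^ n)).
- apply Series_le.
  2: { apply (ex_series_scal_l (r / 8) (fun n => (3 / 4) ^ n)).
    apply ex_series_geom. rewrite Rabs_pos_eq; lra. }
  intros n. destruct (Xq_term_bounds q p f (perturb f h c) n Hq (Hp n) Hf Hg) as [H1 [H2 H3]].
  split; [apply H2|].
  assert (H34 : 0 < (3 / 4) ^ n) by (apply pow_lt; lra).
  destruct (Nat.le_gt_cases n N) as [Hn|Hn].
  + eapply Rle_trans; [exact H3|]. specialize (Hd c n Hc Hn).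
    assert (H4 : (/ 2) ^ n <= (3 / 4) ^ n) by (apply pow_incr; lra).
    assert (H5 : 0 < (/ 2) ^ n) by (apply pow_lt; lra). nra.
  + eapply Rle_trans; [apply H2|].
    replace (/ 2) with (2 / 3 * (3 / 4)) by field. rewrite Rpow_mult_distr.
    apply Rmult_le_compat_r; [lra|].
    replace n with (N + (n - N))%nat by lia. rewrite pow_add.
    assert (H4 : (2 / 3) ^ (n - N) <= 1).
    { rewrite <- (pow1 (n - N)). apply pow_incr. lra. }
    assert (H5 : 0 < (2 / 3) ^ N) by (apply pow_lt; lra).
    assert (H6 : 0 < (2 / 3) ^ (n - N)) by (apply pow_lt; lra). nra.
- rewrite Series_scal_l, Series_geom by (rewrite Rabs_pos_eq; lra). lra.
Qed.

Lemma generic_residual (X : (C -> C) -> Prop) (d : (C -> C) -> (C -> C) -> R) (h : C -> C) :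
  (forall f, X f -> hol_disc f) -> dominates_coef X d ->
  hol_disc h -> totally_unbounded (C_derive h) -> perturbation_small X d h ->
  (Gdelta_in X d (fun f => totally_unbounded (C_derive f)) /\
   dense_in X d (fun f => totally_unbounded (C_derive f))) /\
  (Gdelta_in X d non_extendable /\ dense_in X d non_extendable).
Proof.
intros HX Hd Hh Hu Hp.
assert (Hdense := dense_totally_unbounded X d h HX Hh Hu Hp).
split; split; [now apply Gdelta_totally_unbounded|exact Hdense|now apply Gdelta_non_extendable|].
intros f Xf r Hr. destruct (Hdense f Xf r Hr) as [g [Xg [Hg Hfg]]].
exists g. split; [exact Xg|]. split; [|exact Hfg].
apply totally_unbounded_non_extendable; auto.
Qed.

Theorem theorem7p2 :
  forall (X : (C -> C) -> Prop) (d : (C -> C) -> (C -> C) -> R),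
    is_space X d ->
    (Gdelta_in X d (fun f => totally_unbounded (C_derive f)) /\
     dense_in X d (fun f => totally_unbounded (C_derive f))) /\
    (Gdelta_in X d non_extendable /\ dense_in X d non_extendable).
Proof.
intros X d HX.
destruct lacunary_exists as [h [Hh [Hl Hu]]]. assert (Hlac := conj Hh Hl).
destruct HX as [p Hp| | |q p Hq Hdecr Hlim].
- apply generic_residual with h; auto.
  + intros f Hf. apply Hf.
  + now apply lpa_dominates.
  + now apply lpa_perturbation.
- apply generic_residual with h; auto.
  + intros f Hf. apply Hf.
  + apply linfa_dominates.
  + now apply linfa_perturbation.
- apply generic_residual with h; auto.
  + intros f Hf. apply Hf.
  + apply dominates_coef_sub with linfa; [exact c0a_linfa|apply linfa_dominates].
  + now apply c0a_perturbation.
- assert (Hp := decreasing_gt_limit q p Hdecr Hlim).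
  apply generic_residual with h; auto.
  + intros f Hf. apply (Hf (q + 1)). lra.
  + now apply Xq_dominates.
  + now apply Xq_perturbation.
Qed.
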